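(* Let $q=p-1$, $0<\lambda<\lambda_1$, and $g\in L^1(\Omega)$ with $g\ge0$, $g\not\equiv0$. Then the problem $(-\Delta)^s_{p,\beta}u=\lambda u^{p-1}+g$ in $\Omega$, $u\ge0$ in $\Omega$, $u=0$ in $\mathbb R^N\setminus\Omega$, has a minimal positive entropy solution, i.e. a measurable $u\ge0$ with $u^{p-1}\in L^1(\Omega)$ that is an entropy solution with datum $\lambda u^{p-1}+g$, and such that $u\le\bar u$ a.e. for every other such solution $\bar u$.
   Context: Standing assumptions: $s\in(0,1)$, $1<p<N$, $ps<N$, $0\le\beta<\frac{N-ps}{2}$, and $\Omega\subset\mathbb R^N$ is a smooth bounded domain containing the origin. Set $d\mu=|x|^{-2\beta}dx$ and $d\nu=\frac{dx\,dy}{|x-y|^{N+ps}|x|^\beta|y|^\beta}$. $D_\Omega=(\mathbb R^N\times\mathbb R^N)\setminus\big((\mathbb R^N\setminus\Omega)\times(\mathbb R^N\setminus\Omega)\big)$. $W^{s,p}_{\beta,0}(\Omega)$ is the closure of $C_c^\infty(\Omega)$ under the norm $(\int_\Omega|\phi|^pd\mu)^{1/p}+(\int_\Omega\int_\Omega|\phi(x)-\phi(y)|^pd\nu)^{1/p}$; its elements are extended by $0$ outside $\Omega$. $\lambda_1=\inf_{\phi\in W^{s,p}_{\beta,0}(\Omega),\phi\ne0}\frac{\frac12\iint_{D_\Omega}|\phi(x)-\phi(y)|^pd\nu}{\int_\Omega|\phi|^pdx}$. For $k>0$, $T_k(a)=\max\{-k,\min\{k,a\}\}$. Entropy solution: given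 $f\in L^1(\Omega)$, a measurable $u$ vanishing outside $\Omega$ with $T_k(u)\in W^{s,p}_{\beta,0}(\Omega)$ for all $k>0$ is an entropy solution of $(-\Delta)^s_{p,\beta}u=f$ if (i) $\iint_{R_h}|u(x)-u(y)|^{p-1}d\nu\to0$ as $h\to\infty$, where $R_h=\{(x,y)\in\mathbb R^N\times\mathbb R^N:\ h+1\le\max\{|u(x)|,|u(y)|\}$ and ($\min\{|u(x)|,|u(y)|\}\le h$ or $u(x)u(y)<0$)$\}$; and (ii) for all $k>0$ and all $\varphi\in W^{s,p}_{\beta,0}(\Omega)\cap L^\infty(\Omega)$, $\frac12\iint_{D_\Omega}|u(x)-u(y)|^{p-2}(u(x)-u(y))[T_k(u(x)-\varphi(x))-T_k(u(y)-\varphi(y))]d\nu\le\int_\Omega f\,T_k(u-\varphi)\,dx$. *)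

(* Defs.v *)
(* Points of R^N are N.-tuples of reals,
   equipped with the product Borel sigma-algebra provided by the library. *)
From HB Require Import structures.
From mathcomp Require Import all_boot all_order all_algebra.
From mathcomp Require Import all_classical all_reals all_analysis.

Set Implicit Arguments.
Unset Strict Implicit.
Unset Printing Implicit Defensive.

Import Order.TTheory GRing.Theory Num.Theory.
Import numFieldNormedType.Exports.
Local Open Scope classical_set_scope.
Local Open Scope ring_scope.

Section FracDefs.
Variable R : realType.

Definition enorm {N : nat} (x : N.-tuple R) : R :=
  Num.sqrt (\sum_(i < N) (tnth x i) ^+ 2).
Definition edist {N : nat} (x y : N.-tuple R) : R :=
  Num.sqrt (\sum_(i < N) (tnth x i - tnth y i) ^+ 2).

Definition eopen {N : nat} (A : set (N.-tuple R)) : Prop :=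
  forall x, A x -> exists2 r, 0 < r & forall y, edist x y < r -> A y.

Definition ebounded {N : nat} (A : set (N.-tuple R)) : Prop :=
  exists M : R, forall x, A x -> enorm x <= M.

Definition econnected {N : nat} (A : set (N.-tuple R)) : Prop :=
  forall B C : set (N.-tuple R), eopen B -> eopen C -> B `&` C = set0 ->
    A = B `|` C -> B = set0 \/ C = set0.

(* boundary point of an open set *)
Definition eboundary {N : nat} (A : set (N.-tuple R)) (x0 : N.-tuple R) : Prop :=
  ~ A x0 /\ forall r, 0 < r -> exists2 y, A y & edist x0 y < r.

Definition upd {N : nat} (x : N.-tuple R) (i : 'I_N) (t : R) : N.-tuple R :=
  [tuple if j == i then t else tnth x j | j < N].

Definition econt {N : nat} (f : N.-tuple R -> R) : Prop :=
  forall x e, 0 < e -> exists2 d, 0 < d &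
    forall y, edist x y < d -> `|f x - f y| < e.

Definition pderiv {N : nat} (i : 'I_N) (f : N.-tuple R -> R) : N.-tuple R -> R :=
  fun x => derive1 (fun t => f (upd x i t)) (tnth x i).

Fixpoint Ck {N : nat} (k : nat) (f : N.-tuple R -> R) : Prop :=
  match k with
  | 0 => econt f
  | k'.+1 => econt f /\ forall i : 'I_N,
      (forall x, derivable (fun t => f (upd x i t)) (tnth x i) 1) /\
      Ck k' (pderiv i f)
  end.

Definition smooth {N : nat} (f : N.-tuple R -> R) : Prop := forall k, Ck k f.

(* smooth bounded domain (open, connected, bounded, C^infinity boundary:
   near each boundary point, after relabelling/reorienting an axis, the
   domain is the epigraph of a smooth function of the other coordinates) *)
Definition smooth_bounded_domain {N : nat} (O : set (N.-tuple R)) : Prop :=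
  eopen O /\ econnected O /\ ebounded O /\ O !=set0 /\
  forall x0, eboundary O x0 ->
    exists r, 0 < r /\ exists (i : 'I_N) (b : bool) (gam : N.-tuple R -> R),
      smooth gam /\ (forall x t, gam (upd x i t) = gam x) /\
      forall x, edist x0 x < r ->
        (O x <-> (if b then gam x < tnth x i else tnth x i < gam x)).

Fixpoint iint (n : nat) : (n.-tuple R -> \bar R) -> \bar R :=
  match n return (n.-tuple R -> \bar R) -> \bar R with
  | 0 => fun F => F [tuple]
  | n'.+1 => fun F =>
      (\int[@lebesgue_measure R]_x iint (fun t : n'.-tuple R => F (cons_tuple x t)))%E
  end.

Definition intN {N : nat} (f : N.-tuple R -> R) : \bar R :=
  (iint (fun x => (Num.max (f x) 0)%:E) - iint (fun x => (Num.max (- f x) 0)%:E))%E.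

Definition int2N {N : nat} (F : N.-tuple R -> N.-tuple R -> R) : \bar R :=
  (iint (fun x => iint (fun y => (Num.max (F x y) 0)%:E)) -
   iint (fun x => iint (fun y => (Num.max (- F x y) 0)%:E)))%E.

Definition aeN {N : nat} (P : N.-tuple R -> Prop) : Prop :=
  exists A : set (N.-tuple R), measurable A /\
    iint (fun x => (\1_A x : R)%:E) = 0%E /\ (fun x => ~ P x) `<=` A.

Definition meas {N : nat} (f : N.-tuple R -> R) : Prop :=
  measurable_fun [set: N.-tuple R] f.

Definition L1on {N : nat} (O : set (N.-tuple R)) (f : N.-tuple R -> R) : Prop :=
  meas f /\ (intN (fun x => (\1_O x * `|f x|)%R) < +oo)%E.

Variables (N : nat) (p s beta : R) (O : set (N.-tuple R)).

Definition wmu (x : N.-tuple R) : R := enorm x `^ (- (2 * beta)).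
Definition knu (x y : N.-tuple R) : R :=
  (edist x y `^ (N%:R + p * s) * enorm x `^ beta * enorm y `^ beta)^-1.

Definition Ipmu (phi : N.-tuple R -> R) : \bar R :=
  intN (fun x => \1_O x * `|phi x| `^ p * wmu x).
Definition Gag (phi : N.-tuple R -> R) : \bar R :=
  int2N (fun x y => \1_O x * \1_O y * `|phi x - phi y| `^ p * knu x y).
Definition indD (x y : N.-tuple R) : R :=
  if `[< O x \/ O y >] then 1 else 0.
Definition GagD (phi : N.-tuple R -> R) : \bar R :=
  ((2^-1)%:E * int2N (fun x y => (indD x y * `|phi x - phi y| `^ p * knu x y)%R))%E.

(* C_c^infinity(O): smooth with compact support inside O
   (equivalently, since O is bounded: support at positive distance from
   the complement of O) *)
Definition Ccinf (phi : N.-tuple R -> R) : Prop :=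
  smooth phi /\ exists2 d, 0 < d &
    forall x, phi x != 0 -> forall y, edist x y < d -> O y.

(* W^{s,p}_{beta,0}(O): the closure of C_c^infinity(O) under
   ||.||_{L^p(mu)} + [.]_{nu}, elements extended by 0 outside O *)
Definition W0 (u : N.-tuple R -> R) : Prop :=
  meas u /\ (forall x, ~ O x -> u x = 0) /\
  exists phi : nat -> N.-tuple R -> R, (forall n, Ccinf (phi n)) /\
    forall e : R, 0 < e -> exists n0, forall n, (n0 <= n)%N ->
      (Ipmu (fun x => (phi n x - u x)%R) < e%:E)%E /\
      (Gag (fun x => (phi n x - u x)%R) < e%:E)%E.

Definition lambda1 : \bar R :=
  ereal_inf [set r | exists phi, W0 phi /\ ~ aeN (fun x => phi x = 0) /\
     r = (GagD phi * ((fine (intN (fun x => (\1_O x * `|phi x| `^ p)%R)))^-1)%:E)%E].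

Definition Tk (k a : R) : R := Num.max (- k) (Num.min k a).

Definition Linf (phi : N.-tuple R -> R) : Prop :=
  exists M : R, aeN (fun x => O x -> `|phi x| <= M).

Definition Rh (u : N.-tuple R -> R) (h : R) (x y : N.-tuple R) : Prop :=
  h + 1 <= Num.max `|u x| `|u y| /\
  (Num.min `|u x| `|u y| <= h \/ u x * u y < 0).

Definition entropy_solution (f u : N.-tuple R -> R) : Prop :=
  meas u /\ (forall x, ~ O x -> u x = 0) /\
  (forall k, 0 < k -> W0 (fun x => Tk k (u x))) /\
  (forall e, 0 < e -> exists H : R, forall h, H <= h ->
     (int2N (fun x y => ((if `[< Rh u h x y >] then 1 else 0) *
        `|u x - u y| `^ (p - 1) * knu x y)%R) < e%:E)%E) /\
  (forall k phi, 0 < k -> W0 phi -> Linf phi ->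
     ((2^-1)%:E * int2N (fun x y => (indD x y *
        (`|u x - u y| `^ (p - 2) * (u x - u y)) *
        (Tk k (u x - phi x) - Tk k (u y - phi y)) * knu x y)%R)
      <= intN (fun x => (\1_O x * f x * Tk k (u x - phi x))%R))%E).

Definition nonneg_entropy_sol (lam : R) (g u : N.-tuple R -> R) : Prop :=
  meas u /\ (forall x, 0 <= u x) /\
  L1on O (fun x => u x `^ (p - 1)) /\
  entropy_solution (fun x => lam * u x `^ (p - 1) + g x) u.

End FracDefs.

(* Main.v *)
(** Proof idea.  Write [K = 1/2 1_D nu], [E v] for the integral of [K |v(x) - v(y)|^p]
    and [W] for the space W^{s,p}_{beta,0}(O).  Minimizing [E v / p - \int f v] over the
    [v] in [W] with [|v| <= n] (uniform convexity of [|.|^p] makes minimizing sequences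
    converge) and testing the resulting variational inequality gives a bounded [u] with
    [<A u, T_k (u - phi)> <= \int f T_k (u - phi)].  The solution is the limit of the
    increasing iteration [u_{n+1}] := such a solution at level [n + 1] with datum
    [lam u_n^(p-1) + g].  Every nonnegative entropy solution [v] lies above all [u_n]:
    test [v] with [phi = max (T_h v) u_n] and let [h] go to infinity; hence minimality.

    The bound on [\int u_n^(p-1)] uses [lam < lambda1] on truncations together with the
    gain [|E'| <= C |E|^(ps/N) \int_(E' x E^c) K], for [E' <= E <= O], which comes
    from comparing [E] with a cube of twice its measure.  Truncations of the limit are
    in [W] because near-minimizers of the energy between [T_k u_m] and [T_k u] are
    Cauchy; the entropy inequality passes to the limit by Fatou's lemma, its negative
    part being controlled by truncated energies; the decay on [R_h] follows by testing
    with [phi = T_h u], [k = 1].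

    That W^{s,p}_{beta,0}(O) is stable under [max (. - k) 0] is seen by composing
    approximating test functions with softplus functions. *)
Require Import Defs.
From HB Require Import structures.
From mathcomp Require Import all_boot all_order all_algebra.
From mathcomp Require Import all_classical all_reals all_analysis.
From mathcomp Require Import measurable_realfun ring lra.
Import Order.TTheory GRing.Theory Num.Theory.
Import numFieldNormedType.Exports.
Import Defs.
Local Open Scope classical_set_scope.
Local Open Scope ring_scope.
Set Implicit Arguments.
Unset Strict Implicit.
Unset Printing Implicit Defensive.

(** The seminorm of [W0] integrates over O x O only, while the form integrates over D, which also
    contains pairs with one point outside O. Finite energy is therefore not part of membership in
    [W0]: [fin_energy] is carried as a separate hypothesis, and the test functions of the entropy
    inequality are approximated with control on O x O alone. What happens across the boundary is
    governed by a flux bound, obtained by testing u_n with T_k u_n / k as k tends to 0.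

    The second obstacle is that u^(p-1) is merely in L^1. The condition lam < lambda1 concerns p-th
    powers of elements of [W0], so it reaches u only through T_k u and misses the mass of u^(p-1)
    above level k. The gain of measure makes that mass decay geometrically along doubled levels, up
    to a multiple of the mass of g, and then the total mass can be absorbed.

    All of this is done for an [admissible] kernel and space over a sigma-finite measure; iterated
    integrals, smoothness and the weights enter only when R^N is shown to be an instance. *)

Section power_inequalities.
Context {R : realType}.
Implicit Types a b x y p r e k : R.

(** The flux of the p-Laplacian. The factor [a] makes the value at 0 equal to 0 for every p,
    whatever the convention for a negative power of 0. *)
Definition Phi p a : R := `|a| `^ (p - 2) * a.

Lemma powR_le r x y : 0 <= r -> 0 <= x -> x <= y -> x `^ r <= y `^ r.
Proof.
move=> r0 x0 xy; apply: ge0_ler_powR => //; rewrite nnegrE //.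
exact: le_trans xy.
Qed.

Lemma powR_lt r x y : 0 < r -> 0 <= x -> x < y -> x `^ r < y `^ r.
Proof.
move=> r0 x0 xy; apply: gt0_ltr_powR => //; rewrite nnegrE //.
exact: le_trans (ltW xy).
Qed.

Lemma norm_Phi p a : 1 < p -> `|Phi p a| = `|a| `^ (p - 1).
Proof.
move=> p1; rewrite /Phi normrM (ger0_norm (powR_ge0 _ _)).
have [->|a0] := eqVneq a 0.
  by rewrite normr0 mulr0 powR0 // subr_eq0 gt_eqF.
rewrite -[X in _ * X]powRr1 // -powRD; last by rewrite normr_eq0 a0 implybT.
by congr (_ `^ _); lra.
Qed.

Lemma Phi_ge0E p a : 1 < p -> 0 <= a -> Phi p a = a `^ (p - 1).
Proof.
move=> p1 a0; rewrite -[in RHS](ger0_norm a0) -norm_Phi // ger0_norm //.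
by rewrite /Phi mulr_ge0 // powR_ge0.
Qed.

Lemma PhiN p a : Phi p (- a) = - Phi p a.
Proof. by rewrite /Phi normrN mulrN. Qed.

Lemma Phi0 p : Phi p 0 = 0. Proof. by rewrite /Phi mulr0. Qed.

Lemma powRB1_mul p a : 1 < p -> 0 <= a -> a `^ (p - 1) * a = a `^ p.
Proof. by move=> p1 a0; rewrite mulrC mulr_powRB1 //; lra. Qed.

Lemma Phi_mul_self p a : 1 < p -> Phi p a * a = `|a| `^ p.
Proof.
move=> p1; have [a0|a0] := leP 0 a.
  by rewrite Phi_ge0E // powRB1_mul // ger0_norm.
have na0 : 0 <= - a by lra.
rewrite -[in LHS](opprK a) PhiN mulrNN Phi_ge0E // powRB1_mul //.
by rewrite ltr0_norm.
Qed.

Lemma Phi_lt p a b : 1 < p -> a < b -> Phi p a < Phi p b.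
Proof.
move=> p1 ab; have q0 : 0 < p - 1 by lra.
have [a0|a0] := leP 0 a.
  by rewrite !Phi_ge0E //; [exact: powR_lt|lra].
have na : Phi p a < 0.
  rewrite -oppr_gt0 -PhiN Phi_ge0E //; last lra.
  by apply: powR_gt0; lra.
have [b0|b0] := leP 0 b.
  by rewrite (lt_le_trans na) // Phi_ge0E // powR_ge0.
rewrite -ltrN2 -!PhiN !Phi_ge0E //; try lra.
by apply: powR_lt => //; lra.
Qed.

Lemma Phi_le p a b : 1 < p -> a <= b -> Phi p a <= Phi p b.
Proof.
move=> p1; rewrite le_eqVlt => /predU1P[->//|ab]; exact/ltW/Phi_lt.
Qed.

(** The cases [b <= e * a] and [e * a < b] each yield one of the two terms. The small factor is put
    on the power of [a], which will be a truncated energy known only to be bounded. *)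
Lemma young_eps p e a b : 1 < p -> 0 < e -> 0 <= a -> 0 <= b ->
  a `^ (p - 1) * b <= e * a `^ p + e `^ (1 - p) * b `^ p.
Proof.
move=> p1 e0 a0 b0; have q0 : 0 <= p - 1 by lra.
have [h|h] := leP b (e * a).
  apply: (@le_trans _ _ (e * a `^ p)).
    rewrite -(powRB1_mul p1 a0) mulrCA; apply: ler_wpM2l => //; exact: powR_ge0.
  by rewrite lerDl mulr_ge0 ?powR_ge0.
apply: (@le_trans _ _ (e `^ (1 - p) * b `^ p)); last first.
  by rewrite lerDr mulr_ge0 ?powR_ge0 // ltW.
rewrite -(powRB1_mul p1 b0) mulrA; apply: ler_wpM2r => //.
have -> : e `^ (1 - p) = (e^-1) `^ (p - 1).
  by rewrite -powR_inv1 ?ltW // -powRrM; congr (_ `^ _); lra.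
rewrite -powRM //; last by rewrite invr_ge0 ltW.
apply: powR_le => //; rewrite mulrC ler_pdivlMr // mulrC; exact: ltW.
Qed.

Lemma young_norm p a b : 1 < p -> 0 <= a -> 0 <= b ->
  a `^ (p - 1) * b <= a `^ p + b `^ p.
Proof.
by move=> p1 a0 b0; have := young_eps p1 (@ltr01 R) a0 b0; rewrite powR1 !mul1r.
Qed.

(** Convexity of the p-th power, derived from Young's inequality for the product of [Phi p x] and
    [y]; points at 0 and changes of sign need no separate treatment. *)
Lemma powR_tangent p x y : 1 < p ->
  `|x| `^ p + p * (Phi p x * (y - x)) <= `|y| `^ p.
Proof.
move=> p1; have p0 : 0 < p by lra.
have q0 : 0 < p - 1 by lra.
rewrite mulrBr Phi_mul_self //.
have h1 : Phi p x * y <= `|x| `^ (p - 1) * `|y|.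
  by rewrite -norm_Phi // -normrM ler_norm.
have h2 : `|x| `^ (p - 1) * `|y| <=
    (`|x| `^ (p - 1)) `^ (p / (p - 1)) / (p / (p - 1)) + `|y| `^ p / p.
  apply: conjugate_powR => //; first by rewrite divr_gt0.
  by rewrite invf_div -[X in _ + X]mul1r -mulrDl subrK divff // gt_eqF.
have h3 : (`|x| `^ (p - 1)) `^ (p / (p - 1)) = `|x| `^ p.
  by rewrite -powRrM mulrC divfK // gt_eqF.
move: h2; rewrite h3 invf_div => h2.
have h4 : p * (Phi p x * y) <= (p - 1) * `|x| `^ p + `|y| `^ p.
  have -> : (p - 1) * `|x| `^ p + `|y| `^ p =
     p * (`|x| `^ p * ((p - 1) / p) + `|y| `^ p / p).
    by field; rewrite gt_eqF.
  by rewrite ler_pM2l //; exact: le_trans h2.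
lra.
Qed.

(** Strictness comes from an intermediate point: with [d] halfway between [a] and the midpoint [c],
    the tangent inequalities from [d] to [a], from [c] to [d] and from [c] to [b] add up to the
    midpoint inequality with a surplus of p (Phi d - Phi c) (a - d), positive by strict
    monotonicity. *)
Lemma powR_midpoint_lt p a b : 1 < p -> a != b ->
  `|(a + b) / 2| `^ p < (`|a| `^ p + `|b| `^ p) / 2.
Proof.
move=> p1 ab; set c := (a + b) / 2.
have p0 : 0 < p by lra.
pose d := (a + c) / 2.
have h1 := powR_tangent d a p1.
have h2 := powR_tangent c d p1.
have h3 := powR_tangent c b p1.
have h4 : 0 < (Phi p d - Phi p c) * (a - d).
  have [lt|lt|e] := ltgtP a b; last by rewrite e eqxx in ab.
    have dc : d < c by rewrite /d /c; lra.
    have := Phi_lt p1 dc => h; rewrite nmulr_rgt0; [rewrite /d /c; lra|lra].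
  have dc : c < d by rewrite /d /c; lra.
  have := Phi_lt p1 dc => h; rewrite pmulr_rgt0; [rewrite /d /c; lra|lra].
have e1 : d - c = a - d by rewrite /d /c; lra.
have e2 : b - c = - (2 * (a - d)) by rewrite /d /c; lra.
rewrite e1 in h2; rewrite e2 in h3.
have h5 : 0 < p * ((Phi p d - Phi p c) * (a - d)) by rewrite mulr_gt0.
rewrite mulrBl in h5; nra.
Qed.

Lemma normr_powR_continuous r : 0 < r -> continuous (fun t : R => `|t| `^ r).
Proof.
move=> r0 x; have [->|x0] := eqVneq x 0.
  rewrite /continuous_at normr0 powR0 ?gt_eqF //; apply/cvgr0Pnorm_lt => e e0.
  near=> t; rewrite ger0_norm ?powR_ge0 //.
  have -> : e = (e `^ (r^-1)) `^ r.
    by rewrite -powRrM mulVf ?gt_eqF // powRr1 // ltW.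
  apply: powR_lt => //; near: t.
  apply/nbhs_ballP; exists (e `^ r^-1) => /=; first exact: powR_gt0.
  by move=> t; rewrite /ball /= sub0r normrN.
have xp : 0 < `|x| by rewrite normr_gt0.
apply: (@continuous_comp _ _ _ (fun t : R => `|t|) (fun t : R => t `^ r) x).
  exact: norm_continuous.
apply: differentiable_continuous; apply/derivable1_diffP.
by apply: derivable_powR; rewrite in_itv /= xp.
Unshelve. all: by end_near. Qed.

(** For p < 2 the factor |a|^(p-2) is unbounded near 0; writing [Phi] as a difference of powers of
    the positive and the negative part leaves positive exponents only. *)
Lemma Phi_continuous p : 1 < p -> continuous (Phi p).
Proof.
move=> p1; have q0 : 0 < p - 1 by lra.
have -> : Phi p = (fun a => `|(a + `|a|) / 2| `^ (p - 1)
                          - `|(- a + `|a|) / 2| `^ (p - 1)).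
  apply/funext => a; have [a0|a0] := leP 0 a.
    rewrite (_ : (a + _) / 2 = a); last by rewrite ger0_norm //; lra.
    rewrite (_ : (- a + _) / 2 = 0); last by rewrite ger0_norm //; lra.
    by rewrite Phi_ge0E // normr0 powR0 ?gt_eqF // subr0 ger0_norm.
  rewrite (_ : (a + _) / 2 = 0); last by rewrite ltr0_norm //; lra.
  rewrite (_ : (- a + _) / 2 = - a); last by rewrite ltr0_norm //; lra.
  rewrite -[in LHS](opprK a) PhiN Phi_ge0E; [|lra|lra].
  by rewrite normr0 powR0 ?gt_eqF // sub0r ger0_norm //; lra.
move=> a; apply: cvgB.
  apply: (@continuous_comp _ _ _ (fun a : R => (a + `|a|) / 2)
    (fun t : R => `|t| `^ (p - 1)) a); last first.
    exact: normr_powR_continuous.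
  by apply: cvgMl; apply: cvgD; [exact: cvg_id|exact: norm_continuous].
apply: (@continuous_comp _ _ _ (fun a : R => (- a + `|a|) / 2)
  (fun t : R => `|t| `^ (p - 1)) a); last first.
  exact: normr_powR_continuous.
apply: cvgMl; apply: cvgD; last exact: norm_continuous.
by apply: cvgN; exact: cvg_id.
Qed.

Lemma powR_normD p a b : 0 < p ->
  `|a + b| `^ p <= 2 `^ p * (`|a| `^ p + `|b| `^ p).
Proof.
move=> p0; wlog ab : a b / `|a| <= `|b|.
  move=> h; have [ab|/ltW ba] := leP `|a| `|b|; first exact: h.
  by rewrite addrC [X in _ * X]addrC; exact: h.
apply: (@le_trans _ _ (2 `^ p * `|b| `^ p)); last first.
  by rewrite ler_wpM2l ?powR_ge0 // lerDr powR_ge0.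
rewrite -powRM //; apply: powR_le; [exact: ltW|exact: normr_ge0|].
by rewrite (le_trans (ler_normD _ _)) //; lra.
Qed.

Lemma powR_unif_convex_aux p e : 1 < p -> 0 < e -> exists2 C, 0 < C &
  forall t, -1 <= t <= 1 -> `|1 - t| `^ p <=
    e + C * ((1 + `|t| `^ p) / 2 - `|(1 + t) / 2| `^ p).
Proof.
move=> p1 e0; have p0 : 0 < p by lra.
pose g t : R := (1 + `|t| `^ p) / 2 - `|(1 + t) / 2| `^ p.
have g0 t : t != 1 -> 0 < g t.
  rewrite eq_sym => t1; have := powR_midpoint_lt p1 t1.
  by rewrite normr1 powR1 subr_gt0.
have g1 t : 0 <= g t.
  have [->|/g0/ltW//] := eqVneq t 1.
  rewrite /g normr1 powR1 (_ : (1 + 1) / 2 = 1 :> R); last by lra.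
  by rewrite normr1 powR1; lra.
have cg : continuous g.
  move=> t; apply: cvgB.
    by apply: cvgMl; apply: cvgD; [exact: cvg_cst|exact: normr_powR_continuous].
  apply: (@continuous_comp _ _ _ (fun a : R => (1 + a) / 2)
    (fun t : R => `|t| `^ p) t); last first.
    exact: normr_powR_continuous.
  by apply: cvgMl; apply: cvgD; [exact: cvg_cst|exact: cvg_id].
pose d := e `^ p^-1.
have d0 : 0 < d by exact: powR_gt0.
have [d2|d2] := leP 2 d.
  exists 1 => // t /andP[t1 t2]; rewrite mul1r.
  apply: (@le_trans _ _ e); last by rewrite lerDl; exact: g1.
  have -> : e = d `^ p by rewrite /d -powRrM mulVf ?gt_eqF // powRr1 // ltW.
  by apply: powR_le; [exact: ltW| exact: normr_ge0|rewrite ger0_norm; lra].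
have d1 : -1 <= 1 - d by lra.
have [|c cI cmin] := @EVT_min R g (-1) (1 - d) d1.
  exact: continuous_subspaceT.
have c1 : c != 1 by apply/eqP => c1; move: cI; rewrite c1 in_itv /=; lra.
(* [g c] is the least convexity gap on [-1, 1 - d], positive because c differs from 1, and |1 - t|
   never exceeds 2. For t beyond 1 - d the term [e] alone suffices, since d^p = e. *)
exists (2 `^ p / g c); first by rewrite divr_gt0 ?g0 ?powR_gt0.
move=> t /andP[t1 t2]; have [td|td] := leP t (1 - d).
  apply: (@le_trans _ _ (2 `^ p / g c * g t)); last by rewrite lerDr ltW.
  apply: (@le_trans _ _ (2 `^ p)).
    by apply: powR_le; [exact: ltW|exact: normr_ge0|rewrite ger0_norm; lra].
  rewrite -mulrA ler_peMr ?powR_ge0 // ler_pdivlMl ?g0 // mulr1.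
  by apply: cmin; rewrite in_itv /=; lra.
apply: (@le_trans _ _ e); last first.
  by rewrite lerDl mulr_ge0 // ?g1 // divr_ge0 ?powR_ge0.
have -> : e = d `^ p by rewrite /d -powRrM mulVf ?gt_eqF // powRr1 // ltW.
by apply: powR_le; [exact: ltW| exact: normr_ge0|rewrite ger0_norm; lra].
Qed.

(* By homogeneity this reduces to [a = 1] and [b] in [-1, 1], where strict convexity
   and compactness give the constant. *)
Lemma powR_unif_convex p e : 1 < p -> 0 < e -> exists2 C, 0 < C & forall a b,
  `|a - b| `^ p <= e * (`|a| `^ p + `|b| `^ p) +
    C * ((`|a| `^ p + `|b| `^ p) / 2 - `|(a + b) / 2| `^ p).
Proof.
move=> p1 e0; have p0 : 0 < p by lra.
have [C C0 HC] := powR_unif_convex_aux p1 e0.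
exists C => // a b; wlog ab : a b / `|b| <= `|a|.
  move=> h; have [ab|/ltW ba] := leP `|b| `|a|; first exact: h.
  by rewrite distrC [a + b]addrC [_ `^ _ + _]addrC; exact: h.
have [a0|a0] := eqVneq a 0.
  move: ab; rewrite a0 normr0 normr_le0 => /eqP ->.
  rewrite subr0 addr0 mul0r !normr0 powR0 ?gt_eqF //; lra.
have t1 : -1 <= b / a <= 1.
  by rewrite -ler_norml normf_div ler_pdivrMr ?normr_gt0 // mul1r.
have ap : 0 <= `|a| `^ p by exact: powR_ge0.
have := ler_wpM2l ap (HC _ t1).
have sc z w : w = a * z -> `|a| `^ p * `|z| `^ p = `|w| `^ p.
  by move=> ->; rewrite normrM powRM.
have -> : `|a| `^ p * `|1 - b / a| `^ p = `|a - b| `^ p.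
  by apply: sc; field.
have e1 : `|a| `^ p * `|b / a| `^ p = `|b| `^ p by apply: sc; field.
have e2 : `|a| `^ p * `|(1 + b / a) / 2| `^ p = `|(a + b) / 2| `^ p.
  by apply: sc; field.
have -> : `|a| `^ p * (e + C * ((1 + `|b / a| `^ p) / 2 - `|(1 + b / a) / 2| `^ p))
  = e * `|a| `^ p + C * ((`|a| `^ p + `|b| `^ p) / 2 - `|(a + b) / 2| `^ p).
  by rewrite -e1 -e2; field.
move=> h; apply: (le_trans h); rewrite lerD2r; apply: ler_wpM2l; first exact: ltW.
by rewrite lerDl powR_ge0.
Qed.

End power_inequalities.

(** * Integration of real-valued functions and convergence theorems *)

Section real_integral.
Context {d : measure_display} {T : measurableType d} {R : realType}.
Variable m : {measure set T -> \bar R}.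
Implicit Types f g : T -> R.

Definition igr f := m.-integrable setT (EFin \o f).

Lemma igr_meas f : igr f -> measurable_fun setT f.
Proof. by move=> /(measurable_int m) /measurable_EFinP. Qed.

Lemma igr_le f g : measurable_fun setT f -> (forall x, `|f x| <= g x) ->
  igr g -> igr f.
Proof.
move=> mf fg ig; apply: (@le_integrable _ _ _ m setT measurableT _ (EFin \o g)) => //.
  exact/measurable_EFinP.
move=> x _ /=; rewrite !lee_fin; exact: le_trans (fg x) (ler_norm _).
Qed.

Lemma igrD f g : igr f -> igr g -> igr (fun x => f x + g x).
Proof. by move=> h1 h2; have := integrableD measurableT h1 h2. Qed.

Lemma igrZ (k : R) f : igr f -> igr (fun x => k * f x).
Proof. by move=> h; have := integrableZl measurableT k h. Qed.

Lemma igrB f g : igr f -> igr g -> igr (fun x => f x - g x).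
Proof. by move=> h1 h2; have := integrableB measurableT h1 h2. Qed.

Lemma igr0 : igr (fun=> 0).
Proof. exact: integrable0. Qed.

Lemma igr_ge0P f : measurable_fun setT f -> (forall x, 0 <= f x) ->
  igr f <-> (\int[m]_x (f x)%:E < +oo)%E.
Proof.
move=> mf f0; have e : (\int[m]_x (f x)%:E = \int[m]_x `|(f x)%:E|)%E.
  by apply: eq_integral => x _ /=; rewrite ger0_norm.
split=> [/integrableP[_]|h]; first by rewrite e.
by apply/integrableP; split; [exact/measurable_EFinP|rewrite -e].
Qed.

Lemma EFin_Rintegral f : igr f ->
  (\int[m]_x (f x)%:E)%E = (Rintegral m setT f)%:E.
Proof. by move=> h; rewrite /Rintegral fineK //; exact: integrable_fin_num. Qed.

Lemma Rint_D f g : igr f -> igr g -> Rintegral m setT (fun x => f x + g x) =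
  Rintegral m setT f + Rintegral m setT g.
Proof. exact: RintegralD. Qed.

Lemma Rint_B f g : igr f -> igr g -> Rintegral m setT (fun x => f x - g x) =
  Rintegral m setT f - Rintegral m setT g.
Proof. exact: RintegralB. Qed.

Lemma Rint_Z (k : R) f : igr f -> Rintegral m setT (fun x => k * f x) =
  k * Rintegral m setT f.
Proof. by move=> h; rewrite RintegralZl. Qed.

Lemma Rint_le f g : igr f -> igr g -> (forall x, f x <= g x) ->
  Rintegral m setT f <= Rintegral m setT g.
Proof. by move=> h1 h2 h; apply: le_Rintegral => // x _; exact: h. Qed.

Lemma Rint_ge0 f : (forall x, 0 <= f x) -> 0 <= Rintegral m setT f.
Proof. by move=> h; apply: Rintegral_ge0. Qed.

Lemma igr_ae f g : {ae m, forall x, f x = g x} -> measurable_fun setT g ->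
  igr f -> igr g /\ Rintegral m setT f = Rintegral m setT g.
Proof.
move=> fg mg if_; have mf := igr_meas if_.
have e : ae_eq m setT (EFin \o f) (EFin \o g).
  by apply: filterS fg => x /= ->.
split; last first.
  by rewrite /Rintegral; congr fine; apply: ae_eq_integral => //;
    exact/measurable_EFinP.
have e' : ae_eq m setT (abse \o (EFin \o f)) (abse \o (EFin \o g)).
  by apply: filterS fg => x /= ->.
apply/integrableP; split; first exact/measurable_EFinP.
have /integrableP[_ h] := if_; rewrite (le_lt_trans _ h) //.
rewrite (@ae_eq_integral _ _ _ m setT (abse \o (EFin \o f)) (abse \o (EFin \o g))) //.
- by apply: measurableT_comp => //; exact/measurable_EFinP.
- by apply: measurableT_comp => //; exact/measurable_EFinP.
- by apply: filterS e' => x h2 Tx; rewrite h2.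
Qed.

Lemma Rint_le_ae f g : igr f -> igr g -> {ae m, forall x, f x <= g x} ->
  Rintegral m setT f <= Rintegral m setT g.
Proof.
move=> h1 h2 fg; have mf := igr_meas h1; have mg := igr_meas h2.
pose g' x := Num.max (f x) (g x).
have mg' : measurable_fun setT g' by exact: measurable_maxr.
have [h3 ->] : igr g' /\ Rintegral m setT g = Rintegral m setT g'.
  apply: igr_ae => //; apply: filterS fg => x h; rewrite /g'.
  by apply/esym/max_idPr.
by apply: Rint_le => // x; rewrite /g' le_max lexx.
Qed.

Lemma Rint_eq0_ae f : igr f -> (forall x, 0 <= f x) ->
  Rintegral m setT f <= 0 -> {ae m, forall x, f x = 0}.
Proof.
move=> h f0 h0; have mf := igr_meas h.
have e0 : Rintegral m setT f = 0.
  by apply/eqP; rewrite eq_le h0 Rint_ge0.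
have := EFin_Rintegral h; rewrite e0 => e.
have : (\int[m]_x `|(EFin \o f) x| = 0)%E.
  by rewrite -[RHS]e; apply: eq_integral => x _ /=; rewrite ger0_norm.
move/(ae_eq_integral_abs m measurableT (proj2 (measurable_EFinP _ _) mf)).
by apply: filterS => x /(_ I) /= [].
Qed.

Lemma limn_einf_le (u : (\bar R)^nat) (B : \bar R) :
  (\forall n \near \oo, u n <= B)%E -> (limn_einf u <= B)%E.
Proof.
move=> [N _ h]; rewrite limn_einf_lim; apply: lime_le.
  exact: is_cvg_einfs.
apply: nearW => n; apply: (@le_trans _ _ (u (maxn n N))).
  by apply: ereal_inf_lbound; exists (maxn n N) => //=; rewrite leq_maxl.
by apply: h => /=; rewrite leq_maxr.
Qed.

Lemma fatou_real (f_ : nat -> T -> R) f (B : R) :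
  (forall n, igr (f_ n)) -> (forall n x, 0 <= f_ n x) ->
  measurable_fun setT f -> (forall x, 0 <= f x) ->
  {ae m, forall x, f_ n x @[n --> \oo] --> f x} ->
  (\forall n \near \oo, Rintegral m setT (f_ n) <= B) ->
  igr f /\ Rintegral m setT f <= B.
Proof.
move=> if_ f_0 mf f0 [N [mN N0 cN]] hB.
have mf_ n := igr_meas (if_ n).
have key : (\int[m]_x (f x)%:E <= B%:E)%E.
  have mEf : measurable_fun setT (EFin \o f) by exact/measurable_EFinP.
  (* The null set is removed first, so that the limit can be rewritten at every remaining point as a
     lower limit. *)
  have -> : (\int[m]_x (f x)%:E = \int[m]_(x in setT `\` N) (f x)%:E)%E.
    by apply: ge0_negligible_integral => // x _; rewrite lee_fin.
  rewrite setTD.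
  have -> : (\int[m]_(x in ~` N) (f x)%:E =
      \int[m]_(x in ~` N) limn_einf (fun n => (f_ n x)%:E))%E.
    apply: eq_integral => x; rewrite inE => xN.
    have : (f_ n x)%:E @[n --> \oo] --> (f x)%:E.
      apply/cvg_EFin; first by apply: nearW.
      by have := contra_not (cN x) xN; rewrite /= not_notE.
    by move/cvg_limn_einf_sup => [-> _].
  apply: le_trans.
    apply: (fatou m (measurableC mN)) => //.
    by move=> n; apply: measurable_funTS; exact/measurable_EFinP.
    by move=> n x _; rewrite lee_fin.
  apply: limn_einf_le; apply: filterS hB => n h.
  apply: (@le_trans _ _ (\int[m]_x (f_ n x)%:E)%E); last first.
    by rewrite EFin_Rintegral // lee_fin.
  apply: ge0_subset_integral => //; first exact: measurableC.
    exact/measurable_EFinP.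
  by move=> x _; rewrite lee_fin.
have if0 : igr f by apply/igr_ge0P => //; exact: le_lt_trans key (ltry _).
by split=> //; move: key; rewrite EFin_Rintegral // lee_fin.
Qed.

Lemma dominated_real (f_ : nat -> T -> R) f g :
  (forall n, measurable_fun setT (f_ n)) -> measurable_fun setT f ->
  {ae m, forall x, f_ n x @[n --> \oo] --> f x} -> igr g ->
  (forall n, {ae m, forall x, `|f_ n x| <= g x}) ->
  igr f /\ Rintegral m setT (f_ n) @[n --> \oo] --> Rintegral m setT f.
Proof.
move=> mf_ mf c ig h.
have [|||||h1 _ h2] := @dominated_convergence _ _ _ m setT measurableT
  (fun n x => (f_ n x)%:E) (EFin \o f) (EFin \o g).
- by move=> n; exact/measurable_EFinP.
- exact/measurable_EFinP.
- by apply: filterS c => x cx _; apply/cvg_EFin; first exact: nearW.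
- exact: ig.
- apply: filterS (ae_foralln h) => x h' n _ /=.
  by rewrite lee_fin.
split=> //; rewrite /Rintegral; apply: fine_cvg.
by rewrite fineK //; exact: integrable_fin_num h1.
Qed.

(** The sum of the functions has integral at most 2, hence is finite almost everywhere, and the
    terms of a convergent series tend to 0. This extracts pointwise convergence from fast
    convergence in the mean. *)
Lemma summable_ae_cvg0 (f_ : nat -> T -> R) :
  (forall n, igr (f_ n)) -> (forall n x, 0 <= f_ n x) ->
  (forall n, Rintegral m setT (f_ n) <= 2^-1 ^+ n) ->
  {ae m, forall x, f_ n x @[n --> \oo] --> 0}.
Proof.
move=> if_ f0 hf; have mf_ n := igr_meas (if_ n).
pose F x := (\sum_(n <oo) (f_ n x)%:E)%E.
have mF : measurable_fun setT F.
  apply: ge0_emeasurable_sum => [n x _ _|n _]; first by rewrite lee_fin.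
  exact/measurable_EFinP.
have F0 x : (0 <= F x)%E by apply: nneseries_ge0 => n _ _; rewrite lee_fin.
have iF : m.-integrable setT F.
  apply/integrableP; split => //.
  under eq_integral do rewrite gee0_abs //.
  rewrite /F integral_nneseries //; last 2 first.
    by move=> n; exact/measurable_EFinP.
    by move=> n x _; rewrite lee_fin.
  apply: (@le_lt_trans _ _ (\sum_(n <oo) (2^-1 ^+ n)%:E)%E).
    apply: lee_nneseries => n *; last by rewrite EFin_Rintegral // lee_fin.
    by apply: integral_ge0 => x _; rewrite lee_fin.
  have := @cvg_geometric_series R 1 2^-1.
  rewrite ger0_norm // => /(_ ltac:(lra)) hc.
  rewrite (_ : (\sum_(n <oo) _)%E = (1 / (1 - 2^-1))%:E) ?ltry //.
  apply/cvg_lim => //.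
  rewrite (_ : (fun n => _) = EFin \o (series (geometric 1 2^-1))).
    by apply: cvg_EFin => //; exact: nearW.
  apply/funext => n /=; rewrite sumEFin; congr EFin.
  by apply: eq_bigr => i _; rewrite /geometric /= mul1r.
apply: filterS (integrable_ae measurableT iF) => x /(_ I) fx.
have : cvgn (series (fun n => f_ n x)).
  apply: nondecreasing_is_cvgn.
    by apply: nondecreasing_series => n _ _.
  exists (fine (F x)) => _ [n _ <-]; rewrite -lee_fin fineK //.
  rewrite /series /= -sumEFin; apply: nneseries_lim_ge => // k _.
  by rewrite lee_fin.
exact: cvg_series_cvg_0.
Qed.

Lemma igr_indic (A : set T) : measurable A -> (m A < +oo)%E ->
  igr (\1_A) /\ Rintegral m setT (\1_A) = fine (m A).
Proof.
move=> mA fA; have e : (\int[m]_x (\1_A x)%:E)%E = m A.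
  by rewrite integral_indic // setIT.
split; last by rewrite /Rintegral e.
apply/igr_ge0P; [exact: measurable_indic|by []|by rewrite e].
Qed.

End real_integral.

Section almost_everywhere_product.
Context {d1 d2 : measure_display} {T1 : measurableType d1} {T2 : measurableType d2}.
Context {R : realType}.
Variable m1 : {sigma_finite_measure set T1 -> \bar R}.
Variable m2 : {sigma_finite_measure set T2 -> \bar R}.

Lemma ae_prod1 (P : T1 -> Prop) : {ae m1, forall x, P x} ->
  {ae (m1 \x m2)%E, forall z, P z.1}.
Proof.
move=> [N [mN N0 h]]; exists (N `*` setT); split.
- exact: measurableX.
- transitivity (m1 N * m2 setT)%E; first exact: product_measure1E.
  have -> : m1 N = 0%E by exact: N0.
  by rewrite mul0e.
- by move=> z /= /h hz; split.
Qed.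

Lemma ae_prod2 (P : T2 -> Prop) : {ae m2, forall x, P x} ->
  {ae (m1 \x m2)%E, forall z, P z.2}.
Proof.
move=> [N [mN N0 h]]; exists (setT `*` N); split.
- exact: measurableX.
- transitivity (m1 setT * m2 N)%E; first exact: product_measure1E.
  have -> : m2 N = 0%E by exact: N0.
  by rewrite mule0.
- by move=> z /= /h hz; split.
Qed.

End almost_everywhere_product.

Section measurable_real_functions.
Context {d : measure_display} {T : measurableType d} {R : realType}.
Implicit Types f g : T -> R.
Local Notation mfun := (measurable_fun setT).

Lemma mf_D f g : mfun f -> mfun g -> mfun (fun x => f x + g x).
Proof. exact: measurable_funD. Qed.
Lemma mf_N f : mfun f -> mfun (fun x => - f x).
Proof. by move=> h; apply: measurableT_comp. Qed.
Lemma mf_M f g : mfun f -> mfun g -> mfun (fun x => f x * g x).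
Proof. exact: measurable_funM. Qed.
Lemma mf_norm f : mfun f -> mfun (fun x => `|f x|).
Proof. by move=> h; apply: measurableT_comp. Qed.
Lemma mf_pow r f : mfun f -> mfun (fun x => f x `^ r).
Proof. by move=> h; apply: (measurableT_comp (measurable_powR r)). Qed.
Lemma mf_max f g : mfun f -> mfun g -> mfun (fun x => Num.max (f x) (g x)).
Proof. exact: measurable_maxr. Qed.
Lemma mf_min f g : mfun f -> mfun g -> mfun (fun x => Num.min (f x) (g x)).
Proof. exact: measurable_minr. Qed.
Lemma mf_cst (c : R) : mfun (fun _ : T => c).
Proof. exact: measurable_cst. Qed.
Lemma mf_Tk k f : mfun f -> mfun (fun x => Tk k (f x)).
Proof. by move=> h; apply: mf_max; [exact: mf_cst|apply: mf_min => //; exact: mf_cst]. Qed.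
Lemma mf_Phi p f : mfun f -> mfun (fun x => Phi p (f x)).
Proof. by move=> h; apply: mf_M => //; apply: mf_pow; exact: mf_norm. Qed.
Lemma mf_indic (A : set T) : measurable A -> mfun (fun x => \1_A x : R).
Proof. by move=> h; exact: measurable_indic. Qed.

Lemma measurable_gt f k : mfun f -> measurable [set x | k < f x].
Proof.
move=> mf; rewrite (_ : [set x | k < f x] = setT `&` f @^-1` `]k, +oo[).
  by apply: mf => //; exact: measurable_itv.
by apply/seteqP; split => x /=; rewrite in_itv /= andbT; [split|case].
Qed.

Lemma measurable_ge f k : mfun f -> measurable [set x | k <= f x].
Proof.
move=> mf; rewrite (_ : [set x | k <= f x] = setT `&` f @^-1` `[k, +oo[).
  by apply: mf => //; exact: measurable_itv.
by apply/seteqP; split => x /=; rewrite in_itv /= andbT; [split|case].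
Qed.

Lemma measurable_le f k : mfun f -> measurable [set x | f x <= k].
Proof.
move=> mf; rewrite (_ : [set x | f x <= k] = setT `&` f @^-1` `]-oo, k]).
  by apply: mf => //; exact: measurable_itv.
by apply/seteqP; split => x /=; rewrite in_itv /=; [split|case].
Qed.
End measurable_real_functions.

Section indicators.
Context {R : realType} {T : Type}.
Implicit Types (B : set T) (x : T).

Lemma indic_in B x : B x -> \1_B x = 1 :> R.
Proof. by move=> h; rewrite indicE mem_set. Qed.

Lemma indic_out B x : ~ B x -> \1_B x = 0 :> R.
Proof. by move=> h; rewrite indicE memNset. Qed.

Lemma indic_Cin B x : ~ B x -> \1_(~` B) x = 1 :> R.
Proof. by move=> h; rewrite indic_in. Qed.

Lemma indic_Cout B x : B x -> \1_(~` B) x = 0 :> R.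
Proof. by move=> h; rewrite indic_out //; apply. Qed.

End indicators.

Section measurable_pairs.
Context {d d' : measure_display} {T : measurableType d} {T' : measurableType d'}.
Context {R : realType}.
Lemma mf_fst (u : T -> R) : measurable_fun setT u ->
  measurable_fun setT (fun z : T * T' => u z.1).
Proof. by move=> h; apply: (measurableT_comp h measurable_fst). Qed.
Lemma mf_snd (u : T' -> R) : measurable_fun setT u ->
  measurable_fun setT (fun z : T * T' => u z.2).
Proof. by move=> h; apply: (measurableT_comp h measurable_snd). Qed.
End measurable_pairs.

Ltac measf := repeat first [ assumption | exact: mf_cst | apply: mf_D | apply: mf_M
  | apply: mf_N | apply: mf_norm | apply: mf_pow | apply: mf_max | apply: mf_min
  | apply: mf_Tk | apply: mf_Phi | apply: mf_indic | apply: mf_fst | apply: mf_snd ].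

Ltac mm := rewrite ?/Tk ?/Order.max ?/Order.min;
  repeat (match goal with
    |- context [if (?a < ?b)%O then _ else _] => case: (ltP a b) end);
  try move=> *.

Lemma cvgn_comp {R : realType} (h : R -> R) (u : nat -> R) a : continuous h ->
  u n @[n --> \oo] --> a -> h (u n) @[n --> \oo] --> h a.
Proof. by move=> ch cu; apply: continuous_cvg => //; exact: ch. Qed.

(** * Truncations *)

Section truncation.
Context {R : realType}.
Implicit Types a b k h : R.

Lemma Tk_le k a b : a <= b -> Tk k a <= Tk k b.
Proof. by mm; lra. Qed.

Lemma Tk_norm k a : 0 <= k -> `|Tk k a| <= k.
Proof. by move=> k0; rewrite ler_norml; apply/andP; split; mm; lra. Qed.

Lemma Tk_id k a : `|a| <= k -> Tk k a = a.
Proof. by rewrite ler_norml => /andP[h1 h2]; mm; lra. Qed.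

Lemma Tk_ge0 k a : 0 <= k -> 0 <= a -> 0 <= Tk k a.
Proof. by mm; lra. Qed.

Lemma Tk_geE k a : 0 <= k -> k <= a -> Tk k a = k.
Proof. by mm; lra. Qed.

Lemma Tk_leid k a : 0 <= k -> 0 <= a -> Tk k a <= a.
Proof. by mm; lra. Qed.

Lemma Tk0 k : 0 <= k -> Tk k 0 = 0 :> R.
Proof. by mm; lra. Qed.

Lemma Tk_lip k a b : 0 <= k -> `|Tk k a - Tk k b| <= `|a - b|.
Proof.
move=> k0; wlog ab : a b / b <= a.
  move=> hw; have [ba|/ltW ab] := leP b a; first exact: hw.
  by rewrite distrC [leRHS]distrC; exact: hw.
rewrite !ger0_norm ?subr_ge0 ?Tk_le //; mm; lra.
Qed.

Lemma Tk_norm_le k a : 0 <= k -> `|Tk k a| <= `|a|.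
Proof. by move=> k0; have := Tk_lip a 0 k0; rewrite Tk0 // !subr0. Qed.

Lemma Tk_continuous k : 0 <= k -> continuous (Tk k).
Proof.
move=> k0 a; apply/cvgrPdist_lt => e e0; near=> b.
apply: le_lt_trans (Tk_lip _ _ k0) _; near: b.
exact: (@cvgr_dist_lt _ _ _ _ _ _ _ cvg_id).
Unshelve. all: by end_near. Qed.

(** Expresses the truncation through cuts max(. - k, 0) and linear operations, the only operations
    under which [admissible] asserts stability of the space. *)
Lemma TkE k a : 0 <= k ->
  Tk k a = Num.max a 0 + -1 * Num.max (a - k) 0 +
     -1 * (Num.max (-1 * a) 0 + -1 * Num.max (-1 * a - k) 0).
Proof. by mm; lra. Qed.

End truncation.

(** * Energies, the form A and the abstract setting *)

Section energy.
Context {d : measure_display} {T : measurableType d} {R : realType}.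
Variables (mu : {sigma_finite_measure set T -> \bar R}) (p : R) (K : T * T -> R).

Local Notation m2 := (mu \x mu)%E.

Definition edens (u : T -> R) (z : T * T) : R := K z * `|u z.1 - u z.2| `^ p.
Definition fin_energy (u : T -> R) := igr m2 (edens u).
Definition energy (u : T -> R) : R := Rintegral m2 setT (edens u).
(** Integrand of <A u, v>, kept as a density: for an entropy solution its integrability has to be
    proved and cannot be presupposed. *)
Definition aform (u v : T -> R) (z : T * T) : R :=
  K z * (Phi p (u z.1 - u z.2) * (v z.1 - v z.2)).

(* The properties of the space [W] = W^{s,p}_{beta,0}(O) and of the kernel
   [K] = 1/2 1_D nu on which the variational argument relies. *)
Record admissible (O : set T) (W : (T -> R) -> Prop) (lam1 sg : R) : Prop :=
 Admissible {
  adm_p : 1 < p ;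
  adm_mO : measurable O ;
  adm_fO : (mu O < +oo)%E ;
  adm_mK : measurable_fun setT K ;
  adm_K0 : forall z, 0 <= K z ;
  adm_W0 : W (fun=> 0) ;
  adm_meas : forall u, W u -> measurable_fun setT u ;
  adm_out : forall u, W u -> forall x, ~ O x -> u x = 0 ;
  adm_D : forall u v, W u -> W v -> W (fun x => u x + v x) ;
  adm_Z : forall (c : R) u, W u -> W (fun x => c * u x) ;
  adm_cut : forall (k : R) u, 0 <= k -> W u -> W (fun x => Num.max (u x - k) 0) ;
  adm_closed : forall (v_ : nat -> T -> R) (v : T -> R) (k : R), (forall n, W (v_ n)) ->
    (forall n x, `|v_ n x| <= k) -> measurable_fun setT v ->
    (forall x, ~ O x -> v x = 0) ->
    {ae mu, forall x, v_ n x @[n --> \oo] --> v x} ->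
    (forall e, 0 < e -> \forall n \near \oo,
       fin_energy (fun x => v_ n x - v x) /\ energy (fun x => v_ n x - v x) <= e) -> W v ;
  adm_lam1 : 0 < lam1 ;
  adm_poincare : forall v, W v -> fin_energy v ->
    igr mu (fun x => \1_O x * `|v x| `^ p) /\
    lam1 * Rintegral mu setT (fun x => \1_O x * `|v x| `^ p) <= energy v ;
  adm_sg : 0 < sg ;
  adm_gain : exists2 C : R, 0 < C & forall E' E : set T, measurable E' -> measurable E ->
    E' `<=` E -> E `<=` O ->
    igr m2 (fun z => \1_E' z.1 * \1_(~` E) z.2 * K z) ->
    fine (mu E') <= C * fine (mu E) `^ sg *
      Rintegral m2 setT (fun z => \1_E' z.1 * \1_(~` E) z.2 * K z) ;
  adm_approx : forall phi (M : R), W phi -> (forall x, `|phi x| <= M) ->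
    igr m2 (fun z => \1_O z.1 * \1_O z.2 * edens phi z) /\
    exists (phi_ : nat -> T -> R) (dd : nat -> T * T -> R),
    [/\ (forall n, W (phi_ n) /\ fin_energy (phi_ n)),
        (forall n x, `|phi_ n x| <= M),
        {ae mu, forall x, phi_ n x @[n --> \oo] --> phi x},
        (forall n z, 0 <= dd n z) /\ (forall n z, O z.1 -> O z.2 ->
          `|phi_ n z.1 - phi_ n z.2| <= `|phi z.1 - phi z.2| + dd n z) &
        (forall n, measurable_fun setT (dd n)) /\
        (forall e, 0 < e -> \forall n \near \oo,
          igr m2 (fun z => \1_O z.1 * \1_O z.2 * (K z * dd n z `^ p)) /\
          Rintegral m2 setT (fun z => \1_O z.1 * \1_O z.2 * (K z * dd n z `^ p)) <= e)]
 }.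

End energy.

Section admissible_theory.
Context {d : measure_display} {T : measurableType d} {R : realType}.
Variables (mu : {sigma_finite_measure set T -> \bar R}) (p : R) (K : T * T -> R).
Variables (O : set T) (W : (T -> R) -> Prop) (lam1 sg : R).
Hypothesis A : admissible mu p K O W lam1 sg.

Local Notation m2 := (mu \x mu)%E.
Local Notation mfun := (measurable_fun setT).
Local Notation en := (edens p K).
Local Notation fe := (fin_energy mu p K).
Local Notation En := (energy mu p K).
Local Notation pr := (aform p K).
Implicit Types u v w f : T -> R.

Let p1 : 1 < p := adm_p A.
Let p0 : 0 < p. Proof. by have := p1; lra. Qed.
Let mK := adm_mK A.
Let K0 := adm_K0 A.

Lemma mf_edens u : mfun u -> mfun (en u).
Proof. by move=> mu_; have := mK; rewrite /edens => mK'; measf. Qed.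

Lemma mf_aform u v : mfun u -> mfun v -> mfun (pr u v).
Proof. by move=> mu_ mv; have := mK; rewrite /aform => mK'; measf. Qed.

Lemma edens_ge0 u z : 0 <= en u z.
Proof. by rewrite mulr_ge0 ?powR_ge0 ?K0. Qed.

Lemma energy_ge0 u : 0 <= En u.
Proof. by apply: Rint_ge0; exact: edens_ge0. Qed.

(** Smaller increments give a smaller density at every pair of points; truncations and positive
    parts all enter through this remark. *)
Lemma fe_le u v : mfun v ->
  (forall z : T * T, `|v z.1 - v z.2| <= `|u z.1 - u z.2|) ->
  fe u -> fe v /\ En v <= En u.
Proof.
move=> mv h fu; have h' z : en v z <= en u z.
  by rewrite ler_wpM2l ?K0 // powR_le // ltW.
have fv : fe v.
  apply: (igr_le (mf_edens mv) _ fu) => z.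
  by rewrite ger0_norm ?edens_ge0.
split; [exact: fv|exact: (Rint_le fv fu h')].
Qed.

Lemma edens_D u v z : en (fun x => u x + v x) z <= 2 `^ p * (en u z + en v z).
Proof.
rewrite /edens -mulrDr mulrCA ler_wpM2l ?K0 //.
have -> : u z.1 + v z.1 - (u z.2 + v z.2) = (u z.1 - u z.2) + (v z.1 - v z.2) by ring.
exact: powR_normD.
Qed.

Lemma fe_D u v : mfun u -> mfun v -> fe u -> fe v -> fe (fun x => u x + v x).
Proof.
move=> mu_ mv fu fv.
apply: (igr_le (mf_edens _) _ (igrZ (2 `^ p) (igrD fu fv))); first by measf.
by move=> z; rewrite ger0_norm ?edens_ge0 //; exact: edens_D.
Qed.

Lemma edens_Z c u z : en (fun x => c * u x) z = `|c| `^ p * en u z.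
Proof. by rewrite /edens -mulrBr normrM powRM // mulrCA. Qed.

Lemma fe_Z c u : fe u -> fe (fun x => c * u x).
Proof.
move=> fu; rewrite /fin_energy (_ : en _ = (fun z => `|c| `^ p * en u z)).
  exact: igrZ.
by apply/funext => z; exact: edens_Z.
Qed.

Lemma fe_B u v : mfun u -> mfun v -> fe u -> fe v -> fe (fun x => u x - v x).
Proof.
move=> mu_ mv fu fv.
have -> : (fun x => u x - v x) = (fun x => u x + -1 * v x).
  by apply/funext => x; rewrite mulN1r.
by apply: fe_D => //; [measf|exact: fe_Z].
Qed.

Lemma fe_0 : fe (fun=> 0).
Proof.
rewrite /fin_energy (_ : en _ = fun=> 0); first exact: igr0.
by apply/funext => z; rewrite /edens subrr normr0 powR0 ?mulr0 // gt_eqF.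
Qed.

Lemma aform_le u v z : `|pr u v z| <= en u z + en v z.
Proof.
rewrite /aform /edens -mulrDr normrM (ger0_norm (K0 z)) ler_wpM2l ?K0 //.
by rewrite normrM norm_Phi //; exact: young_norm.
Qed.

Lemma igr_aform u v : mfun u -> mfun v -> fe u -> fe v -> igr m2 (pr u v).
Proof.
move=> mu_ mv fu fv; apply: (igr_le (mf_aform mu_ mv) _ (igrD fu fv)).
exact: aform_le.
Qed.

Lemma W_B u v : W u -> W v -> W (fun x => u x - v x).
Proof.
move=> Wu Wv; have -> : (fun x => u x - v x) = (fun x => u x + -1 * v x).
  by apply/funext => x; rewrite mulN1r.
by apply: (adm_D A) => //; exact: (adm_Z A).
Qed.

Lemma W_pos u : W u -> W (fun x => Num.max (u x) 0).
Proof.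
move=> /(adm_cut A (lexx 0)) h; congr (W _): h.
by apply/funext => x; rewrite subr0.
Qed.

Lemma W_max u v : W u -> W v -> W (fun x => Num.max (u x) (v x)).
Proof.
move=> Wu Wv; have := adm_D A Wu (W_pos (W_B Wv Wu)).
by congr (W _); apply/funext => x; mm; lra.
Qed.

Lemma W_Tk k u : 0 <= k -> W u -> W (fun x => Tk k (u x)).
Proof.
move=> k0 Wu; have Wn := adm_Z A (-1) Wu.
have h1 := adm_D A (W_pos Wu) (adm_Z A (-1) (adm_cut A k0 Wu)).
have h2 := adm_D A (W_pos Wn) (adm_Z A (-1) (adm_cut A k0 Wn)).
have := adm_D A h1 (adm_Z A (-1) h2).
by congr (W _); apply/funext => x; rewrite TkE.
Qed.

(** Integrating the uniform convexity inequality bounds the energy of a difference by [eps] times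
    the sum of the energies, at most 2 B, plus [C] times the midpoint gap. The choices eps = e / (4
    (B + 1)) and a gap of at most e / (2 C) give e / 2 for each part. *)
Lemma energy_cauchy (v_ : nat -> T -> R) B : (forall n, mfun (v_ n)) ->
  (forall n, fe (v_ n)) -> (forall n, En (v_ n) <= B) ->
  (forall e, 0 < e -> exists N, forall i j, (N <= i)%N -> (N <= j)%N ->
    (En (v_ i) + En (v_ j)) / 2 - En (fun x => 2^-1 * (v_ i x + v_ j x)) <= e) ->
  forall e, 0 < e -> exists N, forall i j, (N <= i)%N -> (N <= j)%N ->
    En (fun x => v_ i x - v_ j x) <= e.
Proof.
move=> mv fv hB hmid e e0; have B0 : 0 <= B := le_trans (energy_ge0 _) (hB 0%N).
have eps0 : 0 < e / (4 * (B + 1)) by rewrite divr_gt0 //; lra.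
have [C C0 HC] := powR_unif_convex p1 eps0.
have [|N hN] := hmid (e / (2 * C)); first by rewrite divr_gt0 //; lra.
exists N => i j Ni Nj; have := hN _ _ Ni Nj.
set w := (fun x => _); set eps := e / (4 * (B + 1)) => hw.
have mvi := mv i; have mvj := mv j.
have mw : mfun w by rewrite /w; measf.
have fw : fe w by apply: fe_Z; apply: fe_D.
pose S z := en (v_ i) z + en (v_ j) z.
have iS : igr m2 S := igrD (fv i) (fv j).
have h z : en (fun x => v_ i x - v_ j x) z <= eps * S z + C * (2^-1 * S z - en w z).
  rewrite /S /edens /w.
  have -> : v_ i z.1 - v_ j z.1 - (v_ i z.2 - v_ j z.2) =
    (v_ i z.1 - v_ i z.2) - (v_ j z.1 - v_ j z.2) by ring.
  have -> : 2^-1 * (v_ i z.1 + v_ j z.1) - 2^-1 * (v_ i z.2 + v_ j z.2) =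
    ((v_ i z.1 - v_ i z.2) + (v_ j z.1 - v_ j z.2)) / 2 by ring.
  have := ler_wpM2l (K0 z) (HC (v_ i z.1 - v_ i z.2) (v_ j z.1 - v_ j z.2)).
  move=> h; apply: (le_trans h); rewrite le_eqVlt; apply/orP; left; apply/eqP.
  by rewrite -/eps; ring.
have iR : igr m2 (fun z => eps * S z + C * (2^-1 * S z - en w z)).
  apply: igrD; first exact: igrZ.
  by apply: igrZ; apply: igrB => //; exact: igrZ.
have := Rint_le (fe_B (mv i) (mv j) (fv i) (fv j)) iR h.
rewrite Rint_D; [|exact: igrZ|by apply: igrZ; apply: igrB => //; exact: igrZ].
rewrite !Rint_Z //; last by apply: igrB => //; exact: igrZ.
rewrite Rint_B //; last exact: igrZ.
rewrite Rint_Z // (Rint_D (fv i) (fv j)) -/(En (v_ i)) -/(En (v_ j)) -/(En w).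
move=> /le_trans; apply.
move: hw (hB i) (hB j) (energy_ge0 (v_ i)) (energy_ge0 (v_ j)).
move: (En w) (En (v_ i)) (En (v_ j)) => a b c h1 h2 h3 h4 h5.
have e1 : eps * (b + c) <= e / 2.
  apply: (@le_trans _ _ (eps * (2 * (B + 1)))); first by apply: (ler_wpM2l (ltW eps0)); lra.
  by rewrite /eps le_eqVlt; apply/orP; left; apply/eqP; field; lra.
have e2 : C * (2^-1 * (b + c) - a) <= e / 2.
  apply: (@le_trans _ _ (C * (e / (2 * C)))); first by apply: (ler_wpM2l (ltW C0)); lra.
  by rewrite le_eqVlt; apply/orP; left; apply/eqP; field; rewrite gt_eqF.
lra.
Qed.

(** Letting the second index tend to infinity in the Cauchy bound, Fatou's lemma shows that the
    almost everywhere limit is also the limit in energy, which is what [adm_closed] asks for. *)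
Lemma W_cauchy_closed (v_ : nat -> T -> R) v k : (forall n, W (v_ n)) ->
  (forall n x, `|v_ n x| <= k) -> (forall n, fe (v_ n)) ->
  (forall e, 0 < e -> exists N, forall i j, (N <= i)%N -> (N <= j)%N ->
    En (fun x => v_ i x - v_ j x) <= e) ->
  mfun v -> (forall x, ~ O x -> v x = 0) ->
  {ae mu, forall x, v_ n x @[n --> \oo] --> v x} -> W v /\ fe v.
Proof.
move=> Wv bv fv hc mv ov cv.
have mv_ n := adm_meas A (Wv n).
have key e : 0 < e -> \forall n \near \oo,
    fe (fun x => v_ n x - v x) /\ En (fun x => v_ n x - v x) <= e.
  move=> e0; have [N hN] := hc _ e0; exists N => // n /= Nn.
  apply: (@fatou_real _ _ _ m2 (fun i => en (fun x => v_ n x - v_ i x))).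
  - by move=> i; exact: fe_B.
  - by move=> i z; exact: edens_ge0.
  - by apply: mf_edens; measf.
  - by move=> z; exact: edens_ge0.
  - have c1 := ae_prod1 mu cv; have c2 := ae_prod2 mu cv.
    apply: filterS2 c1 c2 => z /= c1 c2; rewrite /edens.
    apply: cvgMr; apply: (@cvgn_comp _ (fun t : R => `|t| `^ p)).
      exact: normr_powR_continuous.
    by apply: cvgB; apply: cvgB => //; exact: cvg_cst.
  - by exists N => // i /= Ni; exact: hN.
split; first exact: (adm_closed A Wv bv).
have [N _ /(_ N (leqnn N)) [h _]] := key _ ltr01.
have := fe_B (mv_ N) _ (fv N) h.
rewrite (_ : (fun x => v_ N x - (v_ N x - v x)) = v); last first.
  by apply/funext => x; ring.
by apply; measf; exact: mv_.
Qed.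

End admissible_theory.

Section pointwise_limits.
Context {R : realType}.

Lemma cvgn_geometric_steps (w : nat -> R) (n0 : nat) :
  (forall n, (n0 <= n)%N -> `|w n.+1 - w n| <= 2^-1 ^+ n) -> cvgn w.
Proof.
move=> h; pose a n := w (n + n0)%N.
suff : cvgn a by move=> /cvg_ex[l]; rewrite /a cvg_shiftn => c; apply/cvg_ex; exists l.
have c1 : cvgn (series (telescope a)).
  apply: normed_cvg; apply: (@series_le_cvg _ _ (geometric 1 2^-1)).
  - by move=> n; exact: normr_ge0.
  - by move=> n; rewrite /geometric /= mul1r exprn_ge0.
  - move=> n; rewrite /telescope /geometric /= mul1r /a addSn.
    apply: le_trans (h _ (leq_addl _ _)) _.
    by apply: ler_wiXn2l => //; [lra|exact: leq_addr].
  - by apply: is_cvg_geometric_series; rewrite ger0_norm //; lra.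
have -> : a = (fun n => a 0%N + series (telescope a) n).
  by apply/funext => n; exact: eq_sum_telescope.
by apply: is_cvgD => //; exact: is_cvg_cst.
Qed.

Context {d : measure_display} {T : measurableType d}.

(** The upper limit is measurable and defined at every point, also where the sequence diverges; an
    infinite value becomes 0 through [fine]. *)
Definition limfun (w : nat -> T -> R) (x : T) : R :=
  fine (limn_esup (fun n => (w n x)%:E)).

Lemma mf_limfun w : (forall n, measurable_fun setT (w n)) ->
  measurable_fun setT (limfun w).
Proof.
move=> mw; apply: (measurableT_comp (@fine_measurable R setT measurableT)).
by apply: measurable_fun_limn_esup => n; exact/measurable_EFinP.
Qed.

Lemma limfunE w x l : w n x @[n --> \oo] --> l -> limfun w x = l.
Proof.
move=> c; have : (w n x)%:E @[n --> \oo] --> l%:E.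
  by apply/cvg_EFin; first exact: nearW.
by move/cvg_limn_einf_sup => [_ h]; rewrite /limfun h.
Qed.

Lemma limfun_cvg w x : cvgn (fun n => w n x) -> w n x @[n --> \oo] --> limfun w x.
Proof. by move=> /cvg_ex[l c]; rewrite (limfunE c). Qed.

End pointwise_limits.

Lemma igr_mulb {d : measure_display} {T : measurableType d} {R : realType}
  (m : {measure set T -> \bar R}) (f v : T -> R) (c : R) : igr m f ->
  measurable_fun setT v -> (forall x, `|v x| <= c) -> igr m (fun x => f x * v x).
Proof.
move=> hf mv hv; have mf := igr_meas hf.
have c0 (x : T) : 0 <= c := le_trans (normr_ge0 (v x)) (hv x).
apply: (@igr_le _ _ _ _ _ (fun x => c * `|f x|)); first by measf.
  by move=> x; rewrite normrM mulrC ler_wpM2r.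
apply: igrZ; apply: (igr_le _ _ (integrable_norm hf)) => [|x]; first by measf.
by rewrite normr_id.
Qed.

(** * The minimization problem under a bound on the competitors *)

Section minimization.
Context {d : measure_display} {T : measurableType d} {R : realType}.
Variables (mu : {sigma_finite_measure set T -> \bar R}) (p : R) (K : T * T -> R).
Variables (O : set T) (W : (T -> R) -> Prop) (lam1 sg : R).
Hypothesis A : admissible mu p K O W lam1 sg.

Local Notation m2 := (mu \x mu)%E.
Local Notation mfun := (measurable_fun setT).
Local Notation en := (edens p K).
Local Notation fe := (fin_energy mu p K).
Local Notation En := (energy mu p K).
Implicit Types u v w f : T -> R.

Let p1 : 1 < p := adm_p A.
Let p0 : 0 < p. Proof. by have := p1; lra. Qed.

(** The Poincare inequality turns small energies into small L^p norms over O. Along a fast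
    subsequence the p-th powers [g n] of 2^n times the steps have integral at most 2^-n, so they
    tend to 0 almost everywhere and the steps are eventually below 2^-n. *)
Lemma cauchy_subsequence (v_ : nat -> T -> R) k : 0 <= k -> (forall n, W (v_ n)) ->
  (forall n x, `|v_ n x| <= k) -> (forall n, fe (v_ n)) ->
  (forall e, 0 < e -> exists N, forall i j, (N <= i)%N -> (N <= j)%N ->
    En (fun x => v_ i x - v_ j x) <= e) ->
  exists (s : nat -> nat) v, [/\ forall n, (n <= s n)%N, mfun v,
    forall x, ~ O x -> v x = 0, forall x, `|v x| <= k &
    {ae mu, forall x, v_ (s n) x @[n --> \oo] --> v x}].
Proof.
move=> k0 Wv bv fv hc; have mv n := adm_meas A (Wv n).
have l0 := adm_lam1 A.
(* The tolerance pays for [lam1], for the factor (2^n)^p in [g n] and for the target 2^-n. *)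
pose ee n : R := lam1 * (2^-1 ^+ n * (2^-1 ^+ n) `^ p).
have ee0 n : 0 < ee n by rewrite !mulr_gt0 ?powR_gt0 ?exprn_gt0.
have [N hN] := choice (fun n => hc _ (ee0 n)).
pose s := fix s n := if n is n'.+1 then (N n + (s n').+1)%N else N 0%N.
have sN n : (N n <= s n)%N by case: n => //= n; rewrite leq_addr.
have sS n : (s n < s n.+1)%N by rewrite /= leq_addl.
have sn n : (n <= s n)%N by elim: n => // n ih; rewrite (leq_ltn_trans ih (sS n)).
pose w n := v_ (s n).
have mw n : mfun (w n) by exact: mv.
pose g n x : R := (2 ^+ n) `^ p * (\1_O x * `|w n.+1 x - w n x| `^ p).
have hg n : igr mu (g n) /\ Rintegral mu setT (g n) <= 2^-1 ^+ n.
  have Wd := W_B A (Wv (s n.+1)) (Wv (s n)).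
  have fd := fe_B A (mv _) (mv _) (fv (s n.+1)) (fv (s n)).
  have [h1 h2] := adm_poincare A Wd fd.
  split; first exact: igrZ.
  rewrite Rint_Z //.
  have := hN n (s n.+1) (s n) (leq_trans (sN n) (ltnW (sS n))) (sN n).
  move=> /(le_trans h2); rewrite /ee ler_pM2l //.
  set I1 := Rintegral _ _ _ => hI.
  apply: (@le_trans _ _ ((2 ^+ n) `^ p * (2^-1 ^+ n * (2^-1 ^+ n) `^ p))).
    by apply: ler_wpM2l => //; exact: powR_ge0.
  have e1 : 2 ^+ n * 2^-1 ^+ n = 1 :> R by rewrite -exprMn divff ?expr1n.
  by rewrite mulrCA -powRM ?exprn_ge0 // e1 powR1 mulr1.
have c0 : {ae mu, forall x, g n x @[n --> \oo] --> 0}.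
  apply: summable_ae_cvg0 => n; [exact: (hg n).1| |exact: (hg n).2].
  by move=> x; rewrite !mulr_ge0 ?powR_ge0.
(* Clipping at [k] enforces the bound also where the sequence diverges; where it converges nothing
   changes, as the sequence itself is bounded by [k]. *)
exists s, (fun x => Tk k (limfun w x)); split => //.
- by have h := mf_limfun mw; measf.
- move=> x nO; rewrite (@limfunE _ _ _ w x 0) ?Tk0 //.
  rewrite (_ : (fun n => w n x) = fun=> 0); first exact: cvg_cst.
  by apply/funext => n; exact: (adm_out A (Wv _)).
- by move=> x; exact: Tk_norm.
apply: filterS c0 => x gx.
have cw : cvgn (fun n => w n x).
  have /cvgr0Pnorm_lt/(_ 1 ltr01) [n0 _ hn0] := gx.
  apply: (@cvgn_geometric_steps _ _ n0) => n /hn0.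
  have [Ox|nO] := pselect (O x); last first.
    move=> _; rewrite /w (adm_out A (Wv (s n.+1)) nO) (adm_out A (Wv (s n)) nO) subrr normr0.
    by rewrite exprn_ge0.
  rewrite /g indicE mem_set // mul1r -powRM ?exprn_ge0 // ger0_norm ?powR_ge0 // => h.
  have h1 : 2 ^+ n * `|w n.+1 x - w n x| <= 1.
    rewrite leNgt; apply/negP => h1; have := powR_lt p0 ler01 h1.
    by rewrite powR1 => h2; have := lt_trans h h2; rewrite ltxx.
  by rewrite exprVn -ler_pdivlMl ?exprn_gt0 // mulr1 in h1 *.
have cw' := limfun_cvg cw.
have := cvgn_comp (Tk_continuous k0) cw'.
rewrite (_ : (fun n => Tk k (w n x)) = fun n => w n x) //.
by apply/funext => n; apply: Tk_id; exact: bv.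
Qed.

Definition bounded_class (n : R) v := [/\ W v, forall x, `|v x| <= n & fe v].

Definition Jfun f v : R := p^-1 * En v - Rintegral mu setT (fun x => f x * v x).

(** The constraint |v| <= n makes the linear term finite for f merely in L^1 and bounds the
    functional below by -n times the norm of f. The linear term is affine, so the mere fact that the
    value at a midpoint is at least the infimum bounds the convexity gap of the energies. *)
Lemma minimizer_exists (n : R) f : 0 <= n -> igr mu f ->
  exists2 u, bounded_class n u & forall v, bounded_class n v -> Jfun f u <= Jfun f v.
Proof.
move=> n0 hf; have mf := igr_meas hf.
have hfn : igr mu (fun x => `|f x|) := integrable_norm hf.
set F := Rintegral mu setT (fun x => `|f x|).
have ifv v : bounded_class n v -> igr mu (fun x => f x * v x).
  by move=> [Wv bv _]; apply: (igr_mulb hf _ bv); exact: (adm_meas A).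
have bF v : bounded_class n v -> Rintegral mu setT (fun x => f x * v x) <= n * F.
  move=> Kv; rewrite -Rint_Z //; apply: Rint_le; [exact: ifv|exact: igrZ|].
  move=> x; apply: le_trans (ler_norm _) _; rewrite normrM mulrC.
  by apply: ler_wpM2r => //; case: Kv.
pose E := [set Jfun f v | v in bounded_class n].
have J_lb v : bounded_class n v -> p^-1 * En v <= Jfun f v + n * F.
  move=> /bF; rewrite /Jfun; move: (p^-1 * En v) (Rintegral _ _ _) => a b; lra.
have lbE : has_lbound E.
  exists (- (n * F)) => _ [v Kv <-]; have := J_lb _ Kv.
  have : 0 <= p^-1 * En v by rewrite mulr_ge0 ?(energy_ge0 A) // invr_ge0 ltW.
  by move: (p^-1 * En v) (Jfun f v) => a b; lra.
have K_0 : bounded_class n (fun=> 0).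
  by split; [exact: (adm_W0 A)|move=> x; rewrite normr0|exact: (fe_0 A)].
have hiE : has_inf E by split => //; exists (Jfun f (fun=> 0)); exists (fun=> 0).
set I0 := inf E.
have Imin v : bounded_class n v -> I0 <= Jfun f v.
  by move=> Kv; apply: ge_inf => //; exists v.
have /choice[v_ hv_] i : exists v, bounded_class n v /\ Jfun f v <= I0 + i.+1%:R^-1.
  have i0 : 0 < i.+1%:R^-1 :> R by rewrite invr_gt0.
  by have [_ [v Kv <-] /ltW h] := inf_adherent i0 hiE; exists v.
have Kv i : bounded_class n (v_ i) := (hv_ i).1.
have Wv i : W (v_ i) by case: (Kv i).
have mv i : mfun (v_ i) := adm_meas A (Wv i).
have bv i x : `|v_ i x| <= n by case: (Kv i).
have fv i : fe (v_ i) by case: (Kv i).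
have hB i : En (v_ i) <= p * (I0 + 1 + n * F).
  rewrite -ler_pdivrMl //; apply: le_trans (J_lb _ (Kv i)) _; rewrite lerD2r.
  apply: le_trans (hv_ i).2 _; rewrite lerD2l invf_le1 ?ltr0n // ler1n //.
have hc := energy_cauchy A mv fv hB.
have {hc} hc e : 0 < e -> exists N, forall i j, (N <= i)%N -> (N <= j)%N ->
    En (fun x => v_ i x - v_ j x) <= e.
  apply: hc => {}e e0.
  have /cvgr0Pnorm_lt/(_ (e / p)) := @cvg_harmonic R.
  rewrite divr_gt0 // => /(_ isT) [N _ hN]; exists N => i j Ni Nj.
  pose w x := 2^-1 * (v_ i x + v_ j x).
  have Kw : bounded_class n w.
    split; first by apply: (adm_Z A); apply: (adm_D A).
      move=> x; rewrite normrM ger0_norm //.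
      have := ler_normD (v_ i x) (v_ j x); have := bv i x; have := bv j x.
      by move: `|_ + _| `|v_ i x| `|v_ j x| => *; lra.
    exact: (fe_Z _ (fe_D A (mv i) (mv j) (fv i) (fv j))).
  have e1 : Rintegral mu setT (fun x => f x * w x) = 2^-1 *
     (Rintegral mu setT (fun x => f x * v_ i x) + Rintegral mu setT (fun x => f x * v_ j x)).
    rewrite -Rint_D; [|exact: ifv|exact: ifv]; rewrite -Rint_Z; last first.
      by apply: igrD; exact: ifv.
    by congr Rintegral; apply/funext => x; rewrite /w; ring.
  have := Imin _ Kw; have := (hv_ i).2; have := (hv_ j).2.
  have hi : i.+1%:R^-1 <= e / p by have /ltW := hN _ Ni; rewrite /= ger0_norm.
  have hj : j.+1%:R^-1 <= e / p by have /ltW := hN _ Nj; rewrite /= ger0_norm.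
  rewrite /Jfun e1 -/w.
  move: (Rintegral mu setT (fun x => f x * v_ i x)) => x.
  move: (Rintegral mu setT (fun x => f x * v_ j x)) => y.
  move: (En (v_ i)) (En (v_ j)) (En w) => a b c h1 h2 h3.
  have h4 : p^-1 * ((a + b) / 2 - c) <= p^-1 * e.
    move: hi hj h1 h2 h3; rewrite [e / p]mulrC !mulrBr.
    rewrite (_ : p^-1 * ((a + b) / 2) = (p^-1 * a + p^-1 * b) / 2); last by ring.
    by move: (p^-1 * a) (p^-1 * b) (p^-1 * c) (p^-1 * e) i.+1%:R^-1 j.+1%:R^-1 => *; lra.
  by move: h4; rewrite ler_pM2l // invr_gt0.
have [s [v [sn mv' ov bv' cv]]] := cauchy_subsequence n0 Wv bv fv hc.
have hc' e : 0 < e -> exists N, forall i j, (N <= i)%N -> (N <= j)%N ->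
    En (fun x => v_ (s i) x - v_ (s j) x) <= e.
  move=> /hc[N hN]; exists N => i j Ni Nj.
  by apply: hN; [exact: leq_trans (sn i)|exact: leq_trans (sn j)].
have [Wv' fv'] := W_cauchy_closed A (fun i => Wv (s i)) (fun i => bv (s i))
  (fun i => fv (s i)) hc' mv' ov cv.
have Kv' : bounded_class n v by [].
exists v => // w Kw; apply: le_trans (Imin _ Kw).
(* Lower semicontinuity is what is required: the linear terms converge, dominated by n |f|, and the
   energies satisfy Fatou's inequality. *)
have [|||||_ cI] := @dominated_real _ _ _ mu (fun i x => f x * v_ (s i) x)
  (fun x => f x * v x) (fun x => n * `|f x|).
- by move=> i; have mvi := mv (s i); measf.
- by measf.
- by apply: filterS cv => x cx; apply: cvgMr.
- exact: igrZ.
- by move=> i; apply: nearW => x; rewrite normrM mulrC; apply: ler_wpM2r.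
apply/ler_addgt0Pr => e e0; set c := Rintegral mu setT (fun x => f x * v x) in cI.
have e20 : 0 < e / 2 by rewrite divr_gt0.
have [||_ h] := @fatou_real _ _ _ m2 (fun i => en (v_ (s i))) (en v) (p * (I0 + c + e))
  (fun i => fv (s i)) (fun i z => edens_ge0 A _ _) (mf_edens A mv') (edens_ge0 A v).
- have c1 := ae_prod1 mu cv; have c2 := ae_prod2 mu cv.
  apply: filterS2 c1 c2 => z /= c1 c2; rewrite /edens.
  apply: cvgMr; apply: (@cvgn_comp _ (fun t : R => `|t| `^ p)).
    exact: normr_powR_continuous.
  exact: cvgB.
- have n1 : \forall i \near \oo, Rintegral mu setT (fun x => f x * v_ (s i) x) <= c + e / 2.
    have lt : c < c + e / 2 by lra.
    have hh := (@cvgr_le _ _ _ _ _ _ cI _ lt). exact: hh.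
  have n2 : \forall i \near \oo, i.+1%:R^-1 <= e / 2.
    have /cvgr0Pnorm_lt/(_ _ e20) := @cvg_harmonic R.
    by apply: filterS => i /ltW; rewrite /= ger0_norm.
  apply: filterS2 n1 n2 => i h1 h2; rewrite -/(En (v_ (s i))) -ler_pdivrMl //.
  have := (hv_ (s i)).2; rewrite /Jfun.
  have h3 : (s i).+1%:R^-1 <= i.+1%:R^-1 :> R.
    by rewrite lef_pV2 ?posrE ?ltr0n // ler_nat ltnS.
  move: (Rintegral _ _ _) (p^-1 * _) (s i).+1%:R^-1 i.+1%:R^-1 h1 h2 h3 => *; lra.
rewrite /Jfun -/c lerBlDr ler_pdivrMl //; apply: le_trans h _.
by apply: ler_wpM2l; [exact: ltW|rewrite -addrA [c + e]addrC addrA].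
Qed.

End minimization.

(** * Signed integrals in the extended reals *)

Section signed_integral.
Context {d : measure_display} {T : measurableType d} {R : realType}.
Variable m : {measure set T -> \bar R}.
Implicit Types F G : T -> R.

(** Same shape as [intN] and [int2N]. If the negative part has infinite integral, the difference is
    -oo whatever the positive part is. *)
Definition sint F : \bar R :=
  (\int[m]_z (Num.max (F z) 0)%:E - \int[m]_z (Num.max (- F z) 0)%:E)%E.

Lemma igr_pos F : igr m F -> igr m (fun z => Num.max (F z) 0).
Proof.
move=> h; have mF := igr_meas h.
apply: (igr_le _ _ (integrable_norm h)); first by measf.
move=> z /=; rewrite ger0_norm ?le_max ?lexx ?orbT //.
by rewrite ge_max normr_ge0 ler_norm.
Qed.

Lemma sintE F : igr m F -> sint F = (Rintegral m setT F)%:E.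
Proof.
move=> h; have h1 := igr_pos h.
have h2 : igr m (fun z => Num.max (- F z) 0).
  apply: igr_pos; have := igrZ (-1) h.
  by congr (igr m _); apply/funext => z; rewrite mulN1r.
rewrite /sint !EFin_Rintegral // -EFinB -Rint_B //; congr EFin.
by congr Rintegral; apply/funext => z; mm; lra.
Qed.

(** The minorant [- G] excludes the value -oo, for which the upper bound would carry no information;
    the bound then forces the positive part to be integrable. *)
Lemma sint_igr F G (r : R) : measurable_fun setT F -> igr m G ->
  (forall z, - G z <= F z) -> (forall z, 0 <= G z) -> (sint F <= r%:E)%E ->
  igr m F /\ Rintegral m setT F <= r.
Proof.
move=> mF hG FG G0 h; have mG := igr_meas hG.
have h2 : igr m (fun z => Num.max (- F z) 0).
  apply: (igr_le _ _ hG); first by measf.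
  move=> z; rewrite ger0_norm ?le_max ?lexx ?orbT // ge_max G0 andbT lerNl.
  exact: FG.
suff h1 : igr m (fun z => Num.max (F z) 0).
  have hF : igr m F.
    have := igrB h1 h2; congr (igr m _); apply/funext => z; mm; lra.
  by split => //; move: h; rewrite sintE // lee_fin.
apply/igr_ge0P; [by measf|by move=> z; rewrite le_max lexx orbT|].
move: h; rewrite /sint [X in (_ - X)%E]EFin_Rintegral // leeBlDr //.
by move=> /le_lt_trans; apply; rewrite -EFinD ltry.
Qed.

End signed_integral.

(** * From minimizers to inequalities tested with truncations *)

Section variational_solutions.
Context {d : measure_display} {T : measurableType d} {R : realType}.
Variables (mu : {sigma_finite_measure set T -> \bar R}) (p : R) (K : T * T -> R).
Variables (O : set T) (W : (T -> R) -> Prop) (lam1 sg : R).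
Hypothesis A : admissible mu p K O W lam1 sg.

Local Notation m2 := (mu \x mu)%E.
Local Notation mfun := (measurable_fun setT).
Local Notation en := (edens p K).
Local Notation fe := (fin_energy mu p K).
Local Notation En := (energy mu p K).
Local Notation pr := (aform p K).
Implicit Types u v w f : T -> R.

Let p1 : 1 < p := adm_p A.
Let p0 : 0 < p. Proof. by have := p1; lra. Qed.
Let K0 := adm_K0 A.

Local Notation KK := (bounded_class mu p K W).

(** The segment from [u] to [v] respects the constraint. The tangent inequality is taken at the
    moving point w_m = u + t_m (v - u), so minimality yields the claim with A w_m in place of A u
    after division by t_m; then t_m tends to 0 under a fixed integrable bound. *)
Lemma variational_inequality n f u v : igr mu f -> KK n u ->
  (forall w, KK n w -> Jfun mu p K f u <= Jfun mu p K f w) -> KK n v ->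
  Rintegral mu setT (fun x => f x * (v x - u x)) <=
  Rintegral m2 setT (pr u (fun x => v x - u x)).
Proof.
move=> hf [Wu bu fu] umin [Wv bv fv].
have mf := igr_meas hf; have mu_ := adm_meas A Wu; have mv := adm_meas A Wv.
pose eta x := v x - u x; rewrite -/eta.
have We : W eta := W_B A Wv Wu.
have me : mfun eta by rewrite /eta; measf.
have fe_eta : fe eta := fe_B A mv mu_ fv fu.
pose t (m : nat) : R := m.+1%:R^-1.
have t0 m : 0 < t m by rewrite invr_gt0 ltr0n.
have t1 m : t m <= 1 by rewrite /t invf_le1 ?ltr0n // ler1n.
pose w m x := u x + t m * eta x.
have mw m : mfun (w m) by rewrite /w; measf.
have few m : fe (w m) by apply: (fe_D A) => //; [measf|exact: fe_Z].
have Kw m : KK n (w m).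
  split; [exact: (adm_D A Wu (adm_Z A _ We))| |exact: few].
  move=> x; have -> : w m x = (1 - t m) * u x + t m * v x by rewrite /w /eta; ring.
  apply: le_trans (ler_normD _ _) _; rewrite !normrM.
  rewrite (ger0_norm (ltW (t0 m))) ger0_norm ?subr_ge0 //.
  have -> : n = (1 - t m) * n + t m * n by ring.
  by apply: lerD; apply: ler_wpM2l; rewrite ?subr_ge0 // ltW.
have ifu : igr mu (fun x => f x * u x) := igr_mulb hf mu_ bu.
have ifv : igr mu (fun x => f x * v x) := igr_mulb hf mv bv.
have ife : igr mu (fun x => f x * eta x).
  by have := igrB ifv ifu; congr (igr mu _); apply/funext => x; rewrite /eta; ring.
have iw m : igr m2 (pr (w m) eta) by apply: (igr_aform A).
have step m : Rintegral mu setT (fun x => f x * eta x) <= Rintegral m2 setT (pr (w m) eta).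
  have h1 z : en (w m) z - en u z <= (p * t m) * pr (w m) eta z.
    have := powR_tangent (w m z.1 - w m z.2) (u z.1 - u z.2) p1.
    move=> /(ler_wpM2l (K0 z)); rewrite /edens /aform.
    have -> : u z.1 - u z.2 - (w m z.1 - w m z.2) = - (t m * (eta z.1 - eta z.2)).
      by rewrite /w; ring.
    move: (Phi p _) (`|w m z.1 - w m z.2| `^ p) (`|u z.1 - u z.2| `^ p) => a b c h.
    rewrite -subr_ge0 in h; rewrite -subr_ge0; apply: le_trans h _.
    by rewrite le_eqVlt; apply/orP; left; apply/eqP; ring.
  have h2 := Rint_le (igrB (few m) fu) (igrZ (p * t m) (iw m)) h1.
  rewrite (Rint_B (few m) fu) (Rint_Z _ (iw m)) -/(En (w m)) -/(En u) in h2.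
  have h3 := umin _ (Kw m); rewrite /Jfun in h3.
  have e1 : Rintegral mu setT (fun x => f x * w m x) =
      Rintegral mu setT (fun x => f x * u x) + t m * Rintegral mu setT (fun x => f x * eta x).
    rewrite -Rint_Z // -Rint_D //; last exact: igrZ.
    by congr Rintegral; apply/funext => x; rewrite /w; ring.
  rewrite e1 in h3.
  rewrite -(ler_pM2l (t0 m)).
  move: h2 h3; move: (Rintegral mu setT _) (Rintegral mu setT _) => a b.
  move: (Rintegral m2 setT _) (En (w m)) (En u) => c x y.
  move=> h2 h3; have h4 : p^-1 * (x - y) <= p^-1 * (p * t m * c).
    by apply: ler_wpM2l => //; rewrite invr_ge0 ltW.
  rewrite -mulrA mulKf ?gt_eqF // mulrBr in h4.
  by move: h3 h4; move: (p^-1 * x) (p^-1 * y) (t m * c) (t m * _) (t m * _) => *; lra.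
have [|||||_ cI] := @dominated_real _ _ _ m2 (fun m => pr (w m) eta) (pr u eta)
  (fun z => 2 `^ p * (en u z + en eta z) + en eta z).
- by move=> m; exact: (mf_aform A).
- exact: (mf_aform A).
- apply: nearW => z; rewrite /aform; apply: cvgMr; apply: cvgMl.
  apply: (cvgn_comp (Phi_continuous p1)).
  rewrite (_ : (fun m => _) = (fun m => (u z.1 - u z.2) + t m * (eta z.1 - eta z.2))).
    rewrite -[X in _ --> X]addr0; apply: cvgD; first exact: cvg_cst.
    by rewrite -(mul0r (eta z.1 - eta z.2)); apply: cvgMl; exact: cvg_harmonic.
  by apply/funext => m; rewrite /w; ring.
- by apply: igrD => //; apply: igrZ; exact: igrD.
- move=> m; apply: nearW => z; apply: le_trans (aform_le A _ _ _) _; rewrite lerD2r.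
  apply: le_trans (edens_D A _ _ _) _; apply: ler_wpM2l; first exact: powR_ge0.
  rewrite lerD2l edens_Z; apply: ler_piMl; first exact: (edens_ge0 A).
  rewrite [leRHS](_ : 1 = 1 `^ p); last by rewrite powR1.
  apply: powR_le => //; first exact: ltW.
  by rewrite ger0_norm ?t1 // ltW.
rewrite leNgt; apply/negP => lt.
have [N _ /(_ N (leqnn N))] := @cvgr_lt _ _ _ _ _ _ cI _ lt.
by move=> /= h; have := le_lt_trans (step N) h; rewrite ltxx.
Qed.

(** An inequality and not an equation, because the constraint |u| <= n may be active. The competitor
    u - T_k (u - phi) lies between u and phi, hence obeys the constraint as soon as phi does. *)
Definition vsol (n : R) f u := KK n u /\ forall (k : R) phi, 0 <= k -> KK n phi ->
  Rintegral m2 setT (pr u (fun x => Tk k (u x - phi x))) <=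
  Rintegral mu setT (fun x => f x * Tk k (u x - phi x)).

Lemma fe_Tk k u : 0 <= k -> mfun u -> fe u -> fe (fun x => Tk k (u x)).
Proof.
by move=> k0 mu_ fu; apply: (fe_le A _ _ fu).1 => [|z]; [measf|exact: Tk_lip].
Qed.

Lemma vsol_exists n f : 0 <= n -> igr mu f -> exists u, vsol n f u.
Proof.
move=> n0 hf; have [u Ku umin] := minimizer_exists A n0 hf.
exists u; split => // k phi k0 [Wphi bphi fphi].
have [Wu bu fu] := Ku.
have mu_ := adm_meas A Wu; have mphi := adm_meas A Wphi.
pose w x := Tk k (u x - phi x).
have Ww : W w := W_Tk A k0 (W_B A Wu Wphi).
have mw : mfun w by rewrite /w; measf.
have few : fe w by apply: fe_Tk => //; [measf|exact: (fe_B A)].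
have Kv : KK n (fun x => u x - w x).
  split; [exact: (W_B A)| |exact: (fe_B A)].
  move=> x; have := bu x; have := bphi x; rewrite /w !ler_norml.
  by move=> /andP[? ?] /andP[? ?]; apply/andP; split; mm; lra.
have := variational_inequality hf Ku umin Kv.
have ifw : igr mu (fun x => f x * w x).
  by apply: (igr_mulb hf mw (c := k)) => x; exact: Tk_norm.
have -> : (fun x => f x * (u x - w x - u x)) = (fun x => -1 * (f x * w x)).
  by apply/funext => x; ring.
have -> : pr u (fun x => u x - w x - u x) = (fun z => -1 * pr u w z).
  by apply/funext => z; rewrite /aform; ring.
rewrite Rint_Z // Rint_Z; last exact: (igr_aform A).
by move: (Rintegral _ _ _) (Rintegral _ _ _) => a b; lra.
Qed.

End variational_solutions.

(** * Comparison principle *)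

Section truncation_algebra.
Context {R : realType}.
Implicit Types a b n h : R.

Lemma pos_part_lip a b : `|Num.max a 0 - Num.max b 0| <= `|a - b|.
Proof.
wlog ab : a b / b <= a.
  move=> hw; have [ba|/ltW ab] := leP b a; first exact: hw.
  by rewrite distrC [leRHS]distrC; exact: hw.
by rewrite !ger0_norm; mm; lra.
Qed.

Lemma neg_part_mono_lip a b : a <= b ->
  0 <= b - Num.max b 0 - (a - Num.max a 0) <= b - a.
Proof. by move=> ab; apply/andP; split; mm; lra. Qed.

(** The two terms live on disjoint sets: for a <= h the excess over [Tk h a] vanishes, and for a > h
    one has a > h >= n >= b. *)
Lemma Tk_split n h a b : 0 <= n -> n <= h -> 0 <= a -> - n <= b <= n ->
  Tk n (a - Num.max (Tk h a) b) = Tk n (a - Tk h a) - Num.max (b - a) 0.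
Proof.
move=> n0 nh a0 /andP[b1 b2]; have [ah|ha] := leP a h.
  rewrite (@Tk_id _ h) ?ger0_norm // subrr Tk0 // sub0r.
  have [ab|ba] := leP b a; first by
    rewrite subrr Tk0 // max_r ?oppr0 //; lra.
  rewrite (max_l (y := 0)); last by lra.
  by rewrite opprB Tk_id // ler_norml; lra.
rewrite (@Tk_geE _ h) //; [|lra|lra].
by rewrite (max_l (x := h)) ?(max_r (y := 0)) ?subr0 //; lra.
Qed.

Lemma pos_part_Tk n h a b : 0 <= n -> n <= h -> 0 <= a -> - n <= b <= n ->
  Num.max (b - a) 0 = Num.max (b - Tk h a) 0.
Proof.
move=> n0 nh a0 /andP[b1 b2]; have [ah|ha] := leP a h.
  by rewrite (@Tk_id _ h) ?ger0_norm.
rewrite (@Tk_geE _ h) //; [|lra|lra].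
by rewrite !(max_r (y := 0)) //; lra.
Qed.

Lemma Tk_excess_le n h a b : 0 <= n -> 0 <= h -> a <= b ->
  Tk n (a - Tk h a) <= Tk n (b - Tk h b).
Proof.
move=> n0 h0 ab; apply: Tk_le; have := Tk_lip b a h0.
rewrite !ger0_norm ?subr_ge0 ?Tk_le //; lra.
Qed.

End truncation_algebra.

Section comparison_principle.
Context {d : measure_display} {T : measurableType d} {R : realType}.
Variables (mu : {sigma_finite_measure set T -> \bar R}) (p : R) (K : T * T -> R).
Variables (O : set T) (W : (T -> R) -> Prop) (lam1 sg : R).
Hypothesis A : admissible mu p K O W lam1 sg.

Local Notation m2 := (mu \x mu)%E.
Local Notation mfun := (measurable_fun setT).
Local Notation en := (edens p K).
Local Notation fe := (fin_energy mu p K).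
Local Notation En := (energy mu p K).
Local Notation pr := (aform p K).
Implicit Types u v w f : T -> R.

Let p1 : 1 < p := adm_p A.
Let p0 : 0 < p. Proof. by have := p1; lra. Qed.
Let K0 := adm_K0 A.

Local Notation KK := (bounded_class mu p K W).
Local Notation vsol := (vsol mu p K W).

(** Here [a] and [b] are increments of two functions, [s] and [t] the values of their difference at
    the two points. Then a <= b exactly when s <= t, so the two factors have the same sign. *)
Lemma mono_pos_part a b s t : a - b = s - t ->
  0 <= (Phi p a - Phi p b) * (Num.max s 0 - Num.max t 0).
Proof.
move=> e; have [st|ts] := leP s t.
  apply: mulr_le0; last by mm; lra.
  by rewrite subr_le0; apply: Phi_le => //; lra.
apply: mulr_ge0; last by mm; lra.
by rewrite subr_ge0; apply: Phi_le => //; lra.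
Qed.

Lemma mono_pos_part_eq0 a b s t : a - b = s - t ->
  (Phi p a - Phi p b) * (Num.max s 0 - Num.max t 0) = 0 -> Num.max s 0 = Num.max t 0.
Proof.
move=> e /eqP; rewrite mulf_eq0 => /orP[|]; rewrite subr_eq0 => /eqP // h.
suff -> : s = t by [].
have [ab|ab|ab] := ltgtP a b; last by lra.
  by have := Phi_lt p1 ab; rewrite h ltxx.
by have := Phi_lt p1 ab; rewrite h ltxx.
Qed.

Lemma energy0_ae v : W v -> fe v -> En v <= 0 -> {ae mu, forall x, v x = 0}.
Proof.
move=> Wv fv E0; have [i3 h3] := adm_poincare A Wv fv.
have l0 := adm_lam1 A.
have : Rintegral mu setT (fun x => \1_O x * `|v x| `^ p) <= 0.
  by rewrite -(pmulr_rle0 _ l0); exact: le_trans h3 E0.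
have g0 x : 0 <= \1_O x * `|v x| `^ p by rewrite mulr_ge0 ?powR_ge0.
move=> /(Rint_eq0_ae i3 g0); apply: filterS => x hx.
have [Ox|nO] := pselect (O x); last exact: (adm_out A Wv nO).
by move: hx; rewrite indicE mem_set // mul1r => /powR_eq0_eq0 /normr0_eq0.
Qed.

(* Testing [u] with [max (T_h u) w] and [w] with [min w u]: the truncation at height
   [h >= n] separates [(w - u)^+] from [u - T_h u]. *)
Lemma comparison n w f1 u f2 : 0 <= n -> vsol n f1 w -> igr mu f1 -> igr mu f2 ->
  {ae mu, forall x, f1 x <= f2 x} ->
  mfun u -> (forall x, 0 <= u x) ->
  (forall e, 0 < e -> exists2 h, n <= h & [/\ W (fun x => Tk h (u x)),
    fe (fun x => Tk h (u x)),
    (sint m2 (pr u (fun x => Tk n (u x - Num.max (Tk h (u x)) (w x)))) <=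
      (Rintegral mu setT (fun x => f2 x * Tk n (u x - Num.max (Tk h (u x)) (w x))))%:E)%E &
    Rintegral mu setT (fun x => f2 x * Tk n (u x - Tk h (u x))) <= e]) ->
  {ae mu, forall x, w x <= u x}.
Proof.
move=> n0 [[Ww bw fw] hw] i1 i2 f12 mu_ u0 H.
have mw := adm_meas A Ww; have mf1 := igr_meas i1; have mf2 := igr_meas i2.
pose eta x := Num.max (w x - u x) 0.
have me : mfun eta by rewrite /eta; measf.
have wn x : - n <= w x <= n by rewrite -ler_norml.
have eta0 x : 0 <= eta x by rewrite /eta le_max lexx orbT.
have etan x : `|eta x| <= n.
  by rewrite ger0_norm // /eta; have := wn x; have := u0 x; mm; lra.
have [h0 nh0 [WT0 fT0 _ _]] := H 1 ltr01.
have etaE h x : n <= h -> eta x = Num.max (w x - Tk h (u x)) 0.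
  by move=> nh; exact: (pos_part_Tk n0).
have We : W eta.
  have := W_pos A (W_B A Ww WT0); congr (W _); apply/funext => x.
  by rewrite (etaE h0).
have fE : fe eta.
  have mT0 := adm_meas A WT0.
  apply: (fe_le A me _ (fe_B A mw mT0 fw fT0)).1 => z; rewrite !(etaE h0) //.
  exact: pos_part_lip.
have iwe : igr m2 (pr w eta) by apply: (igr_aform A).
have if1e : igr mu (fun x => f1 x * eta x) := igr_mulb i1 me etan.
have if2e : igr mu (fun x => f2 x * eta x) := igr_mulb i2 me etan.
have hwe : Rintegral m2 setT (pr w eta) <= Rintegral mu setT (fun x => f1 x * eta x).
  have Kphi : KK n (fun x => w x - eta x).
    split; [exact: (W_B A)| |exact: (fe_B A)].
    move=> x; rewrite ler_norml; apply/andP; rewrite /eta.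
    by have := wn x; have := u0 x; split; mm; lra.
  have := hw n _ n0 Kphi.
  rewrite (_ : (fun x => Tk n (w x - (w x - eta x))) = eta); last first.
    by apply/funext => x; rewrite opprB addrC subrK Tk_id.
  rewrite (_ : (fun x => f1 x * Tk n (w x - (w x - eta x))) = (fun x => f1 x * eta x)) //.
  by apply/funext => x; rewrite opprB addrC subrK Tk_id.
have h12 : Rintegral mu setT (fun x => f1 x * eta x) <= Rintegral mu setT (fun x => f2 x * eta x).
  by apply: Rint_le_ae => //; apply: filterS f12 => x h; apply: ler_wpM2r.
pose P z := pr w eta z - pr u eta z.
have P0 z : 0 <= P z.
  rewrite /P /aform -mulrBr -mulrBl mulr_ge0 ?K0 //; apply: mono_pos_part; ring.
have mP : mfun P.
  by have h1 := mf_aform A mw me; have h2 := mf_aform A mu_ me; rewrite /P; measf.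
have key e : 0 < e -> igr m2 P /\ Rintegral m2 setT P <= e.
  move=> /H[h nh [WT fT hF hG]].
  have h00 : 0 <= h := le_trans n0 nh.
  set V := fun x => Tk n (u x - Num.max _ _) in hF.
  have mV : mfun V by rewrite /V; measf.
  pose Gu x := Tk n (u x - Tk h (u x)).
  have mGu : mfun Gu by rewrite /Gu; measf.
  have VE x : V x = Gu x - eta x.
    exact: Tk_split.
  have F1 z : 0 <= pr u Gu z.
    rewrite /aform mulr_ge0 ?K0 // /Gu; have [ab|/ltW ab] := leP (u z.1) (u z.2).
      apply: mulr_le0; last by rewrite subr_le0; exact: Tk_excess_le.
      by rewrite -(Phi0 p); apply: Phi_le => //; lra.
    apply: mulr_ge0; last by rewrite subr_ge0; exact: Tk_excess_le.
    by rewrite -(Phi0 p); apply: Phi_le => //; lra.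
  have FE z : pr u V z = pr u Gu z - pr u eta z.
    by rewrite /aform !VE; ring.
  (* Integrable majorant of [pr u eta], which gives the signed integral a meaning. If both values of
     u are at most h, u may be replaced by its truncation; if one exceeds h, [eta] vanishes there
     and the product is not positive. *)
  pose B z := en (fun x => Tk h (u x)) z + en eta z.
  have iB : igr m2 B := igrD fT fE.
  have B0 z : 0 <= B z by rewrite addr_ge0 ?(edens_ge0 A).
  have eta_hi x : h < u x -> eta x = 0.
    by rewrite /eta; have := wn x; mm; lra.
  have F2 z : pr u eta z <= B z.
    have [z1|z1] := leP (u z.1) h; have [z2|z2] := leP (u z.2) h.
    - have := aform_le A (fun x => Tk h (u x)) eta z; rewrite /aform.
      have -> : Tk h (u z.1) = u z.1 by apply: Tk_id; rewrite ger0_norm.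
      have -> : Tk h (u z.2) = u z.2 by apply: Tk_id; rewrite ger0_norm.
      by move=> hh; apply: le_trans hh; exact: ler_norm.
    - apply: le_trans (B0 z); rewrite /aform (eta_hi z.2) // subr0.
      rewrite -[leRHS](mulr0 (K z)); apply: ler_wpM2l; first exact: K0.
      apply: mulr_le0_ge0 => //; rewrite -(Phi0 p); apply: Phi_le => //; lra.
    - apply: le_trans (B0 z); rewrite /aform (eta_hi z.1) // sub0r.
      rewrite -[leRHS](mulr0 (K z)); apply: ler_wpM2l; first exact: K0.
      apply: mulr_ge0_le0; last by rewrite oppr_le0.
      by rewrite -(Phi0 p); apply: Phi_le => //; lra.
    - by apply: le_trans (B0 z); rewrite /aform !eta_hi // subrr !mulr0.
  have [iF hF'] : igr m2 (pr u V) /\ Rintegral m2 setT (pr u V) <=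
      Rintegral mu setT (fun x => f2 x * V x).
    apply: (sint_igr (mf_aform A mu_ mV) iB _ B0 hF) => z.
    by rewrite FE; have := F1 z; have := F2 z; lra.
  have PF z : P z <= pr w eta z + pr u V z.
    by rewrite /P FE; have := F1 z; lra.
  have iS := igrD iwe iF.
  have iP : igr m2 P.
    by apply: (igr_le mP _ iS) => z; rewrite ger0_norm.
  split => //; apply: le_trans (Rint_le iP iS PF) _; rewrite Rint_D //.
  have if2G : igr mu (fun x => f2 x * Gu x).
    by apply: (igr_mulb i2 mGu (c := n)) => x; exact: Tk_norm.
  have e1 : Rintegral mu setT (fun x => f2 x * V x) =
     Rintegral mu setT (fun x => f2 x * Gu x) - Rintegral mu setT (fun x => f2 x * eta x).
    rewrite -Rint_B //; congr Rintegral; apply/funext => x; rewrite VE; ring.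
  move: hF' hG hwe h12; rewrite e1 -/Gu.
  move: (Rintegral m2 setT _) (Rintegral m2 setT _) (Rintegral mu setT _) => a b c.
  by move: (Rintegral mu setT _) (Rintegral mu setT _) => x y; lra.
have [iP _] := key 1 ltr01.
have hP : Rintegral m2 setT P <= 0.
  by apply/ler_addgt0Pr => e e0; rewrite add0r; exact: (key e e0).2.
(* Equality in the monotonicity inequality forces equal values of [eta] at both points wherever the
   kernel is positive, so [eta] has zero energy and the Poincare inequality makes it vanish. *)
have aP := Rint_eq0_ae iP P0 hP.
have ae_e : {ae m2, forall z, en eta z = 0}.
  apply: filterS aP => z; rewrite /P /aform -mulrBr -mulrBl /edens => /eqP.
  rewrite mulf_eq0 => /orP[/eqP ->|/eqP h]; first by rewrite mul0r.
  rewrite (_ : eta z.1 = eta z.2) ?subrr ?normr0 ?powR0 ?mulr0 ?gt_eqF //.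
  by apply: (mono_pos_part_eq0 _ h); ring.
have E0 : En eta = 0.
  have [_ h] := igr_ae ae_e (mf_cst _) fE.
  by rewrite /energy h /Rintegral integral0.
have Ele : En eta <= 0 by rewrite E0.
apply: filterS (energy0_ae We fE Ele) => x.
by rewrite /eta; mm; lra.
Qed.

End comparison_principle.

(** In the application M and G are the masses of u^(p-1) and g, [m k] is the mass of u^(p-1) above
    level k, [tp k] the integral of (T_k u)^p and c the measure of O. The point is that [C] depends
    on p, sg, B and c only: the level k0 beyond which [m] vanishes merely starts a downward
    induction over doubled levels. *)
Lemma apriori_numeric {R : realType} (p sg B c : R) : 1 < p -> 0 < sg -> 0 <= B -> 0 <= c ->
  exists2 C : R, 0 <= C & forall (M G : R) (m tp : R -> R), 0 <= M -> 0 <= G ->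
  (forall k : R, 0 <= m k <= M) -> (forall k l, k <= l -> m l <= m k) ->
  (exists k0, forall k, k0 <= k -> m k = 0) ->
  (forall k : R, 0 < k -> m (2 * k) <= m (4 * k) + B * (k `^ (1 - p) * M) `^ sg * (m k + G)) ->
  (forall k : R, 0 < k -> tp k <= B * k * (m k + G)) ->
  (forall k s : R, 0 < k -> 0 < s -> M <= m k + s * c + s `^ (- (p - 1)^-1) * tp k) ->
  M <= C * G.
Proof.
move=> p1 sg0 B0 c0; have q0 : 0 < p - 1 by lra.
have [rho rhoE] : exists rho : R, rho = 2 `^ ((1 - p) * sg) by eexists.
have rho1 : rho < 1.
  have -> : rho = (2 `^ ((p - 1) * sg))^-1.
    by rewrite rhoE -powRN; congr (_ `^ _); ring.
  rewrite invf_lt1 ?powR_gt0 //; have := @powR_lt R ((p - 1) * sg) 1 2.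
  by rewrite powR1; apply => //; [rewrite mulr_gt0|lra].
have rho0 : 0 <= rho by rewrite rhoE powR_ge0.
(* Solution of D = D rho + B: in passing from level 2k to level k the earlier factor is multiplied
   by [rho], because X (2k) = rho X k. *)
have [D DB] : exists D, D = B / (1 - rho) by eexists.
have D0 : 0 <= D by rewrite DB divr_ge0 // subr_ge0 ltW.
have DE : D * rho + B = D by rewrite DB; field; rewrite gt_eqF // subr_gt0.
(* With this [t], every level k with k^(p-1) >= t M satisfies D X k <= 1/4, so doubling it gives m
   (2k) <= (m k + G) / 4. *)
have [t tE] : exists t, t = (4 * D + 1) `^ sg^-1 by eexists.
have t0 : 0 < t by rewrite tE powR_gt0; lra.
(* [H] is s^(-1/(p-1)) times the level [kk], for the [s] chosen below; M cancels in this product, so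
   [H] is a constant. Then [j] is so large that (1 + B H) 2^-j <= 1/4. *)
have [H HE] : exists H, H = (t * (4 * (c + 1))) `^ (p - 1)^-1 by eexists.
have H0 : 0 <= H by rewrite HE powR_ge0.
have [j jE] : exists j, j = Num.bound (4 * (1 + B * H)) by eexists.
have BH0 : 0 <= B * H by rewrite mulr_ge0.
have j2 : 4 * (1 + B * H) <= 2 ^+ j.
  apply: le_trans (ltW (archi_boundP _)) _; first by lra.
  by rewrite -jE -natrX ler_nat ltnW // ltn_expl.
have tj0 : 0 < 2 ^+ j :> R by rewrite exprn_gt0.
exists (2 * (1 + 2 * (2 ^+ j * (B * H)))).
  by rewrite mulr_ge0 // addr_ge0 // mulr_ge0 // mulr_ge0 // ltW.
move=> M G m tp M0 G0 mM mdec [k0 mk0] h1 h2 h3.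
have [M00|Mp] := eqVneq M 0.
  rewrite M00 mulr_ge0 // mulr_ge0 // addr_ge0 // mulr_ge0 // mulr_ge0 //; exact: ltW.
have {}Mp : 0 < M by rewrite lt_def Mp.
pose X k := (k `^ (1 - p) * M) `^ sg.
have X0 k : 0 <= X k by exact: powR_ge0.
have X2 (k : R) : 0 <= k -> X (2 * k) = rho * X k.
  move=> kk; rewrite /X (@powRM _ 2 k) // -mulrA powRM ?powR_ge0 //; last first.
    by rewrite mulr_ge0 ?powR_ge0.
  by rewrite -powRrM rhoE.
have m0 k : 0 <= m k by case/andP: (mM k).
have mG k : 0 <= m k + G by rewrite addr_ge0.
have claim J : forall k : R, 0 < k -> k0 <= 2 ^+ J * k -> m (2 * k) <= D * X k * (m k + G).
  elim: J => [|J ih] k kp.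
    rewrite expr0 mul1r => kk; rewrite mk0; last by lra.
    by rewrite !mulr_ge0.
  rewrite exprSr -mulrA => /ih h; have {}h := h ltac:(lra).
  have e4 : 2 * (2 * k) = 4 * k by ring.
  rewrite e4 X2 in h; last by lra.
  apply: le_trans (h1 _ kp) _; rewrite -/(X k).
  have h' : m (4 * k) <= D * rho * X k * (m k + G).
    apply: le_trans h _; rewrite mulrA.
    apply: ler_wpM2l; first by rewrite !mulr_ge0.
    by rewrite lerD2r; apply: mdec; lra.
  rewrite -[Y in _ <= Y * X k * _]DE; apply: le_trans (lerD h' (lexx _)) _.
  by rewrite -mulrDl -mulrDl.
have {claim} claim (k : R) : 0 < k -> m (2 * k) <= D * X k * (m k + G).
  move=> kp; apply: (claim (Num.bound (`|k0| / k)) k kp).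
  rewrite -ler_pdivrMr //; apply: (@le_trans _ _ (`|k0| / k)).
    by apply: ler_wpM2r; [rewrite invr_ge0 ltW|exact: ler_norm].
  apply: le_trans (ltW (archi_boundP _)) _; first by rewrite divr_ge0 // ltW.
  by rewrite -natrX ler_nat ltnW // ltn_expl.
have tM0 : 0 < t * M by rewrite mulr_gt0.
have [kk kkE] : exists kk, kk = (t * M) `^ (p - 1)^-1 by eexists.
have kk0 : 0 < kk by rewrite kkE powR_gt0.
have DX (k : R) : kk <= k -> D * X k <= 4^-1.
  move=> kkk; have kp : 0 < k := lt_le_trans kk0 kkk.
  have hk : t * M <= k `^ (p - 1).
    have -> : t * M = kk `^ (p - 1).
      by rewrite kkE -powRrM mulVf ?gt_eqF // powRr1 // ltW.
    by apply: powR_le => //; exact: ltW.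
  have hX : k `^ (1 - p) * M <= t^-1.
    have -> : k `^ (1 - p) = (k `^ (p - 1))^-1.
      by rewrite -powRN; congr (_ `^ _); ring.
    rewrite mulrC ler_pdivrMr ?powR_gt0 // ler_pdivlMl //.
  have hX2 : X k <= (4 * D + 1)^-1.
    have -> : (4 * D + 1)^-1 = t^-1 `^ sg.
      rewrite -(powR_inv1 (ltW t0)) -powRrM mulN1r powRN; congr (_^-1).
      by rewrite tE -powRrM mulVf ?gt_eqF // powRr1 //; lra.
    by apply: powR_le => //; [exact: ltW|rewrite mulr_ge0 ?powR_ge0].
  apply: le_trans (ler_wpM2l D0 hX2) _; rewrite ler_pdivrMr; last by lra.
  by rewrite mulrDr mulrA mulVf ?pnatr_eq0 // mul1r mulr1 lerDl.
have mj i : m (2 ^+ i * kk) <= 4^-1 ^+ i * M + G.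
  elim: i => [|i ih].
    by rewrite !expr0 !mul1r; case/andP: (mM kk) => _ h; rewrite (le_trans h) // lerDl.
  have ki : 0 < 2 ^+ i * kk by rewrite mulr_gt0 // exprn_gt0.
  rewrite exprS -mulrA; apply: le_trans (claim _ ki) _.
  have dx : D * X (2 ^+ i * kk) <= 4^-1.
    by apply: DX; apply: ler_peMl; [exact: ltW|apply: exprn_ege1; lra].
  apply: le_trans (ler_wpM2r (mG _) dx) _.
  rewrite exprS -mulrA; move: ih; move: (m _) (4^-1 ^+ i * M) => a b; lra.
(* This [s] makes s c at most M / 4; together with the choice of [j], half of M is absorbed into the
   left-hand side. *)
have [s sE] : exists s, s = M / (4 * (c + 1)) by eexists.
have s0 : 0 < s by rewrite sE divr_gt0 //; lra.
have kj : 0 < 2 ^+ j * kk by rewrite mulr_gt0.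
have := h3 _ _ kj s0.
have sc : s * c <= M / 4.
  rewrite sE invfM mulrA -mulrA; apply: ler_piMr; first by rewrite divr_ge0.
  by rewrite mulrC ler_pdivrMr; lra.
have hH : s `^ (- (p - 1)^-1) * (2 ^+ j * kk) = 2 ^+ j * H.
  rewrite mulrCA kkE HE; congr (_ * _); rewrite powRN -powR_inv1 ?powR_ge0 //.
  rewrite -powRrM mulrC [_ * -1]mulrC powRrM powR_inv1 ?ltW // -powRM ?invr_ge0 ?ltW //.
  congr (_ `^ _); rewrite sE; field; lra.
have hT : s `^ (- (p - 1)^-1) * tp (2 ^+ j * kk) <= B * (2 ^+ j * H) * (4^-1 ^+ j * M + 2 * G).
  apply: le_trans (ler_wpM2l (powR_ge0 _ _) (h2 _ kj)) _.
  rewrite (_ : _ * (B * _ * _) =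
    B * (s `^ (- (p - 1)^-1) * (2 ^+ j * kk)) * (m (2 ^+ j * kk) + G)); last by ring.
  rewrite hH; apply: ler_wpM2l; first by rewrite mulr_ge0 // mulr_ge0 // ltW.
  by have := mj j; lra.
have e4 : 2 ^+ j * 4^-1 ^+ j = 2^-1 ^+ j :> R.
  by rewrite -exprMn; congr (_ ^+ _); clear; lra.
have q1 : 4^-1 ^+ j <= 2^-1 ^+ j :> R by apply: lerXn2r; rewrite ?nnegrE; clear; lra.
have q2 : (1 + B * H) * 2^-1 ^+ j <= 4^-1.
  by rewrite exprVn ler_pdivrMr //; lra.
have q3 : B * (2 ^+ j * H) * (4^-1 ^+ j * M + 2 * G) =
   (B * H * 2^-1 ^+ j) * M + 2 * (2 ^+ j * (B * H)) * G by rewrite -e4; ring.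
rewrite q3 in hT.
have q4 : 4^-1 ^+ j * M + B * H * 2^-1 ^+ j * M <= 4^-1 * M.
  rewrite -mulrDl; apply: ler_wpM2r => //; apply: le_trans q2.
  by rewrite mulrDl mul1r lerD2r.
have q5 : 2 * (1 + 2 * (2 ^+ j * (B * H))) * G = 2 * G + 2 * (2 * (2 ^+ j * (B * H)) * G).
  by ring.
rewrite q5; have := mj j; move: hT sc q4.
move: (2 * (2 ^+ j * (B * H)) * G) (m (2 ^+ j * kk)) (s * c) (_ * tp _).
move: (4^-1 ^+ j * M) (B * H * 2^-1 ^+ j * M) => *; lra.
Qed.

(** * A bound on the mass of u^(p-1), uniform in the level *)

Section apriori_estimate.
Context {d : measure_display} {T : measurableType d} {R : realType}.
Variables (mu : {sigma_finite_measure set T -> \bar R}) (p : R) (K : T * T -> R).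
Variables (O : set T) (W : (T -> R) -> Prop) (lam1 sg : R).
Hypothesis A : admissible mu p K O W lam1 sg.

Local Notation m2 := (mu \x mu)%E.
Local Notation mfun := (measurable_fun setT).
Local Notation en := (edens p K).
Local Notation fe := (fin_energy mu p K).
Local Notation En := (energy mu p K).
Local Notation pr := (aform p K).
Implicit Types u v w f : T -> R.

Let p1 : 1 < p := adm_p A.
Let p0 : 0 < p. Proof. by have := p1; lra. Qed.
Let mK := adm_mK A.
Let K0 := adm_K0 A.
Let mO := adm_mO A.

Local Notation vsol := (vsol mu p K W).

Lemma igr_bounded_out v (c : R) : mfun v -> (forall x, `|v x| <= c) ->
  (forall x, ~ O x -> v x = 0) -> igr mu v.
Proof.
move=> mv bv ov; have [i1 _] := igr_indic mO (adm_fO A).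
apply: (igr_le mv _ (igrZ c i1)) => x.
have [Ox|nO] := pselect (O x); first by rewrite indicE mem_set // mulr1.
by rewrite ov // normr0 indicE memNset // mulr0.
Qed.

(** The increment of tau(u) has the sign of the increment of u and is no larger, so p - 1 of its p
    factors may be replaced by the increment of u. *)
Lemma aform_lip_mono (tau : R -> R) u z :
  (forall a b, a <= b -> 0 <= tau b - tau a <= b - a) ->
  en (fun x => tau (u x)) z <= pr u (fun x => tau (u x)) z.
Proof.
move=> htau; rewrite /edens /aform ler_wpM2l ?K0 //.
wlog ab : z / u z.2 <= u z.1.
  move=> hw; have [h|/ltW h] := leP (u z.2) (u z.1); first exact: hw.
  have := hw (z.2, z.1) h => /=; rewrite distrC => /le_trans; apply.
  by rewrite -opprB PhiN -[tau _ - _]opprB mulrNN.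
have /andP[t0 t1] := htau _ _ ab.
rewrite ger0_norm // Phi_ge0E ?subr_ge0 // -(powRB1_mul p1 t0).
by apply: ler_wpM2r => //; apply: powR_le => //; have := p1; lra.
Qed.

Lemma Tk_0l (a : R) : Tk 0 a = 0.
Proof. by mm; lra. Qed.

Lemma Tk_mono_lip k : 0 <= k -> forall a b : R, a <= b -> 0 <= Tk k b - Tk k a <= b - a.
Proof.
move=> k0 a b ab; rewrite subr_ge0 Tk_le //=.
have := Tk_lip b a k0; rewrite !ger0_norm ?subr_ge0 ?Tk_le //.
Qed.

Lemma Tk_excess_mono_lip k h : 0 <= k -> 0 <= h ->
  forall a b : R, a <= b -> 0 <= Tk k (b - Tk h b) - Tk k (a - Tk h a) <= b - a.
Proof.
move=> k0 h0 a b ab; have /andP[h1 h2] := Tk_mono_lip h0 ab.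
have ab' : a - Tk h a <= b - Tk h b by lra.
by have /andP[h3 h4] := Tk_mono_lip k0 ab'; lra.
Qed.

(** The test function is phi = T_h u. The excess T_k (u - T_h u) is a nondecreasing 1-Lipschitz
    function of u, so the tested form bounds its own energy; h = 0 is the test with T_k u. *)
Lemma vsol_test_excess n f u k h : vsol n f u -> 0 <= k -> 0 <= h ->
  let V := fun x => Tk k (u x - Tk h (u x)) in
  [/\ W V, fe V, igr m2 (pr u V) & En V <= Rintegral m2 setT (pr u V) /\
    Rintegral m2 setT (pr u V) <= Rintegral mu setT (fun x => f x * V x)].
Proof.
move=> [[Wu bu fu] hu] k0 h0 V; have mu_ := adm_meas A Wu.
have WT : W (fun x => Tk h (u x)) by apply: (W_Tk A).
have fT : fe (fun x => Tk h (u x)) by apply: (fe_Tk A).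
have mT := adm_meas A WT.
have WV : W V by apply: (W_Tk A) => //; exact: (W_B A).
have fV : fe V by apply: (fe_Tk A) => //; [measf|exact: (fe_B A)].
have mV := adm_meas A WV.
have iV : igr m2 (pr u V) by apply: (igr_aform A).
split => //; split.
  by apply: Rint_le => // z; apply: (aform_lip_mono (tau := fun a => Tk k (a - Tk h a)));
    exact: Tk_excess_mono_lip.
apply: hu => //; split => // x; apply: le_trans (bu x).
exact: Tk_norm_le.
Qed.

(** The datum f may contain u itself through the right-hand side, and [C] must not depend on [n].
    Three estimates are fed into the numerical lemma: decay of the mass above level 2k, a bound on
    the integral of (T_k u)^p, and a splitting of the total mass. *)
Lemma apriori_bound (lam : R) : 0 < lam < lam1 -> exists2 C : R, 0 <= C &
  forall (n : R) f g u, 0 <= n -> vsol n f u -> (forall x, 0 <= u x) -> igr mu f -> igr mu g ->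
  (forall x, 0 <= g x) -> {ae mu, forall x, f x <= lam * u x `^ (p - 1) + g x} ->
  igr mu (fun x => u x `^ (p - 1)) /\
  Rintegral mu setT (fun x => u x `^ (p - 1)) <= C * Rintegral mu setT g.
Proof.
move=> /andP[lam0 lam1_]; have [CG CG0 gain] := adm_gain A; have sg0 := adm_sg A.
have q0 : 0 < p - 1 by have := p1; lra.
have dl : 0 < lam1 - lam by lra.
have l1 (k a : R) : 0 < k -> 2 * k <= a -> 3 / 2 * k <= a by move=> *; lra.
have l2 (k a : R) : 0 < k -> 3 / 2 * k <= a -> k <= a by move=> *; lra.
have l3 (k a : R) : 0 < k -> 2 * k <= a -> k <= a - k by move=> *; lra.
have l4 (k a : R) : a < 3 / 2 * k -> a - k <= k / 2 by move=> *; lra.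
have l5 (k a : R) : 0 < k -> a <= k / 2 -> k / 2 <= k - a by move=> *; lra.
have l6 (k a : R) : 0 < k -> a <= k / 2 -> a <= k by move=> *; lra.
pose B1 := (lam + 1) / (lam1 - lam).
pose B2 := 4 `^ (p - 1) * (CG * 2 `^ p * (lam + 1)).
have B10 : 0 <= B1 by rewrite divr_ge0 // ?ltW //; lra.
have B20 : 0 <= B2 by rewrite !mulr_ge0 ?powR_ge0 ?ltW //; lra.
have c0 : 0 <= fine (mu O) by apply: fine_ge0.
have [C C0 HC] := @apriori_numeric R p sg (B1 + B2) (fine (mu O)) p1 sg0
  (addr_ge0 B10 B20) c0.
exists C => // n f g u n0 hu u0 hf hg g0 fg.
have [[Wu bu fu] tu] := hu; have mu_ := adm_meas A Wu.
have ou := adm_out A Wu.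
have [iO iOE] := igr_indic mO (adm_fO A).
pose U x := u x `^ (p - 1).
have mU : mfun U by rewrite /U; measf.
have U0 x : 0 <= U x by exact: powR_ge0.
have oU x : ~ O x -> U x = 0 by move=> /ou h; rewrite /U h powR0 // gt_eqF.
have bU x : `|U x| <= n `^ (p - 1).
  by rewrite ger0_norm //; apply: powR_le; [exact: ltW| |have := bu x; rewrite ger0_norm].
have iU : igr mu U := igr_bounded_out mU bU oU.
split => //; rewrite -/U.
set M := Rintegral mu setT U; set G := Rintegral mu setT g.
pose ch k x : R := \1_[set x | k < u x] x.
have chT (k : R) x : k < u x -> ch k x = 1 by move=> h; rewrite /ch indicE mem_set.
have chF (k : R) x : u x <= k -> ch k x = 0.
  by move=> h; rewrite /ch indicE memNset //= ; apply/negP; rewrite -leNgt.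
have ch01 k x : 0 <= ch k x <= 1.
  by have [h|h] := leP (u x) k; [rewrite chF|rewrite chT] => //; rewrite lexx ler01.
have mch k : mfun (ch k) by apply: mf_indic; exact: measurable_gt.
pose mk k := Rintegral mu setT (fun x => ch k x * U x).
have ich k : igr mu (fun x => ch k x * U x).
  apply: (igr_le _ _ iU); first by have mc := mch k; measf.
  move=> x; have /andP[c1 c2] := ch01 k x; rewrite ger0_norm ?mulr_ge0 //.
  exact: ler_piMl.
have mf := igr_meas hf; have mg := igr_meas hg.
pose F x := lam * U x + g x.
have iF : igr mu F by apply: igrD => //; exact: igrZ.
have test (V : T -> R) (c : R) : mfun V -> (forall x, 0 <= V x <= c) ->
    Rintegral mu setT (fun x => f x * V x) <= Rintegral mu setT (fun x => F x * V x).
  move=> mV bV; have bV' x : `|V x| <= c.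
    by have /andP[h1 h2] := bV x; rewrite ger0_norm.
  apply: Rint_le_ae; [exact: (igr_mulb hf mV bV')|exact: (igr_mulb iF mV bV')|].
  by apply: filterS fg => x h; apply: ler_wpM2r => //; case/andP: (bV x).
pose tp k := Rintegral mu setT (fun x => Tk k (u x) `^ p).
have itp k : 0 < k -> igr mu (fun x => Tk k (u x) `^ p).
  move=> k0; apply: (@igr_bounded_out _ (k `^ p)); first by measf.
    move=> x; rewrite ger0_norm ?powR_ge0 //; apply: powR_le; first exact: ltW.
      by apply: Tk_ge0 => //; exact: ltW.
    by have := Tk_norm (u x) (ltW k0); rewrite ger0_norm // Tk_ge0 // ltW.
  by move=> x /ou ->; rewrite Tk0 ?ltW // powR0 // gt_eqF.
apply: (HC M G mk tp).
- exact: Rint_ge0.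
- exact: Rint_ge0.
- move=> k; apply/andP; split.
    by apply: Rint_ge0 => x; rewrite mulr_ge0 //; case/andP: (ch01 k x).
  by apply: Rint_le => // x; apply: ler_piMl => //; case/andP: (ch01 k x).
- move=> k l kl; apply: Rint_le => // x; apply: ler_wpM2r => //.
  have [h|h] := leP (u x) l; first by rewrite chF //; case/andP: (ch01 k x).
  by rewrite !chT // (le_lt_trans kl).
- exists n => k nk; rewrite /mk (_ : (fun x => _) = fun=> 0).
    by rewrite /Rintegral integral0.
  apply/funext => x; rewrite chF ?mul0r //; apply: le_trans nk.
  by have := bu x; rewrite ger0_norm.
(* Decay: the excess V = T_k (u - T_k u) equals k on E' = {u >= 2k} and is at most k/2 off E = {u >=
   3k/2}. Its energy therefore bounds the interaction of E' with the complement of E, and the gain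
   bounds |E'|, where |E| <= k^(1-p) M by Chebyshev. Between the levels 2k and 4k, u^(p-1) is at
   most (4k)^(p-1). *)
- move=> k k0; have k00 := ltW k0.
  have := vsol_test_excess hu k00 k00.
  set V := (fun x => Tk k (u x - Tk k (u x))) => -[WV fV iV [e1 e2]].
  have mV := adm_meas A WV.
  have exc x : 0 <= u x - Tk k (u x) by rewrite subr_ge0 Tk_leid.
  have V0 x : 0 <= V x by apply: Tk_ge0.
  have Vk x : V x <= k.
    by have := Tk_norm (u x - Tk k (u x)) k00; rewrite -/(V x) ger0_norm.
  have Vch x : V x <= k * ch k x.
    have [h|h] := leP (u x) k; last by rewrite chT // mulr1.
    by rewrite chF // mulr0 /V (@Tk_id _ k (u x)) ?ger0_norm // subrr Tk0.
  have eV : En V <= k * ((lam + 1) * (mk k + G)).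
    apply: le_trans e1 _; apply: le_trans e2 _.
    apply: le_trans (test V k mV _) _; first by move=> x; rewrite V0 Vk.
    have iS : igr mu (fun x => k * (lam * (ch k x * U x) + g x)).
      by apply: igrZ; apply: igrD => //; exact: igrZ.
    apply: (@le_trans _ _ (Rintegral mu setT (fun x => k * (lam * (ch k x * U x) + g x)))).
      apply: Rint_le => //.
        by apply: (igr_mulb iF mV (c := k)) => x; rewrite ger0_norm.
      move=> x; rewrite /F mulrDl mulrDr; apply: lerD; last first.
        by rewrite mulrC; apply: ler_wpM2r.
      rewrite -mulrA [k * _]mulrCA; apply: ler_wpM2l; first exact: ltW.
      by rewrite mulrC mulrA; apply: ler_wpM2r.
    rewrite Rint_Z; last by apply: igrD => //; exact: igrZ.
    rewrite Rint_D //; last exact: igrZ.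
    rewrite Rint_Z // -/(mk k) -/G; apply: ler_wpM2l => //.
    have mk0 : 0 <= mk k by apply: Rint_ge0 => x; rewrite mulr_ge0 //; case/andP: (ch01 k x).
    have G0 : 0 <= G by exact: Rint_ge0.
    rewrite mulrDl mul1r mulrDr -addrA; apply: lerD => //.
    by rewrite addrA lerDr addr_ge0 // mulr_ge0 // ltW.
  pose E' := [set x | 2 * k <= u x]; pose E := [set x | 3 / 2 * k <= u x].
  have mE' : measurable E' by exact: measurable_ge.
  have mE : measurable E by exact: measurable_ge.
  have EE : E' `<=` E by move=> x xE; exact: (l1 k (u x) k0 xE).
  have EO : E `<=` O.
    by move=> x xE; apply: contrapT => /ou h2; have := l2 k (u x) k0 xE; rewrite h2 leNgt k0.
  pose c1 := 2 `^ p * k `^ (- p).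
  have c10 : 0 <= c1 by rewrite mulr_ge0 ?powR_ge0.
  have hKd z : \1_E' z.1 * \1_(~` E) z.2 * K z <= c1 * en V z.
    have e0 : 0 <= c1 * en V z by rewrite mulr_ge0 // (edens_ge0 A).
    have [z1|z1] := pselect (E' z.1); last first.
      by rewrite indicE memNset // !mul0r.
    have [z2|z2] := pselect (E z.2).
      by rewrite [X in _ * X * _]indicE memNset ?mulr0 ?mul0r //= ; apply.
    rewrite !indicE !mem_set // !mul1r /edens mulrCA -[leLHS]mulr1.
    apply: ler_wpM2l; first exact: K0.
    have d1 : V z.1 = k.
      have z1' : 2 * k <= u z.1 by [].
      by rewrite /V (@Tk_geE _ k (u z.1)) ?Tk_geE //; first [exact: (l3 _ _ k0 z1')|exact: (l2 _ _ k0 (l1 _ _ k0 z1'))].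
    have d2 : V z.2 <= k / 2.
      have z2' : u z.2 < 3 / 2 * k by rewrite ltNge; apply/negP.
      apply: le_trans (Tk_leid k00 (exc _)) _.
      have [h|h] := leP (u z.2) k.
        by rewrite Tk_id ?ger0_norm // subrr divr_ge0.
      by rewrite Tk_geE //; first [exact: l4|exact: ltW].
    have hk : k / 2 <= `|V z.1 - V z.2| by rewrite d1 ger0_norm ?subr_ge0 //; first [exact: l5|exact: l6].
    have k2 : 0 <= k / 2 by rewrite divr_ge0.
    apply: le_trans (ler_wpM2l c10 (powR_le (ltW p0) k2 hk)).
    rewrite /c1 powRN -mulrA mulrCA -powRM // mulrC.
    by rewrite (_ : 2 * (k / 2) = k) ?divff //; [rewrite powR_eq0 gt_eqF|field].
  have mKd : mfun (fun z => \1_E' z.1 * \1_(~` E) z.2 * K z).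
    apply: mf_M => //; apply: mf_M.
      by apply: mf_fst; exact: mf_indic.
    by apply: mf_snd; apply: mf_indic; exact: measurableC.
  have iKd : igr m2 (fun z => \1_E' z.1 * \1_(~` E) z.2 * K z).
    apply: (igr_le mKd _ (igrZ c1 fV)) => z.
    by rewrite ger0_norm ?mulr_ge0 ?K0.
  have hg1 := gain _ _ mE' mE EE EO iKd.
  have hKi := Rint_le iKd (igrZ c1 fV) hKd.
  rewrite (Rint_Z _ fV) -/(En V) in hKi.
  have finE S : measurable S -> S `<=` O -> (mu S < +oo)%E.
    by move=> mS SO; apply: le_lt_trans (adm_fO A); apply: le_measure; rewrite ?inE.
  have [iE iEE] := igr_indic mE (finE _ mE EO).
  have [iE' iEE'] := igr_indic mE' (finE _ mE' (subset_trans EE EO)).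
  have hE : fine (mu E) <= k `^ (1 - p) * M.
    rewrite -iEE /M -Rint_Z //; apply: Rint_le => //; first exact: igrZ.
    move=> x; have [xE|xE] := pselect (E x); last first.
      by rewrite indicE memNset // mulr_ge0 ?powR_ge0.
    have hx : 3 / 2 * k <= u x by [].
    rewrite indicE mem_set // (_ : 1 - p = - (p - 1)); last by ring.
    rewrite powRN mulrC ler_pdivlMr ?powR_gt0 // mul1r.
    by apply: powR_le; [exact: ltW|exact: ltW|exact: (l2 _ _ k0 hx)].
  have mk0 : 0 <= mk k by apply: Rint_ge0 => x; rewrite mulr_ge0 //; case/andP: (ch01 k x).
  have G0 : 0 <= G by exact: Rint_ge0.
  have hE' : fine (mu E') <= CG * (k `^ (1 - p) * M) `^ sg *
     (c1 * (k * ((lam + 1) * (mk k + G)))).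
    apply: le_trans hg1 _; apply: ler_pM.
    - by rewrite mulr_ge0 ?powR_ge0 // ltW.
    - by apply: Rint_ge0 => z; rewrite !mulr_ge0 ?K0.
    - apply: ler_wpM2l; first exact: ltW.
      by apply: powR_le; [exact: ltW|exact: fine_ge0|].
    - by apply: le_trans hKi _; apply: ler_wpM2l.
  have h4 : mk (2 * k) <= mk (4 * k) + (4 * k) `^ (p - 1) * fine (mu E').
    rewrite -iEE' /mk -Rint_Z // -Rint_D //; last exact: igrZ.
    apply: Rint_le => //; first by apply: igrD => //; exact: igrZ.
    move=> x; have [h|h] := leP (u x) (2 * k).
      by rewrite chF // mul0r addr_ge0 ?mulr_ge0 ?powR_ge0 //; case/andP: (ch01 (4 * k) x).
    have xE : E' x by apply: ltW.
    rewrite (chT (2 * k)) // mul1r indicE mem_set // mulr1.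
    have [h'|h'] := leP (u x) (4 * k); last by rewrite chT // mul1r lerDl powR_ge0.
    by rewrite chF // mul0r add0r; apply: powR_le => //; exact: ltW.
  apply: le_trans h4 _; rewrite lerD2l.
  apply: le_trans (ler_wpM2l (powR_ge0 _ _) hE') _.
  rewrite [leRHS]mulrAC -/B2.
  set X := (k `^ (1 - p) * M) `^ sg; set Q := mk k + G.
  have X0 : 0 <= X by exact: powR_ge0.
  have Q0 : 0 <= Q by rewrite addr_ge0.
  have e3 : (4 * k) `^ (p - 1) * (CG * X * (c1 * (k * ((lam + 1) * Q)))) = B2 * Q * X.
    have ek : k `^ (p - 1) * (k `^ (- p) * k) = 1.
      rewrite powRN [_^-1 * k]mulrC mulrA powRB1_mul // divff //.
      by rewrite powR_eq0 gt_eqF.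
    rewrite powRM // /c1 /B2.
    rewrite (_ : _ * _ * _ = (k `^ (p - 1) * (k `^ (- p) * k)) *
       (4 `^ (p - 1) * (CG * 2 `^ p * (lam + 1)) * Q * X)); last by ring.
    by rewrite ek mul1r.
  by rewrite e3; apply: (ler_wpM2r X0); apply: (ler_wpM2r Q0); rewrite lerDr.
(* Test with T_k u: below level k the datum produces lam times the integral of (T_k u)^p, absorbed
   because lam < lam1; above k it costs lam k times the mass there. *)
- move=> k k0; have k00 := ltW k0.
  have := vsol_test_excess hu k00 (lexx 0).
  rewrite (_ : (fun x => Tk k (u x - Tk 0 (u x))) = (fun x => Tk k (u x))); last first.
    by apply/funext => x; rewrite Tk_0l subr0.
  set V := (fun x => Tk k (u x)) => -[WV fV iV [e1 e2]].
  have mV := adm_meas A WV.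
  have V0 x : 0 <= V x by apply: Tk_ge0.
  have Vk x : V x <= k by have := Tk_norm (u x) k00; rewrite -/(V x) ger0_norm.
  have [_] := adm_poincare A WV fV.
  rewrite (_ : (fun x => \1_O x * `|V x| `^ p) = (fun x => V x `^ p)); last first.
    apply/funext => x; rewrite ger0_norm //; have [Ox|nO] := pselect (O x).
      by rewrite indicE mem_set // mul1r.
    by rewrite (adm_out A WV nO) powR0 ?mulr0 // gt_eqF.
  rewrite -/(tp k) => h1.
  have mk0 : 0 <= mk k by apply: Rint_ge0 => x; rewrite mulr_ge0 //; case/andP: (ch01 k x).
  have G0 : 0 <= G by exact: Rint_ge0.
  have itk := itp _ k0.
  have iS : igr mu (fun x => lam * (V x `^ p) + k * (lam * (ch k x * U x) + g x)).
    by apply: igrD; apply: igrZ => //; apply: igrD => //; exact: igrZ.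
  have h2 : Rintegral mu setT (fun x => F x * V x) <= lam * tp k + k * (lam * mk k + G).
    rewrite /tp /mk /G -Rint_Z // -[lam * Rintegral _ _ _]Rint_Z //.
    rewrite -Rint_D //; last exact: igrZ.
    rewrite -Rint_Z; last by apply: igrD => //; exact: igrZ.
    rewrite -Rint_D //; [|exact: igrZ|by apply: igrZ; apply: igrD => //; exact: igrZ].
    apply: Rint_le => //.
      by apply: (igr_mulb iF mV (c := k)) => x; rewrite ger0_norm.
    move=> x; have gV : g x * V x <= k * g x by rewrite mulrC; apply: ler_wpM2r.
    have hUV : U x * V x <= V x `^ p + k * (ch k x * U x).
      have [h|h] := leP (u x) k.
        rewrite chF // mul0r mulr0 addr0 /V Tk_id ?ger0_norm // powRB1_mul //.
      rewrite chT // mul1r mulrC.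
      apply: (@le_trans _ _ (k * U x)); first by apply: ler_wpM2r.
      by rewrite lerDr powR_ge0.
    rewrite /F mulrDl mulrDr addrA; apply: lerD => //.
    rewrite -mulrA [k * (lam * _)]mulrCA -mulrDr.
    by apply: ler_wpM2l => //; exact: ltW.
  have h3 := le_trans h1 (le_trans e1 (le_trans e2 (le_trans (test V k mV _) h2))).
  have {}h3 := h3 (fun x => introT andP (conj (V0 x) (Vk x))).
  have h4 : (lam1 - lam) * tp k <= k * ((lam + 1) * (mk k + G)).
    apply: (@le_trans _ _ (k * (lam * mk k + G))).
      by rewrite mulrBl; first [rewrite lerBlDr; exact: h3|rewrite lerBlDl; exact: h3].
    apply: ler_wpM2l => //; rewrite mulrDl mul1r mulrDr -addrA; apply: lerD => //.
    by rewrite addrA lerDr addr_ge0 // mulr_ge0 // ltW.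
  apply: (@le_trans _ _ (B1 * k * (mk k + G))).
    rewrite /B1 (_ : _ * k * _ = (k * ((lam + 1) * (mk k + G))) / (lam1 - lam)); last by ring.
    by rewrite ler_pdivlMr // mulrC.
  apply: ler_wpM2r; first by rewrite addr_ge0.
  by apply: ler_wpM2r => //; rewrite lerDl.
(* Splitting: where u <= k and u^(p-1) > s, one has u > s^(1/(p-1)), so u^(p-1) = u^p / u is at most
   s^(-1/(p-1)) (T_k u)^p. The rest of O lies above k or contributes at most s times its measure. *)
- move=> k s k0 s0; have k00 := ltW k0; have itk := itp _ k0.
  rewrite /M /mk -iOE -Rint_Z // /tp -[_ * Rintegral mu setT (fun x => Tk k _ `^ p)]Rint_Z //.
  rewrite -!Rint_D //; try by [exact: igrZ | apply: igrD => //; exact: igrZ].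
  apply: Rint_le => //.
    by apply: igrD; [apply: igrD => //; exact: igrZ|exact: igrZ].
  move=> x; have [Ox|nO] := pselect (O x); last first.
    rewrite oU // mulr0 add0r addr_ge0 ?mulr_ge0 ?powR_ge0 //; exact: ltW.
  rewrite indicE mem_set // mulr1.
  have a0 : 0 <= s `^ (- (p - 1)^-1) * Tk k (u x) `^ p by rewrite mulr_ge0 ?powR_ge0.
  have [h|h] := leP (u x) k; last first.
    by rewrite chT // mul1r -addrA lerDl addr_ge0 // ltW.
  rewrite chF // mul0r add0r.
  have [h'|h'] := leP (U x) s; first by apply: le_trans h' _; rewrite lerDl.
  apply: (@le_trans _ _ (s `^ (- (p - 1)^-1) * Tk k (u x) `^ p)); last first.
    by rewrite lerDr ltW.
  rewrite Tk_id ?ger0_norm // -(powRB1_mul p1 (u0 x)) -/(U x) mulrCA -[leLHS]mulr1.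
  apply: ler_wpM2l => //.
  rewrite powRN mulrC ler_pdivlMr ?powR_gt0 // mul1r.
  have := powR_le (ltW (_ : 0 < (p - 1)^-1)) (ltW s0) (ltW h').
  rewrite invr_gt0 => /(_ q0) h2; apply: le_trans h2 _.
  by rewrite /U -powRrM mulfV ?gt_eqF // powRr1.
Qed.

End apriori_estimate.

(** * Nonnegative solutions, entropy inequalities and their comparison *)

Section iteration.
Context {d : measure_display} {T : measurableType d} {R : realType}.
Variables (mu : {sigma_finite_measure set T -> \bar R}) (p : R) (K : T * T -> R).
Variables (O : set T) (W : (T -> R) -> Prop) (lam1 sg : R).
Hypothesis A : admissible mu p K O W lam1 sg.

Local Notation m2 := (mu \x mu)%E.
Local Notation mfun := (measurable_fun setT).
Local Notation en := (edens p K).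
Local Notation fe := (fin_energy mu p K).
Local Notation En := (energy mu p K).
Local Notation pr := (aform p K).
Implicit Types u v w f : T -> R.

Local Notation KK := (bounded_class mu p K W).
Local Notation vsol := (vsol mu p K W).

Lemma ae_pair (P : T -> Prop) : {ae mu, forall x, P x} ->
  {ae m2, forall z, P z.1 /\ P z.2}.
Proof.
move=> h; have h1 := ae_prod1 mu h; have h2 := ae_prod2 mu h.
by apply: filterS2 h1 h2 => z /= ? ?.
Qed.

Lemma igr_le_ae {d' : measure_display} {T' : measurableType d'}
  (m : {measure set T' -> \bar R}) (f g : T' -> R) : measurable_fun setT f ->
  {ae m, forall x, `|f x| <= g x} -> igr m g -> igr m f.
Proof.
move=> mf fg ig; have mg := igr_meas ig.
pose f' x := Num.max (- `|g x|) (Num.min `|g x| (f x)).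
have mf' : measurable_fun setT f' by rewrite /f'; measf.
have if' : igr m f'.
  apply: (igr_le mf' _ (integrable_norm ig)) => x /=; rewrite ler_norml.
  have := normr_ge0 (g x); rewrite /f'; move: `|g x| (f x) => a b a0.
  by apply/andP; split; mm; lra.
apply: (igr_ae _ mf if').1; apply: filterS fg => x.
rewrite ler_norml /f' => /andP[h1 h2]; have := ler_norm (g x).
by move: (g x) `|g x| (f x) h1 h2 => a b c; mm; lra.
Qed.

Lemma vsol_ae n f v v' : vsol n f v -> KK n v' -> igr mu f ->
  {ae mu, forall x, v x = v' x} -> vsol n f v'.
Proof.
move=> [[Wv bv fv] hv] [Wv' bv' fv'] hf e; split => // k phi k0 Kphi.
have [Wphi bphi fphi] := Kphi.
have mv := adm_meas A Wv; have mv' := adm_meas A Wv'; have mphi := adm_meas A Wphi.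
have mf := igr_meas hf.
have h := hv k phi k0 Kphi.
have fT : fe (fun x => Tk k (v x - phi x)).
  by apply: (fe_Tk A) => //; [measf|exact: (fe_B A)].
have mT : mfun (fun x => Tk k (v x - phi x)) by measf.
have mT' : mfun (fun x => Tk k (v' x - phi x)) by measf.
have [_ <-] : igr m2 (pr v' (fun x => Tk k (v' x - phi x))) /\
  Rintegral m2 setT (pr v (fun x => Tk k (v x - phi x))) =
  Rintegral m2 setT (pr v' (fun x => Tk k (v' x - phi x))).
  apply: igr_ae; [|exact: (mf_aform A)|exact: (igr_aform A)].
  by apply: filterS (ae_pair e) => z [e1 e2]; rewrite /aform e1 e2.
have [_ <-] : igr mu (fun x => f x * Tk k (v' x - phi x)) /\
  Rintegral mu setT (fun x => f x * Tk k (v x - phi x)) =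
  Rintegral mu setT (fun x => f x * Tk k (v' x - phi x)).
  apply: igr_ae; [|by measf|].
    by apply: filterS e => x ->.
  by apply: (igr_mulb hf mT (c := k)) => x; exact: Tk_norm.
exact: h.
Qed.

(** For f >= 0 the test with phi = max(v, 0) shows that the negative part of a solution v has energy
    at most 0, so it vanishes almost everywhere; max(v, 0) is then a solution that is nonnegative at
    every point. *)
Lemma vsol_nonneg_exists n f : 0 <= n -> igr mu f -> (forall x, 0 <= f x) ->
  exists2 u, vsol n f u & forall x, 0 <= u x.
Proof.
move=> n0 hf f0; have [v hv] := vsol_exists A n0 hf.
have [[Wv bv fv] tv] := hv; have mv := adm_meas A Wv.
pose v' x := Num.max (v x) 0.
have Wv' : W v' := W_pos A Wv.
have mv' := adm_meas A Wv'.
have fv' : fe v' by apply: (fe_le A mv' _ fv).1 => z; exact: pos_part_lip.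
have bv' x : `|v' x| <= n.
  by rewrite /v'; have := bv x; rewrite !ler_norml => /andP[? ?]; apply/andP; split; mm; lra.
have Kv' : KK n v' by [].
exists v'; last by move=> x; rewrite /v' le_max lexx orbT.
apply: (vsol_ae hv Kv' hf).
pose eta x := v x - v' x.
have We : W eta := W_B A Wv Wv'.
have me := adm_meas A We.
have feta : fe eta := fe_B A mv mv' fv fv'.
have etaE x : Tk n (v x - v' x) = eta x.
  apply: Tk_id; have := bv x; rewrite /v' !ler_norml => /andP[? ?].
  by apply/andP; split; mm; lra.
have h := tv n v' n0 Kv'.
rewrite (_ : (fun x => Tk n (v x - v' x)) = eta) in h; last exact/funext.
rewrite (_ : (fun x => f x * Tk n (v x - v' x)) = (fun x => f x * eta x)) in h; last first.
  by apply/funext => x; rewrite etaE.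
have eta0 x : eta x <= 0 by rewrite /eta /v'; mm; lra.
have h2 : Rintegral mu setT (fun x => f x * eta x) <= 0.
  have <- : Rintegral mu setT (fun=> 0 : R) = 0 by rewrite /Rintegral integral0.
  apply: Rint_le; [|exact: igr0|by move=> x; rewrite mulr_ge0_le0].
  apply: (igr_mulb hf me (c := n)) => x; rewrite -etaE; exact: Tk_norm.
have ip : igr m2 (pr v eta) by apply: (igr_aform A).
have E0 : En eta <= 0.
  apply: le_trans (le_trans h h2); apply: Rint_le => // z.
  apply: (aform_lip_mono A (tau := fun a => a - Num.max a 0)) => a b ab.
  exact: neg_part_mono_lip.
apply: filterS (energy0_ae A We feta E0) => x; rewrite /eta; lra.
Qed.

(** Since h bounds u, the truncation T_h u is u itself and the excess term of the general comparison
    is 0. *)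
Lemma comparison_vsol n h w f1 u f2 : 0 <= n -> n <= h -> vsol n f1 w -> vsol h f2 u ->
  igr mu f1 -> igr mu f2 -> {ae mu, forall x, f1 x <= f2 x} -> (forall x, 0 <= u x) ->
  {ae mu, forall x, w x <= u x}.
Proof.
move=> n0 nh hw [[Wu bu fu] tu] i1 i2 f12 u0.
have [[Ww bw fw] _] := hw; have mu_ := adm_meas A Wu; have mw := adm_meas A Ww.
have h0 : 0 <= h := le_trans n0 nh.
have TE : (fun x => Tk h (u x)) = u by apply/funext => x; exact: Tk_id.
apply: (comparison A n0 hw i1 i2 f12 mu_ u0) => e e0; exists h => //.
have Kphi : KK h (fun x => Num.max (u x) (w x)).
  split; first exact: (W_max A).
    move=> x; have := bu x; have := bw x; rewrite !ler_norml => /andP[? ?] /andP[? ?].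
    by apply/andP; split; mm; lra.
  have -> : (fun x => Num.max (u x) (w x)) = (fun x => u x + Num.max (w x - u x) 0).
    by apply/funext => x; mm; lra.
  apply: (fe_D A) => //; first by measf.
  have fd := fe_B A mw mu_ fw fu.
  by apply: (fe_le A _ _ fd).1 => [|z]; [measf|exact: pos_part_lip].
have := tu n _ n0 Kphi.
have EE : (fun x => Tk n (u x - Num.max (Tk h (u x)) (w x))) =
    (fun x => Tk n (u x - Num.max (u x) (w x))).
  by apply/funext => x; rewrite (@Tk_id _ h).
split; rewrite ?TE //.
  have -> : (fun x => f2 x * Tk n (u x - Num.max (Tk h (u x)) (w x))) =
    (fun x => f2 x * Tk n (u x - Num.max (u x) (w x))).
    by apply/funext => x; rewrite (@Tk_id _ h).
  rewrite EE sintE ?lee_fin //.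
  have [Wp _ fp] := Kphi; have mp := adm_meas A Wp.
  apply: (igr_aform A) => //; first by measf.
  by apply: (fe_Tk A) => //; [measf|exact: (fe_B A)].
rewrite (_ : (fun x => _) = fun=> 0) /Rintegral ?integral0 ?ltW //.
by apply/funext => x; rewrite (@Tk_id _ h) // subrr Tk0 // mulr0.
Qed.

(** The left-hand side is a signed integral because its integrand is not assumed integrable. The
    bound on phi is demanded at every point, not up to a null set. *)
Definition entropy_ineq f u := forall (k M : R) phi, 0 < k -> W phi ->
  (forall x, `|phi x| <= M) ->
  (sint m2 (pr u (fun x => Tk k (u x - phi x))) <=
   (Rintegral mu setT (fun x => f x * Tk k (u x - phi x)))%:E)%E.

(** Membership of T_k u in [W] is not assumed to give finite energy. The test with phi = 0 does: its
    integrand is nonnegative and dominates the energy density of T_k u. *)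
Lemma entropy_fe f u k : 0 < k -> mfun u -> entropy_ineq f u ->
  fe (fun x => Tk k (u x)).
Proof.
move=> k0 mu_ hu; have b0 (x : T) : `|0 : R| <= 0 by rewrite normr0.
have h := hu k 0 (fun=> 0) k0 (adm_W0 A) b0.
rewrite (_ : (fun x => Tk k (u x - 0)) = (fun x => Tk k (u x))) in h; last first.
  by apply/funext => x; rewrite subr0.
have mT : mfun (fun x => Tk k (u x)) by measf.
have hp z : en (fun x => Tk k (u x)) z <= pr u (fun x => Tk k (u x)) z.
  by apply: (aform_lip_mono A); apply: Tk_mono_lip; exact: ltW.
have [|ip _] := sint_igr (mf_aform A mu_ mT) (igr0 m2) _ (fun=> lexx 0) h.
  by move=> z; rewrite oppr0; apply: le_trans (hp z); exact: (edens_ge0 A).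
by apply: (igr_le (mf_edens A mT) _ ip) => z; rewrite ger0_norm ?(edens_ge0 A).
Qed.

(** The test function max(T_h u, w) is bounded although u is not. The remaining term, the integral
    of f2 T_n (u - T_h u), tends to 0 along integers h by dominated convergence. *)
Lemma comparison_entropy n w f1 u f2 : 0 <= n -> vsol n f1 w -> igr mu f1 -> igr mu f2 ->
  {ae mu, forall x, f1 x <= f2 x} -> mfun u -> (forall x, 0 <= u x) ->
  (forall k, 0 < k -> W (fun x => Tk k (u x))) -> entropy_ineq f2 u ->
  {ae mu, forall x, w x <= u x}.
Proof.
move=> n0 hw i1 i2 f12 mu_ u0 WT hu.
have [[Ww bw fw] _] := hw; have mw := adm_meas A Ww; have mf2 := igr_meas i2.
apply: (comparison A n0 hw i1 i2 f12 mu_ u0) => e e0.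
have [|||||_ c] := @dominated_real _ _ _ mu
   (fun m x => f2 x * Tk n (u x - Tk m%:R (u x))) (fun=> 0) (fun x => n * `|f2 x|).
- by move=> m; measf.
- exact: mf_cst.
- apply: nearW => x; apply: cvg_near_cst.
  have ux : 0 <= `|u x| by [].
  exists (Num.bound `|u x|) => // m /= hm.
  rewrite (@Tk_id _ m%:R) ?subrr ?Tk0 ?mulr0 //.
  by apply: le_trans (ltW (archi_boundP ux)) _; rewrite ler_nat.
- by apply: igrZ; exact: integrable_norm.
- move=> m; apply: nearW => x; rewrite normrM mulrC; apply: ler_wpM2r => //.
  exact: Tk_norm.
have z0 : Rintegral mu setT (fun=> 0 : R) = 0 by rewrite /Rintegral integral0.
rewrite z0 in c.
have [N _ hN] := @cvgr_le _ _ _ _ _ _ c _ e0.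
pose h : R := (maxn N (Num.bound n).+1)%:R.
have nh : n <= h.
  apply: le_trans (ltW (archi_boundP n0)) _; rewrite ler_nat.
  by rewrite leq_max leqnSn orbT.
have hp : 0 < h by rewrite ltr0n leq_max orbT.
exists h => //; split.
- exact: WT.
- exact: (entropy_fe hp mu_ hu).
(* Level 0 is treated apart: the entropy inequality is stated for positive k, and truncation at
   level 0 gives 0. *)
- have [n00|np] := eqVneq n 0.
    rewrite n00 (_ : (fun x => Tk 0 _) = fun=> 0); last first.
      by apply/funext => x; rewrite Tk_0l.
    rewrite (_ : (fun x => f2 x * _) = fun=> 0); last first.
      by apply/funext => x; rewrite Tk_0l mulr0.
    rewrite (_ : pr u _ = fun=> 0); last first.
      by apply/funext => z; rewrite /aform subrr !mulr0.
    by rewrite sintE ?z0; [rewrite /Rintegral integral0|exact: igr0].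
  apply: (hu n h) => //.
  + by rewrite lt_def np.
  + by apply: (W_max A) => //; exact: WT.
  + move=> x; have := Tk_norm (u x) (ltW hp); have := bw x.
    have := Tk_ge0 (ltW hp) (u0 x).
    rewrite !ler_norml; move: (Tk h (u x)) => t t0 /andP[? ?] /andP[? ?].
    by apply/andP; split; mm; lra.
- by apply: hN => /=; rewrite leq_maxl.
Qed.

End iteration.

(** * Monotone limits in the space and the iteration scheme *)

Section limit_passage.
Context {d : measure_display} {T : measurableType d} {R : realType}.
Variables (mu : {sigma_finite_measure set T -> \bar R}) (p : R) (K : T * T -> R).
Variables (O : set T) (W : (T -> R) -> Prop) (lam1 sg : R).
Hypothesis A : admissible mu p K O W lam1 sg.

Local Notation mfun := (measurable_fun setT).
Local Notation fe := (fin_energy mu p K).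
Local Notation En := (energy mu p K).
Implicit Types u v w f : T -> R.

Let p1 : 1 < p := adm_p A.

Local Notation KK := (bounded_class mu p K W).
Local Notation vsol := (vsol mu p K W).

(* Near-minimizers of the energy in the order intervals [v_m, v] are Cauchy by uniform
   convexity, and they are squeezed to [v]. *)
Lemma W_monotone_limit (v_ : nat -> T -> R) v (k B : R) :
  (forall n, W (v_ n)) -> (forall n, fe (v_ n)) -> (forall n, En (v_ n) <= B) ->
  (forall n x, `|v_ n x| <= k) -> {ae mu, forall x n, v_ n x <= v_ n.+1 x} ->
  {ae mu, forall x, v_ n x @[n --> \oo] --> v x} -> mfun v ->
  (forall x, ~ O x -> v x = 0) -> W v /\ fe v.
Proof.
move=> Wv fv hB bv mono cv mv ov.
pose C m w := [/\ W w, fe w, forall x, `|w x| <= k &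
  {ae mu, forall x, v_ m x <= w x <= v x}].
have ae_le : {ae mu, forall x, {homo v_ ^~ x : m n / (m <= n)%N >-> m <= n} /\
    forall n, v_ n x <= v x}.
  apply: filterS2 mono cv => x h c.
  have nd : nondecreasing_seq (v_ ^~ x) by apply/nondecreasing_seqP.
  split; first exact: nd.
  move=> n; rewrite -(cvg_lim (@Rhausdorff R) c); apply: nondecreasing_cvgn_le => //.
  by apply/cvg_ex; exists (v x).
have Cv m : C m (v_ m).
  by split => //; apply: filterS ae_le => x [_ h]; rewrite lexx h.
have Csub m n w : (m <= n)%N -> C n w -> C m w.
  move=> mn [h1 h2 h3 h4]; split => //.
  by apply: filterS2 ae_le h4 => x [h _] /andP[h5 ->]; rewrite (le_trans (h _ _ mn)).
have Cmid m w w' : C m w -> C m w' -> C m (fun x => 2^-1 * (w x + w' x)).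
  move=> [W1 f1 b1 c1] [W2 f2 b2 c2]; split.
  - by apply: (adm_Z A); apply: (adm_D A).
  - by apply: fe_Z; apply: (fe_D A) => //; exact: (adm_meas A).
  - move=> x; rewrite normrM ger0_norm //.
    have := ler_normD (w x) (w' x); have := b1 x; have := b2 x.
    by move: `|_ + _| `|w x| `|w' x| => *; lra.
  - apply: filterS2 c1 c2 => x /andP[? ?] /andP[? ?].
    by apply/andP; split; lra.
pose E m := [set En w | w in C m].
have lbE m : has_lbound (E m) by exists 0 => _ [w _ <-]; exact: (energy_ge0 A).
have hiE m : has_inf (E m) by split => //; exists (En (v_ m)); exists (v_ m).
(* The classes [C m] shrink, so these infima increase, and B bounds them. Near-minimizers with
   indices beyond [N1] have their midpoint in [C N1], of energy at least [dm N1], which is already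
   close to the supremum; hence the convexity gap is small. *)
pose dm m := inf (E m).
have dmin m w : C m w -> dm m <= En w by move=> Cw; apply: ge_inf => //; exists w.
have dmB m : dm m <= B := le_trans (dmin _ _ (Cv m)) (hB m).
have dnd m n : (m <= n)%N -> dm m <= dm n.
  move=> mn; apply: lb_le_inf; first by exists (En (v_ n)); exists (v_ n).
  by move=> _ [w Cw <-]; apply: dmin; exact: Csub Cw.
have hsD : has_sup (range dm).
  by split; [exists (dm 0%N); exists 0%N|exists B => _ [m _ <-]].
pose ds := sup (range dm).
have dds m : dm m <= ds by apply: ub_le_sup; [case: hsD|exists m].
have /choice[w hw] m : exists w, C m w /\ En w <= dm m + m.+1%:R^-1.
  have m0 : 0 < m.+1%:R^-1 :> R by rewrite invr_gt0.
  by have [_ [w Cw <-] /ltW h] := inf_adherent m0 (hiE m); exists w.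
have Ww m : W (w m) by case: (hw m) => -[].
have fw m : fe (w m) by case: (hw m) => -[].
have bw m x : `|w m x| <= k by case: (hw m) => -[].
have mw m := adm_meas A (Ww m).
have EB m : En (w m) <= B + 1.
  apply: le_trans (hw m).2 _; apply: lerD => //.
  by rewrite invf_le1 ?ltr0n // ler1n.
have cau := energy_cauchy A mw fw EB.
apply: (W_cauchy_closed A Ww bw fw _ mv ov).
  apply: cau => e e0; have e20 : 0 < e / 2 by rewrite divr_gt0.
  have [_ [N1 _ <-] hN1] := sup_adherent e20 hsD.
  have /cvgr0Pnorm_lt/(_ _ e20) [N2 _ hN2] := @cvg_harmonic R.
  exists (maxn N1 N2) => i j; rewrite !geq_max => /andP[i1 i2] /andP[j1 j2].
  have hi : i.+1%:R^-1 <= e / 2 by have /ltW := hN2 _ i2; rewrite /= ger0_norm.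
  have hj : j.+1%:R^-1 <= e / 2 by have /ltW := hN2 _ j2; rewrite /= ger0_norm.
  have := dmin _ _ (Cmid _ _ _ (Csub _ _ _ i1 (hw i).1) (Csub _ _ _ j1 (hw j).1)).
  have := (hw i).2; have := (hw j).2; have := dds i; have := dds j.
  move: hN1 hi hj; rewrite -/ds; move: (ds) i.+1%:R^-1 j.+1%:R^-1 (dm i) (dm j) (dm N1).
  move: (En _) (En _) (En _) => *; lra.
have aw : {ae mu, forall x, forall m, v_ m x <= w m x <= v x}.
  by apply: ae_foralln => m; case: (hw m) => -[].
apply: filterS2 aw cv => x h c.
by apply: (squeeze_cvgr _ c (cvg_cst _)); apply: nearW => m; exact: h.
Qed.

Section monotone_scheme.
Variables (lam : R) (g : T -> R).
Hypotheses (lamP : 0 < lam < lam1) (ig : igr mu g) (g0 : forall x, 0 <= g x).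

Definition datum (u : T -> R) x := lam * u x `^ (p - 1) + g x.

Lemma igr_powR_bounded n u : KK n u -> (forall x, 0 <= u x) ->
  igr mu (fun x => u x `^ (p - 1)).
Proof.
move=> [Wu bu fu] u0; have mu_ := adm_meas A Wu.
have q0 : 0 < p - 1 by have := p1; lra.
apply: (igr_bounded_out A (c := n `^ (p - 1))); first by measf.
  move=> x; rewrite ger0_norm ?powR_ge0 //.
  by apply: powR_le; [exact: ltW| |have := bu x; rewrite ger0_norm].
by move=> x /(adm_out A Wu) ->; rewrite powR0 // gt_eqF.
Qed.

Lemma datum_ge0 u x : 0 <= datum u x.
Proof.
by case/andP: lamP => l0 _; rewrite addr_ge0 // mulr_ge0 ?powR_ge0 // ltW.
Qed.

Lemma igr_datum u : igr mu (fun x => u x `^ (p - 1)) -> igr mu (datum u).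
Proof. by move=> h; apply: igrD => //; exact: igrZ. Qed.

Lemma datum_le u v x : 0 <= u x -> u x <= v x -> datum u x <= datum v x.
Proof.
move=> u0 uv; rewrite lerD2r; apply: ler_wpM2l; first by case/andP: lamP => /ltW.
by apply: powR_le => //; have := p1; lra.
Qed.

(** Raising the level together with the index removes the constraint in the limit. Solvability
    requires the previous iterate to be bounded and nonnegative, so a total successor on pairs
    (level, function) is chosen first and the invariant is recovered by induction. *)
Lemma scheme_exists : exists us : nat -> T -> R,
  [/\ forall n x, 0 <= us n x, KK 0 (us 0%N) &
      forall n, vsol n.+1%:R (datum (us n)) (us n.+1)].
Proof.
pose P (n : nat) (u v : T -> R) := KK n%:R u -> (forall x, 0 <= u x) ->
  vsol n.+1%:R (datum u) v /\ forall x, 0 <= v x.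
have /choice[F hF] (nu : nat * (T -> R)) : exists v, P nu.1 nu.2 v.
  have [[Ku u0]|h] := pselect (KK nu.1%:R nu.2 /\ forall x, 0 <= nu.2 x); last first.
    by exists nu.2 => Ku u0; exfalso; apply: h.
  have [v hv v0] := @vsol_nonneg_exists _ _ _ _ _ _ _ _ _ _ A nu.1.+1%:R (datum nu.2)
    (ler0n _ _) (igr_datum (igr_powR_bounded Ku u0)) (datum_ge0 _).
  by exists v.
pose us := fix us n := if n is n'.+1 then F (n', us n') else (fun=> 0) : T -> R.
have K0' : KK 0 (us 0%N).
  by split; [exact: (adm_W0 A)|move=> x; rewrite normr0|exact: (fe_0 A)].
have h n : [/\ KK n%:R (us n), forall x, 0 <= us n x & P n (us n) (us n.+1)].
  elim: n => [|n [Kn n0 Pn]]; first by split => //; exact: (hF (0%N, us 0%N)).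
  by have [[K1 _] h2] := Pn Kn n0; split => //; exact: (hF (n.+1, us n.+1)).
exists us; split => // [n x|n]; first by have [_ ->] := h n.
by have [K1 h0 P1] := h n; have [] := P1 K1 h0.
Qed.

End monotone_scheme.

End limit_passage.

Section scheme.
Context {d : measure_display} {T : measurableType d} {R : realType}.
Variables (mu : {sigma_finite_measure set T -> \bar R}) (p : R) (K : T * T -> R).
Variables (O : set T) (W : (T -> R) -> Prop) (lam1 sg : R).
Hypothesis A : admissible mu p K O W lam1 sg.

Local Notation mfun := (measurable_fun setT).
Implicit Types u v w f : T -> R.

Let p1 : 1 < p := adm_p A.

Local Notation KK := (bounded_class mu p K W).
Local Notation vsol := (vsol mu p K W).
Variables (lam : R) (g : T -> R).
Hypotheses (lamP : 0 < lam < lam1) (ig : igr mu g) (g0 : forall x, 0 <= g x).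
Local Notation datum := (datum p lam g).
Variable us : nat -> T -> R.
Hypotheses (us0 : forall n x, 0 <= us n x) (usK0 : KK 0 (us 0%N))
  (usS : forall n, vsol n.+1%:R (datum (us n)) (us n.+1)).

Let q0 : 0 < p - 1. Proof. by have := p1; lra. Qed.

Lemma scheme_KK n : KK n%:R (us n).
Proof. by case: n => [|n]; [exact: usK0|case: (usS n)]. Qed.

Lemma scheme_meas n : mfun (us n).
Proof. by have [Wu _ _] := scheme_KK n; exact: (adm_meas A). Qed.

Lemma scheme_igr n : igr mu (fun x => us n x `^ (p - 1)).
Proof. exact: (igr_powR_bounded A (scheme_KK n)). Qed.

Lemma scheme_mono : {ae mu, forall x n, us n x <= us n.+1 x}.
Proof.
apply: ae_foralln; elim=> [|n ih].
  apply: nearW => x; have [_ b0 _] := usK0.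
  by have := b0 x; rewrite normr_le0 => /eqP ->.
apply: (comparison_vsol A (h := n.+2%:R) _ _ (usS n) (usS n.+1)) => //.
- by rewrite ler_nat.
- by apply: igr_datum => //; exact: scheme_igr.
- by apply: igr_datum => //; exact: scheme_igr.
- by apply: filterS ih => x h; apply: (datum_le A).
Qed.

(** Monotonicity puts the datum built from u_n below the one built from u_(n+1), so the a priori
    bound applies to u_(n+1) with its own power on the right. *)
Lemma scheme_bound : exists B, forall n, Rintegral mu setT (fun x => us n x `^ (p - 1)) <= B.
Proof.
have [C C0 HC] := apriori_bound A lamP; exists (C * Rintegral mu setT g) => -[|n].
  rewrite (_ : (fun x => _) = fun=> 0).
    by rewrite /Rintegral integral0 mulr_ge0 // Rint_ge0.
  have [_ b0 _] := usK0; apply/funext => x.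
  by have := b0 x; rewrite normr_le0 => /eqP ->; rewrite powR0 // gt_eqF.
apply: (HC _ _ _ _ _ (usS n) (us0 n.+1) _ ig g0 _).2 => //.
  by apply: igr_datum => //; exact: scheme_igr.
by apply: filterS scheme_mono => x h; apply: (datum_le A).
Qed.

(** The lower limit of u_n^(p-1) is integrable by Fatou's lemma, hence finite almost everywhere, and
    at such points the increasing sequence u_n is bounded. *)
Lemma scheme_limit : exists u : T -> R,
  [/\ mfun u /\ (forall x, 0 <= u x), forall x, ~ O x -> u x = 0,
      igr mu (fun x => u x `^ (p - 1)),
      {ae mu, forall x, us n x @[n --> \oo] --> u x} &
      {ae mu, forall x n, us n x <= u x}].
Proof.
have [B hB] := scheme_bound.
have mus := scheme_meas.
pose U n x := us n x `^ (p - 1).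
have mU n : mfun (U n) by have mun := mus n; rewrite /U; measf.
have U0 n x : 0 <= U n x by exact: powR_ge0.
pose h x := limn_einf (fun n => (U n x)%:E).
have mh : measurable_fun setT h.
  have -> : h = (fun x => - limn_esup (fun n => - (U n x)%:E))%E.
    by apply/funext => x; rewrite -limn_einfN; congr limn_einf; apply/funext => n /=;
      rewrite ?oppeK ?opprK.
  apply: measurableT_comp => //; apply: measurable_fun_limn_esup => n.
  by apply: measurableT_comp => //; exact/measurable_EFinP.
have hfin : {ae mu, forall x, h x \is a fin_num}.
  have : mu.-integrable setT h.
    apply/integrableP; split => //.
    apply: (@le_lt_trans _ _ B%:E); last exact: ltry.
    have h0 x : (0 <= h x)%E.
      rewrite /h limn_einf_lim; apply: lime_ge; first exact: is_cvg_einfs.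
      apply: nearW => n; apply: le_ereal_inf_tmp => _ [m _ <-].
      by rewrite lee_fin.
    under eq_integral do rewrite gee0_abs //.
    apply: le_trans; first apply: (fatou mu measurableT).
    - by move=> n; exact/measurable_EFinP.
    - by move=> n x _; rewrite lee_fin.
    apply: limn_einf_le; apply: nearW => n.
    by rewrite (EFin_Rintegral (scheme_igr n)) lee_fin; exact: hB.
  by move=> /(integrable_ae measurableT); apply: filterS => x /(_ I).
have cu : {ae mu, forall x, cvgn (us ^~ x)}.
  apply: filterS2 hfin scheme_mono => x hx mono.
  have nd : nondecreasing_seq (us ^~ x) by apply/nondecreasing_seqP.
  apply: nondecreasing_is_cvgn => //.
  exists (fine (h x) `^ (p - 1)^-1) => _ [n _ <-].
  have hU : U n x <= fine (h x).
    rewrite -lee_fin fineK // /h limn_einf_lim; apply: lime_ge; first exact: is_cvg_einfs.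
    exists n => // m /= nm; apply: le_ereal_inf_tmp => _ [l /= ml <-].
    rewrite lee_fin; apply: powR_le; [exact: ltW|exact: us0|].
    by apply: nd; exact: leq_trans ml.
  have -> : us n x = U n x `^ (p - 1)^-1.
    by rewrite /U -powRrM mulfV ?gt_eqF // powRr1.
  by apply: powR_le => //; rewrite invr_ge0 ltW.
pose u x := Num.max (limfun us x) 0.
have mlu := mf_limfun mus.
have mu_ : mfun u by rewrite /u; measf.
have cuu : {ae mu, forall x, us n x @[n --> \oo] --> u x}.
  apply: filterS cu => x cx; have c := limfun_cvg cx.
  suff -> : u x = limfun us x by [].
  rewrite /u max_l // -(cvg_lim (@Rhausdorff R) c).
  by apply: limr_ge => //; apply: nearW => n; exact: us0.
exists u; split => //.
- by split => // x; rewrite /u le_max lexx orbT.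
- move=> x nO; rewrite /u (@limfunE _ _ _ us x 0) ?maxxx //.
  rewrite (_ : (fun n => us n x) = fun=> 0); first exact: cvg_cst.
  by apply/funext => n; have [Wu _ _] := scheme_KK n; exact: (adm_out A Wu).
- apply: (@fatou_real _ _ _ mu U (fun x => u x `^ (p - 1)) B _ U0 _ _ _ _).1.
  + exact: scheme_igr.
  + by measf.
  + by move=> x; exact: powR_ge0.
  + apply: filterS cuu => x c.
    have ux0 : 0 <= u x by rewrite /u le_max lexx orbT.
    have := cvgn_comp (normr_powR_continuous q0) c.
    rewrite ger0_norm // (_ : (fun n => `|us n x| `^ _) = U ^~ x) //.
    by apply/funext => n; rewrite ger0_norm.
  + by apply: nearW => n; exact: hB.
- apply: filterS2 cuu scheme_mono => x c mono n.
  have nd : nondecreasing_seq (us ^~ x) by apply/nondecreasing_seqP.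
  rewrite -(cvg_lim (@Rhausdorff R) c); apply: nondecreasing_cvgn_le => //.
  by apply/cvg_ex; exists (u x).
Qed.

End scheme.

(** * Passage to the limit in the entropy inequality *)

Section pointwise_entropy_bounds.
Context {R : realType}.
Implicit Types a b k : R.

(** T_k(a) / k with k = 1/(n+1) approaches the indicator of a > 0; as a^q vanishes at a = 0, the
    indicator leaves no trace in the limit. *)
Lemma flux_cvg (q : R) (a_ : nat -> R) a : 0 < q -> (forall n, 0 <= a_ n) -> 0 <= a ->
  a_ n @[n --> \oo] --> a ->
  n.+1%:R * (a_ n `^ q * Tk n.+1%:R^-1 (a_ n)) @[n --> \oo] --> a `^ q.
Proof.
move=> q0 an0 a0 ca.
have cq : a_ n `^ q @[n --> \oo] --> a `^ q.
  have := cvgn_comp (normr_powR_continuous q0) ca.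
  rewrite ger0_norm // (_ : (fun n => `|a_ n| `^ q) = (fun n => a_ n `^ q)) //.
  by apply/funext => n; rewrite ger0_norm.
have k0 n : 0 < n.+1%:R^-1 :> R by rewrite invr_gt0.
have [az|ap] := eqVneq a 0.
  rewrite az powR0 ?gt_eqF // in cq *.
  apply: (squeeze_cvgr _ (cvg_cst 0) cq); apply: nearW => n.
  have t0 := Tk_ge0 (ltW (k0 n)) (an0 n).
  have tk : Tk n.+1%:R^-1 (a_ n) <= n.+1%:R^-1.
    by have := Tk_norm (a_ n) (ltW (k0 n)); rewrite ger0_norm.
  rewrite !mulr_ge0 ?powR_ge0 //= mulrCA; apply: ler_piMr; first exact: powR_ge0.
  by rewrite -ler_pdivlMl ?ltr0n // mulr1.
have {}ap : 0 < a by rewrite lt_def ap.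
have a2 : 0 < a / 2 by rewrite divr_gt0.
have lt2 : a / 2 < a by lra.
have n1 : \forall n \near \oo, a / 2 <= a_ n.
  have h := @cvgr_ge _ _ _ _ _ _ ca _ lt2; exact: h.
have n2 : \forall n \near \oo, n.+1%:R^-1 <= a / 2.
  have /cvgr0Pnorm_lt/(_ _ a2) := @cvg_harmonic R.
  by apply: filterS => n /ltW; rewrite /= ger0_norm.
have e : \forall n \near \oo, a_ n `^ q = n.+1%:R * (a_ n `^ q * Tk n.+1%:R^-1 (a_ n)).
  apply: filterS2 n1 n2 => n h1 h2.
  rewrite Tk_geE; [|exact: ltW|].
    by rewrite mulrCA mulfV ?mulr1 // pnatr_eq0.
  exact: le_trans h1.
exact: cvg_trans (near_eq_cvg e) cq.
Qed.

(* Where the product is negative, both values of [u] lie below [k + M]. *)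
Lemma aform_neg_part p k M u1 u2 f1 f2 : 1 < p -> 0 <= k -> 0 <= u1 -> 0 <= u2 ->
  `|f1| <= M -> `|f2| <= M ->
  - (`|Tk (k + M) u1 - Tk (k + M) u2| `^ (p - 1) * `|f1 - f2|) <=
  Phi p (u1 - u2) * (Tk k (u1 - f1) - Tk k (u2 - f2)) :> R.
Proof.
move=> p1 k0; wlog u12 : u1 u2 f1 f2 / u2 <= u1.
  move=> hw a1 a2 b1 b2; have [h|/ltW h] := leP u2 u1; first exact: hw.
  have := hw u2 u1 f2 f1 h a2 a1 b2 b1.
  rewrite distrC [`|f2 - f1|]distrC => /le_trans; apply.
  by rewrite -[u1 - u2]opprB PhiN -[Tk k (u1 - f1) - _]opprB mulrNN.
move=> a1 a2 b1 b2.
have P0 : 0 <= Phi p (u1 - u2) by rewrite Phi_ge0E ?subr_ge0 ?powR_ge0.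
have N0 : - (`|Tk (k + M) u1 - Tk (k + M) u2| `^ (p - 1) * `|f1 - f2|) <= 0.
  by rewrite oppr_le0 mulr_ge0 ?powR_ge0.
have [D0|D0] := leP 0 (Tk k (u1 - f1) - Tk k (u2 - f2)).
  by apply: le_trans N0 _; rewrite mulr_ge0.
have u1L : u1 <= k + M.
  rewrite leNgt; apply/negP => h; move: D0; rewrite (@Tk_geE _ k (u1 - f1)) //.
    by have := Tk_norm (u2 - f2) k0; rewrite ler_norml => /andP[_]; lra.
  by have := ler_norm f1; lra.
have u2L : u2 <= k + M := le_trans u12 u1L.
have -> : Tk (k + M) u1 = u1 by apply: Tk_id; rewrite ger0_norm.
have -> : Tk (k + M) u2 = u2 by apply: Tk_id; rewrite ger0_norm.
have hD : - `|f1 - f2| <= Tk k (u1 - f1) - Tk k (u2 - f2).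
  have := Tk_lip (u1 - f1) (u2 - f2) k0; rewrite (ltr0_norm D0).
  have lt : u1 - f1 < u2 - f2.
    by rewrite ltNge; apply/negP => h; move: D0; have := Tk_le k h; lra.
  rewrite ltr0_norm; last by lra.
  by have := ler_norm (f1 - f2); lra.
rewrite -mulrN (Phi_ge0E p1) ?subr_ge0 // ger0_norm ?subr_ge0 //.
by apply: ler_wpM2l => //; exact: powR_ge0.
Qed.

End pointwise_entropy_bounds.

Section entropy_limit.
Context {d : measure_display} {T : measurableType d} {R : realType}.
Variables (mu : {sigma_finite_measure set T -> \bar R}) (p : R) (K : T * T -> R).
Variables (O : set T) (W : (T -> R) -> Prop) (lam1 sg : R).
Hypothesis A : admissible mu p K O W lam1 sg.

Local Notation mfun := (measurable_fun setT).
Local Notation en := (edens p K).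
Local Notation pr := (aform p K).
Implicit Types u v w f : T -> R.

Let p1 : 1 < p := adm_p A.
Let mK := adm_mK A.
Let K0 := adm_K0 A.
Let mO := adm_mO A.

(** Pairs with exactly one point in O. Solutions and test functions vanish at the other point, and
    the increments of phi are not controlled there. *)
Definition cross (z : T * T) : R :=
  \1_O z.1 * \1_(~` O) z.2 + \1_(~` O) z.1 * \1_O z.2.
Definition crdens (v : T -> R) (z : T * T) : R :=
  cross z * (K z * `|v z.1 - v z.2| `^ (p - 1)).

Lemma cross01 z : 0 <= cross z <= 1.
Proof.
have [h1|h1] := pselect (O z.1); have [h2|h2] := pselect (O z.2); rewrite /cross.
- by rewrite (indic_in h1) (indic_in h2) (indic_Cout h1) (indic_Cout h2); lra.
- by rewrite (indic_in h1) (indic_out h2) (indic_Cout h1) (indic_Cin h2); lra.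
- by rewrite (indic_out h1) (indic_in h2) (indic_Cin h1) (indic_Cout h2); lra.
- by rewrite (indic_out h1) (indic_out h2) (indic_Cin h1) (indic_Cin h2); lra.
Qed.

Lemma mf_cross : mfun cross.
Proof.
have mC : measurable (~` O) by exact: measurableC.
have h1 := mf_indic mO (R := R); have h2 := mf_indic mC (R := R).
by apply: mf_D; apply: mf_M; by [exact: mf_fst|exact: mf_snd].
Qed.

Lemma mf_crdens v : mfun v -> mfun (crdens v).
Proof. by move=> mv; have mc := mf_cross; have mK' := mK; rewrite /crdens; measf. Qed.

Lemma crdens_ge0 v z : 0 <= crdens v z.
Proof. by have /andP[? _] := cross01 z; rewrite !mulr_ge0 ?powR_ge0 ?K0. Qed.

(** On O x O the negative part is estimated by Young's inequality twice, against phi and against the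
    defect [dl], whence the factor 2. Across the boundary |T_k| <= k leaves k times the flux, and
    off D the form is 0. The defect is present because the approximants psi are compared with phi on
    O x O only. *)
Lemma aform_lower (e k M : R) v psi phi (dl : T * T -> R) z : 0 < e -> 0 <= k ->
  (forall x, 0 <= v x) -> (forall x, ~ O x -> v x = 0) -> (forall x, ~ O x -> psi x = 0) ->
  (forall x, `|psi x| <= M) -> 0 <= dl z ->
  (O z.1 -> O z.2 -> `|psi z.1 - psi z.2| <= `|phi z.1 - phi z.2| + dl z) ->
  - (2 * e * en (fun x => Tk (k + M) (v x)) z
     + e `^ (1 - p) * (\1_O z.1 * \1_O z.2 * en phi z)
     + k * crdens v z
     + e `^ (1 - p) * (\1_O z.1 * \1_O z.2 * (K z * dl z `^ p)))
  <= pr v (fun x => Tk k (v x - psi x)) z.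
Proof.
move=> e0 k0 v0 ov op bp d0 hd.
have q0 : 0 <= p - 1 by have := p1; lra.
have E0 : 0 <= 2 * e * en (fun x => Tk (k + M) (v x)) z.
  by rewrite mulr_ge0 ?(edens_ge0 A) // mulr_ge0 // ltW.
have C0 := powR_ge0 e (1 - p).
have [h1|h1] := pselect (O z.1); have [h2|h2] := pselect (O z.2).
- rewrite (indic_in h1) (indic_in h2) !mul1r.
  have cz : crdens v z = 0.
    rewrite /crdens /cross (indic_Cout h1) (indic_Cout h2).
    by rewrite mulr0 mul0r addr0 mul0r.
  rewrite cz mulr0 addr0 /aform.
  have := aform_neg_part p1 k0 (v0 z.1) (v0 z.2) (bp z.1) (bp z.2).
  set a := `|Tk _ _ - _| => h.
  apply: le_trans (ler_wpM2l (K0 z) h); rewrite mulrN lerN2.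
  have a0 : 0 <= a by exact: normr_ge0.
  have h3 : a `^ (p - 1) * `|psi z.1 - psi z.2| <=
     (e * a `^ p + e `^ (1 - p) * `|phi z.1 - phi z.2| `^ p) +
     (e * a `^ p + e `^ (1 - p) * dl z `^ p).
    apply: le_trans (lerD (young_eps p1 e0 a0 (normr_ge0 _)) (young_eps p1 e0 a0 d0)).
    by rewrite -mulrDr; apply: ler_wpM2l; [exact: powR_ge0|exact: hd].
  apply: le_trans (ler_wpM2l (K0 z) h3) _; rewrite /edens -/a.
  by rewrite le_eqVlt; apply/orP; left; apply/eqP; ring.
- have cz : cross z = 1.
    rewrite /cross (indic_in h1) (indic_Cin h2) (indic_out h2).
    by rewrite mulr0 addr0 mulr1.
  rewrite (indic_out h2) !mulr0 !mul0r !mulr0 !addr0 /crdens cz mul1r.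
  rewrite /aform (ov _ h2) (op _ h2) subrr Tk0 // !subr0.
  apply: (@le_trans _ _ (- (k * (K z * `|v z.1| `^ (p - 1))))).
    by rewrite lerN2 lerDr.
  rewrite mulrCA -mulrN; apply: ler_wpM2l; first exact: K0.
  rewrite -norm_Phi // lerNl -mulNr; apply: le_trans (ler_norm _) _.
  by rewrite normrM normrN mulrC; apply: ler_wpM2r => //; exact: Tk_norm.
- have cz : cross z = 1.
    rewrite /cross (indic_out h1) (indic_in h2) (indic_Cin h1).
    by rewrite mul0r add0r mulr1.
  rewrite (indic_out h1) !mul0r !mulr0 !addr0 /crdens cz mul1r.
  rewrite /aform (ov _ h1) (op _ h1) subrr Tk0 // !sub0r normrN.
  apply: (@le_trans _ _ (- (k * (K z * `|v z.2| `^ (p - 1))))).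
    by rewrite lerN2 lerDr.
  rewrite mulrCA -mulrN; apply: ler_wpM2l; first exact: K0.
  rewrite PhiN mulrNN -norm_Phi // lerNl -mulNr; apply: le_trans (ler_norm _) _.
  by rewrite normrM normrN mulrC; apply: ler_wpM2r => //; exact: Tk_norm.
- rewrite /aform (ov _ h1) (ov _ h2) subrr Phi0 mul0r mulr0 oppr_le0.
  rewrite (indic_out h1) !mul0r !mulr0 !addr0.
  by rewrite addr_ge0 // mulr_ge0 // crdens_ge0.
Qed.

End entropy_limit.

Section entropy_solution_limit.
Context {d : measure_display} {T : measurableType d} {R : realType}.
Variables (mu : {sigma_finite_measure set T -> \bar R}) (p : R) (K : T * T -> R).
Variables (O : set T) (W : (T -> R) -> Prop) (lam1 sg : R).
Hypothesis A : admissible mu p K O W lam1 sg.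

Local Notation m2 := (mu \x mu)%E.
Local Notation mfun := (measurable_fun setT).
Local Notation en := (edens p K).
Local Notation fe := (fin_energy mu p K).
Local Notation En := (energy mu p K).
Local Notation pr := (aform p K).
Implicit Types u v w f : T -> R.

Let p1 : 1 < p := adm_p A.
Let p0 : 0 < p. Proof. by have := p1; lra. Qed.
Let K0 := adm_K0 A.

Local Notation KK := (bounded_class mu p K W).
Local Notation vsol := (vsol mu p K W).
Local Notation cr := (crdens p K O).
Local Notation crs := (@cross d T R O).
Variables (lam : R) (g : T -> R).
Hypotheses (lamP : 0 < lam < lam1) (ig : igr mu g) (g0 : forall x, 0 <= g x).
Local Notation datum := (datum p lam g).
Variable us : nat -> T -> R.
Hypotheses (us0 : forall n x, 0 <= us n x) (usK0 : KK 0 (us 0%N))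
  (usS : forall n, vsol n.+1%:R (datum (us n)) (us n.+1)).
Variable u : T -> R.
Hypotheses (mu_ : mfun u) (u0 : forall x, 0 <= u x) (ou : forall x, ~ O x -> u x = 0)
  (iu : igr mu (fun x => u x `^ (p - 1)))
  (cu : {ae mu, forall x, us n x @[n --> \oo] --> u x})
  (leu : {ae mu, forall x n, us n x <= u x}).

Let q0 : 0 < p - 1. Proof. by have := p1; lra. Qed.
Let mus n : mfun (us n) := scheme_meas A usK0 usS n.
Let WS n : W (us n). Proof. by have [] := scheme_KK usK0 usS n. Qed.
Let fS n : fe (us n). Proof. by have [] := scheme_KK usK0 usS n. Qed.
Let idn n : igr mu (datum (us n)).
Proof. by apply: igr_datum => //; exact: (scheme_igr A us0 usK0 usS). Qed.
Let idu : igr mu (datum u).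
Proof. exact: igr_datum. Qed.
Let Fm := Rintegral mu setT (datum u).
Let Fm0 : 0 <= Fm.
Proof. by apply: Rint_ge0 => x; exact: (datum_ge0 p lamP). Qed.
Let cu1 : {ae mu, forall x, us n.+1 x @[n --> \oo] --> u x}.
Proof.
apply: filterS cu => x c.
rewrite (_ : (fun n => us n.+1 x) = (fun n => us (n + 1)%N x)).
  by rewrite (cvg_shiftn 1 (us ^~ x)).
by apply/funext => n; rewrite addn1.
Qed.

(** The test with T_k u_(n+1), where the datum of u_n is replaced by its upper bound, the datum of
    the limit. The resulting bounds are uniform in n and linear in k. *)
Lemma scheme_truncation n k : 0 <= k -> let V := fun x => Tk k (us n.+1 x) in
  [/\ W V, fe V, En V <= k * Fm, igr m2 (pr (us n.+1) V) &
   Rintegral m2 setT (pr (us n.+1) V) <= k * Fm].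
Proof.
move=> k0 V; have := vsol_test_excess A (usS n) k0 (lexx 0).
have VE : (fun x => Tk k (us n.+1 x - Tk 0 (us n.+1 x))) = V.
  by apply/funext => x; rewrite Tk_0l subr0.
rewrite VE => -[WV fV iV [e1 e2]].
have mV := adm_meas A WV.
have V0 x : 0 <= V x by apply: Tk_ge0.
have Vk x : `|V x| <= k by exact: Tk_norm.
have h : Rintegral m2 setT (pr (us n.+1) V) <= k * Fm.
  apply: le_trans e2 _; rewrite -Rint_Z //; apply: Rint_le_ae.
  - exact: (igr_mulb (idn n) mV Vk).
  - exact: igrZ.
  - apply: filterS leu => x h; rewrite mulrC.
    apply: ler_pM => //; [exact: (datum_ge0 p lamP)|by have := Vk x; rewrite ger0_norm|].
    exact: (datum_le A).
by split => //; apply: le_trans e1 _.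
Qed.

Lemma limit_truncation k : 0 < k -> W (fun x => Tk k (u x)) /\ fe (fun x => Tk k (u x)).
Proof.
move=> k0; have k00 := ltW k0.
apply: (@W_monotone_limit _ _ _ _ _ _ _ _ _ _ A (fun n x => Tk k (us n.+1 x)) _ k (k * Fm)).
- by move=> n; have [] := scheme_truncation n k00.
- by move=> n; have [] := scheme_truncation n k00.
- by move=> n; have [] := scheme_truncation n k00.
- by move=> n x; exact: Tk_norm.
- apply: filterS (scheme_mono A lamP ig us0 usK0 usS) => x h n; exact: Tk_le.
- by apply: filterS cu1 => x c; exact: (cvgn_comp (Tk_continuous k00)).
- by measf.
- by move=> x /ou ->; rewrite Tk0.
Qed.

(** The bound k [Fm] is linear in k and so survives division by k. Across the boundary the form
    tested with T_k u_n / k is K u_n^(p-1) T_k(u_n) / k, which for k = 1/(n+1) tends to K u^(p-1);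
    Fatou's lemma concludes. *)
Lemma flux_igr : igr m2 (cr u).
Proof.
pose kn n : R := n.+1%:R^-1.
have kn0 n : 0 < kn n by rewrite invr_gt0.
have cr01 z : 0 <= crs z <= 1 := cross01 O z.
have mc : mfun crs := mf_cross A.
pose f n z := crs z * (n.+1%:R * pr (us n.+1) (fun x => Tk (kn n) (us n.+1 x)) z).
have ipr n : igr m2 (fun z => n.+1%:R * pr (us n.+1) (fun x => Tk (kn n) (us n.+1 x)) z).
  by apply: igrZ; have [_ _ _ ->] := scheme_truncation n (ltW (kn0 n)).
have pr0 n z : 0 <= n.+1%:R * pr (us n.+1) (fun x => Tk (kn n) (us n.+1 x)) z.
  rewrite mulr_ge0 //; apply: le_trans (edens_ge0 A (fun x => Tk (kn n) (us n.+1 x)) z) _.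
  by apply: (aform_lip_mono A); apply: Tk_mono_lip; exact: ltW.
have f0 n z : 0 <= f n z.
  by rewrite /f mulr_ge0 ?pr0 //; case/andP: (cr01 z).
have flp n z : f n z <= n.+1%:R * pr (us n.+1) (fun x => Tk (kn n) (us n.+1 x)) z.
  by apply: ler_piMl; [exact: pr0|case/andP: (cr01 z)].
have mf n : mfun (f n).
  by have h := igr_meas (ipr n); rewrite /f; apply: mf_M.
have if_ n : igr m2 (f n).
  by apply: (igr_le (mf n) _ (ipr n)) => z; rewrite ger0_norm.
apply: (@fatou_real _ _ _ m2 f (cr u) Fm if_ f0 _ _ _ _).1.
- exact: (mf_crdens A).
- by move=> z; exact: (crdens_ge0 A).
- apply: filterS (ae_pair cu1) => z [c1 c2]; rewrite /f /crdens.
  have aux (a_ : nat -> R) (a : R) : (forall n, 0 <= a_ n) -> 0 <= a -> a_ n @[n --> \oo] --> a ->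
     n.+1%:R * (K z * (a_ n `^ (p - 1) * Tk (kn n) (a_ n))) @[n --> \oo] --> K z * a `^ (p - 1).
    move=> h1 h2 h3; under eq_fun do rewrite mulrCA.
    by apply: cvgMr; exact: flux_cvg.
  have [h1|h1] := pselect (O z.1); have [h2|h2] := pselect (O z.2).
  + have -> : crs z = 0.
      by rewrite /cross (indic_Cout h1) (indic_Cout h2) mulr0 mul0r addr0.
    by rewrite mul0r; under eq_fun do rewrite mul0r; exact: cvg_cst.
  + apply: cvgMr; rewrite (ou h2) subr0 ger0_norm //.
    under eq_fun do rewrite /aform (adm_out A (WS _) h2) Tk0 ?ltW // !subr0 Phi_ge0E //.
    exact: aux.
  + apply: cvgMr; rewrite (ou h1) sub0r normrN ger0_norm //.
    under eq_fun do rewrite /aform (adm_out A (WS _) h1) Tk0 ?ltW // !sub0r PhiN mulrNN Phi_ge0E //.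
    exact: aux.
  + have -> : crs z = 0.
      by rewrite /cross (indic_out h1) (indic_out h2) mulr0 mul0r addr0.
    by rewrite mul0r; under eq_fun do rewrite mul0r; exact: cvg_cst.
- apply: nearW => n; have [_ _ _ h1 h2] := scheme_truncation n (ltW (kn0 n)).
  apply: le_trans (Rint_le (if_ n) (ipr n) (flp n)) _; rewrite Rint_Z //.
  by rewrite -ler_pdivlMl ?ltr0n.
Qed.

Lemma limit_entropy : entropy_ineq mu p K W (datum u) u.
Proof.
move=> k M0 phi k0 Wphi bphi0; have k00 := ltW k0.
pose M := Num.max M0 0.
have M00 : 0 <= M by rewrite /M le_max lexx orbT.
have bphi x : `|phi x| <= M by rewrite /M le_max bphi0.
have mphi := adm_meas A Wphi; have ophi := adm_out A Wphi.
have [iG [phi_ [dd [hphi_ bphi_ cphi [dd0 hdd] [mdd idd]]]]] := adm_approx A Wphi bphi.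
have mphi_ n : mfun (phi_ n) := adm_meas A (hphi_ n).1.
set L := k + M; have L0 : 0 < L by rewrite /L; lra.
pose v n := us n.+1.
have v0 n x : 0 <= v n x by exact: us0.
have mv n : mfun (v n) by exact: mus.
have ov n x : ~ O x -> v n x = 0 by exact: (adm_out A (WS _)).
pose Tn n x := Tk k (v n x - phi_ n x).
have mTn n : mfun (Tn n) by have m1 := mv n; have m2 := mphi_ n; rewrite /Tn; measf.
pose Tu x := Tk k (u x - phi x).
have mTu : mfun Tu by rewrite /Tu; measf.
pose F n := pr (v n) (Tn n); pose Fu := pr u Tu.
have iF n : igr m2 (F n).
  apply: (igr_aform A) => //; first exact: fS.
  apply: (fe_Tk A) => //; first by have h1 := mv n; have h2 := mphi_ n; measf.
  by apply: (fe_B A) => //; [exact: fS|exact: (hphi_ n).2].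
have mFu : mfun Fu by exact: (mf_aform A).
pose CR := Rintegral m2 setT (cr u).
have icr := flux_igr.
have crle n : {ae m2, forall z, cr (v n) z <= cr u z}.
  apply: filterS (ae_pair leu) => z [l1 l2]; rewrite /crdens.
  have cz : 0 <= cross O z :> R by case/andP: (cross01 (R := R) O z).
  have [h1|h1] := pselect (O z.1); have [h2|h2] := pselect (O z.2).
  - by rewrite /cross (indic_Cout h1) (indic_Cout h2) mulr0 mul0r addr0 !mul0r.
  - apply: ler_wpM2l => //; apply: ler_wpM2l; first exact: K0.
    rewrite (ou h2) (ov n _ h2) !subr0 !ger0_norm //.
    by apply: powR_le => //; [exact: ltW|exact: l1].
  - apply: ler_wpM2l => //; apply: ler_wpM2l; first exact: K0.
    rewrite (ou h1) (ov n _ h1) !sub0r !normrN !ger0_norm //.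
    by apply: powR_le => //; [exact: ltW|exact: l2].
  - by rewrite /cross (indic_out h1) (indic_out h2) mulr0 mul0r addr0 !mul0r.
have icrn n : igr m2 (cr (v n)).
  apply: (igr_le_ae (mf_crdens A (mv n)) _ icr).
  by apply: filterS (crle n) => z h; rewrite ger0_norm // (crdens_ge0 A).
have hcrn n : Rintegral m2 setT (cr (v n)) <= CR by exact: Rint_le_ae.
pose r1 n := Rintegral mu setT (fun x => datum (us n) x * Tn n x).
pose ru := Rintegral mu setT (fun x => datum u x * Tu x).
have cr1 : r1 n @[n --> \oo] --> ru.
  apply: (@dominated_real _ _ _ mu _ _ (fun x => k * datum u x) _ _ _ _ _).2.
  - by move=> n; have h1 := igr_meas (idn n); have h2 := mTn n; measf.
  - by have h1 := igr_meas idu; measf.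
  - apply: filterS3 cu cu1 cphi => x c1 c2 c3; apply: cvgM; last first.
      by apply: (cvgn_comp (Tk_continuous k00)); exact: cvgB.
    apply: cvgD; last exact: cvg_cst.
    apply: cvgMr; have := cvgn_comp (normr_powR_continuous q0) c1.
    rewrite ger0_norm // (_ : (fun n => `|us n x| `^ _) = (fun n => us n x `^ (p - 1))) //.
    by apply/funext => n; rewrite ger0_norm.
  - exact: igrZ.
  - move=> n; apply: filterS leu => x h; rewrite normrM mulrC.
    apply: ler_pM => //; first exact: Tk_norm.
    by rewrite ger0_norm ?(datum_ge0 p lamP) //; exact: (datum_le A).
(* The inequality at level n + 1 admits phi_n only if |phi_n| <= n + 1, hence the restriction to
   large n. *)
have tst : \forall n \near \oo, Rintegral m2 setT (F n) <= r1 n.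
  exists (Num.bound M) => // n /= hn.
  have [_ hv] := usS n; apply: hv => //; split; [exact: (hphi_ n).1| |exact: (hphi_ n).2].
  move=> x; apply: le_trans (bphi_ n x) _.
  apply: le_trans (ltW (archi_boundP M00)) _; rewrite ler_nat; exact: leq_trans hn (leqnSn _).
have [WL fL] := limit_truncation L0.
have EL0 := energy_ge0 A (fun x => Tk L (u x)).
pose G := Rintegral m2 setT (fun z => \1_O z.1 * \1_O z.2 * en phi z).
(* [F n + H (v n)] is nonnegative up to [r n]. In the limit the phi-term of [H] is the same on both
   sides and cancels, the flux of v_n is at most that of u and cancels too, and the energy term
   costs 2 e L [Fm], which vanishes with e; so bounded truncated energies are enough. *)
have key e : 0 < e -> igr m2 Fu /\ Rintegral m2 setT Fu <= ru + (2 + 2 * L * Fm) * e.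
  move=> e0; pose Ce := e `^ (1 - p).
  pose H w z := 2 * e * en (fun x => Tk L (w x)) z +
     Ce * (\1_O z.1 * \1_O z.2 * en phi z) + k * cr w z.
  have iH w : fe (fun x => Tk L (w x)) -> igr m2 (cr w) -> igr m2 (H w).
    by move=> h1 h2; apply: igrD; [apply: igrD|]; exact: igrZ.
  have HE w : fe (fun x => Tk L (w x)) -> igr m2 (cr w) -> Rintegral m2 setT (H w) =
      2 * e * En (fun x => Tk L (w x)) + Ce * G + k * Rintegral m2 setT (cr w).
    move=> h1 h2; rewrite Rint_D; [|by apply: igrD; exact: igrZ|exact: igrZ].
    by rewrite Rint_D ?Rint_Z //; exact: igrZ.
  have fTn n : fe (fun x => Tk L (v n x)) by have [] := scheme_truncation n (ltW L0).
  have ETn n : En (fun x => Tk L (v n x)) <= L * Fm.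
    by have [] := scheme_truncation n (ltW L0).
  pose r n z := Ce * (\1_O z.1 * \1_O z.2 * (K z * dd n z `^ p)).
  have low n z : 0 <= F n z + H (v n) z + r n z.
    have := aform_lower A e0 k00 (v0 n) (ov n) (adm_out A (hphi_ n).1) (bphi_ n)
      (dd0 n z) (hdd n z).
    rewrite -/L -/Ce -/(H (v n) z) -/(r n z) -/(Tn n) -/(F n z) => h.
    by move: h; move: (F n z) (H (v n) z) (r n z) => a b c; lra.
  have lowu z : 0 <= Fu z + H u z.
    have := @aform_lower _ _ _ _ _ _ _ _ _ _ A e k M u phi phi (fun=> 0) z e0 k00 u0 ou
      ophi bphi (lexx 0).
    rewrite addr0 powR0 ?gt_eqF // !mulr0 addr0 -/L -/Ce -/(H u z) -/Tu -/(Fu z).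
    move=> /(_ (fun _ _ => lexx _)).
    by move: (Fu z) (H u z) => a b; lra.
  (* The positive part restores the sign that Fatou's lemma demands and exceeds the integrand by at
     most [r n]. *)
  pose P n z := Num.max (F n z + H (v n) z) 0.
  have iFH n : igr m2 (fun z => F n z + H (v n) z) by apply: igrD => //; exact: iH.
  have iP n : igr m2 (P n) by exact: igr_pos.
  have e1 : \forall n \near \oo, r1 n <= ru + e.
    have lt : ru < ru + e by rewrite ltrDl.
    have h := @cvgr_le _ _ _ _ _ _ cr1 _ lt; exact: h.
  (* The approximation error gets multiplied by [Ce], a negative power of e, so it is asked to be at
     most e / (Ce + 1). *)
  have eC : 0 < e / (Ce + 1) by rewrite divr_gt0 // ltr_pwDr // powR_ge0.
  have [iS hS] : igr m2 (fun z => Fu z + H u z) /\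
    Rintegral m2 setT (fun z => Fu z + H u z) <=
      (ru + e) + (2 * e * (L * Fm) + Ce * G + k * CR) + e.
    apply: (@fatou_real _ _ _ m2 P _ _ iP).
    - by move=> n z; rewrite /P le_max lexx orbT.
    - have h1 : mfun (H u) := igr_meas (iH _ fL icr).
      by measf.
    - exact: lowu.
    - apply: filterS2 (ae_pair cu1) (ae_pair cphi) => z [c1 c2] [c3 c4].
      have cF : F n z @[n --> \oo] --> Fu z.
        rewrite /F /Fu /aform; apply: cvgMr; apply: cvgM.
          by apply: (cvgn_comp (Phi_continuous p1)); exact: cvgB.
        by apply: cvgB; apply: (cvgn_comp (Tk_continuous k00)); exact: cvgB.
      have cH : H (v n) z @[n --> \oo] --> H u z.
        apply: cvgD; [apply: cvgD; [apply: cvgMr|exact: cvg_cst]|apply: cvgMr].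
          apply: cvgMr; apply: (@cvgn_comp _ (fun t : R => `|t| `^ p)).
            exact: normr_powR_continuous.
          by apply: cvgB; apply: (cvgn_comp (Tk_continuous (ltW L0))).
        apply: cvgMr; apply: cvgMr; apply: (@cvgn_comp _ (fun t : R => `|t| `^ (p - 1))).
          exact: normr_powR_continuous.
        exact: cvgB.
      have -> : Fu z + H u z = ((Fu z + H u z) + `|Fu z + H u z|) / 2.
        by rewrite ger0_norm //; lra.
      rewrite (_ : (fun n => P n z) = (fun n => ((F n z + H (v n) z) +
         `|F n z + H (v n) z|) / 2)); last first.
        apply/funext => n; rewrite /P; move: (F n z + _) => a.
        have [a0|a0] := leP 0 a; first by rewrite ger0_norm //; lra.
        by rewrite ltr0_norm //; lra.
      have cFH : F n z + H (v n) z @[n --> \oo] --> Fu z + H u z.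
        by apply: cvgD.
      have cN : `|F n z + H (v n) z| @[n --> \oo] --> `|Fu z + H u z|.
        have cn : continuous (fun t : R => `|t|) by move=> t; exact: norm_continuous.
        exact: (cvgn_comp cn cFH).
      by apply: cvgMl; apply: cvgD.
    - apply: filterS3 tst e1 (idd _ eC) => n t1 t2 [ir hr].
      have ir' : igr m2 (r n) by exact: igrZ.
      have hP z : P n z <= F n z + H (v n) z + r n z.
        rewrite /P ge_max low andbT lerDl mulr_ge0 ?powR_ge0 //.
        by rewrite !mulr_ge0 ?K0 ?powR_ge0.
      apply: le_trans (Rint_le (iP n) (igrD (iFH n) ir') hP) _.
      rewrite Rint_D // Rint_D //; last exact: iH.
      rewrite HE // [Rintegral _ _ (r n)]Rint_Z //.
      have h3 : Ce * Rintegral m2 setT (fun z => \1_O z.1 * \1_O z.2 * (K z * dd n z `^ p)) <= e.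
        apply: le_trans (ler_wpM2l (powR_ge0 _ _) hr) _.
        rewrite -/Ce mulrCA; apply: ler_piMr; first exact: ltW.
        have C10 : 0 < Ce + 1 by rewrite ltr_pwDr // powR_ge0.
        by rewrite ler_pdivrMr // mul1r lerDl.
      apply: lerD; last exact: h3.
      apply: lerD; first exact: (le_trans t1 t2).
      apply: lerD; last exact: (ler_wpM2l k00 (hcrn n)).
      by rewrite lerD2r; apply: ler_wpM2l; [rewrite mulr_ge0 // ltW|exact: ETn].
  have iFu : igr m2 Fu.
    have := igrB iS (iH _ fL icr); congr (igr m2 _); apply/funext => z; ring.
  split => //; move: hS; rewrite Rint_D //; last exact: iH.
  rewrite HE // -/CR.
  have h4 : 0 <= 2 * e * En (fun x => Tk L (u x)) by rewrite !mulr_ge0 // ltW.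
  rewrite (_ : (2 + 2 * L * Fm) * e = 2 * e + 2 * e * (L * Fm)); last by ring.
  by move: (Rintegral m2 setT Fu) (2 * e * En _) (2 * e * (L * Fm)) (Ce * G) (k * CR) h4 => *;
    lra.
have [iFu _] := key 1 ltr01.
rewrite sintE // lee_fin; apply/ler_addgt0Pr => e e0.
have c0 : 0 < 2 + 2 * L * Fm by rewrite ltr_pwDl // mulr_ge0 // mulr_ge0 // ltW.
have e10 : 0 < e / (2 + 2 * L * Fm) by rewrite divr_gt0.
have [_ h] := key _ e10; apply: le_trans h _; rewrite lerD2l mulrCA mulfV ?mulr1 //.
by rewrite gt_eqF.
Qed.

End entropy_solution_limit.

(** * Existence, minimality and decay in the abstract setting *)

Section abstract_theorem.
Context {d : measure_display} {T : measurableType d} {R : realType}.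
Variables (mu : {sigma_finite_measure set T -> \bar R}) (p : R) (K : T * T -> R).
Variables (O : set T) (W : (T -> R) -> Prop) (lam1 sg : R).
Hypothesis A : admissible mu p K O W lam1 sg.

Local Notation m2 := (mu \x mu)%E.
Local Notation mfun := (measurable_fun setT).
Local Notation pr := (aform p K).
Implicit Types u v w f : T -> R.

Theorem minimal_entropy_solution (lam : R) (g : T -> R) : 0 < lam < lam1 -> igr mu g ->
  (forall x, 0 <= g x) ->
  exists u : T -> R, [/\ [/\ mfun u, forall x, 0 <= u x & forall x, ~ O x -> u x = 0],
    igr mu (fun x => u x `^ (p - 1)),
    forall k, 0 < k -> W (fun x => Tk k (u x)),
    entropy_ineq mu p K W (datum p lam g u) u &
    forall v, mfun v -> (forall x, 0 <= v x) -> igr mu (fun x => v x `^ (p - 1)) ->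
      (forall k, 0 < k -> W (fun x => Tk k (v x))) ->
      entropy_ineq mu p K W (datum p lam g v) v -> {ae mu, forall x, u x <= v x}].
Proof.
move=> lamP ig g0; have [us [us0 usK0 usS]] := scheme_exists A lamP ig g0.
have [u [[mu_ u0] ou iu cu leu]] := scheme_limit A lamP ig g0 us0 usK0 usS.
exists u; split => //.
- by move=> k k0; have [] := limit_truncation A lamP ig g0 us0 usK0 usS mu_ ou iu cu leu k0.
- exact: (limit_entropy A lamP ig g0 us0 usK0 usS mu_ u0 ou iu cu leu).
move=> v mv v0 iv WT hv.
have hn n : {ae mu, forall x, us n x <= v x}.
  elim: n => [|n ih].
    apply: nearW => x; have [_ b0 _] := usK0.
    by have := b0 x; rewrite normr_le0 => /eqP ->.
  apply: (comparison_entropy A _ (usS n) _ _ _ mv v0 WT hv) => //.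
  - by apply: igr_datum => //; exact: (scheme_igr A us0 usK0 usS).
  - exact: igr_datum.
  - by apply: filterS ih => x h; apply: (datum_le A).
apply: filterS2 (ae_foralln hn) cu => x h c.
rewrite -(cvg_lim (@Rhausdorff R) c); apply: limr_le; first by apply/cvg_ex; exists (u x).
exact: nearW.
Qed.

(** T_h u is an admissible bounded test function and makes the integrand nonnegative, so the
    integral of f T_1 (u - T_h u) bounds the form; it tends to 0 because f is integrable. *)
Lemma entropy_tail f u : mfun u -> (forall x, 0 <= u x) -> igr mu f -> (forall x, 0 <= f x) ->
  (forall k, 0 < k -> W (fun x => Tk k (u x))) -> entropy_ineq mu p K W f u ->
  forall e, 0 < e -> exists2 H : R, 0 < H & forall h, H <= h ->
    igr m2 (pr u (fun x => Tk 1 (u x - Tk h (u x)))) /\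
    Rintegral m2 setT (pr u (fun x => Tk 1 (u x - Tk h (u x)))) <= e.
Proof.
move=> mu_ u0 hf f0 WT hu e e0; have mf := igr_meas hf.
have [|||||_ c] := @dominated_real _ _ _ mu
   (fun m x => f x * Tk 1 (u x - Tk m%:R (u x))) (fun=> 0) (fun x => 1 * `|f x|).
- by move=> m; measf.
- exact: mf_cst.
- apply: nearW => x; apply: cvg_near_cst.
  have ux : 0 <= `|u x| by [].
  exists (Num.bound `|u x|) => // m /= hm.
  rewrite (@Tk_id _ m%:R) ?subrr ?Tk0 ?mulr0 //.
  by apply: le_trans (ltW (archi_boundP ux)) _; rewrite ler_nat.
- by apply: igrZ; exact: integrable_norm.
- move=> m; apply: nearW => x; rewrite normrM mulrC; apply: ler_wpM2r => //.
  by apply: Tk_norm.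
have z0 : Rintegral mu setT (fun=> 0 : R) = 0 by rewrite /Rintegral integral0.
rewrite z0 in c.
have [N _ hN] := @cvgr_le _ _ _ _ _ _ c _ e0.
(* The excess T_1 (u - T_h u) decreases as h grows, so the estimate at the integer N + 1 serves
   every real h beyond it. *)
exists N.+1%:R => // h Hh; have h0 : 0 < h by apply: lt_le_trans Hh; rewrite ltr0n.
have b x : `|Tk h (u x)| <= h by apply: Tk_norm; exact: ltW.
have := hu 1 h _ ltr01 (WT h h0) b.
set V := (fun x => Tk 1 (u x - Tk h (u x))) => hV.
have mV : mfun V by rewrite /V; measf.
have pos z : - 0 <= pr u V z.
  rewrite oppr0; apply: le_trans (edens_ge0 A V z) _.
  apply: (aform_lip_mono A (tau := fun a => Tk 1 (a - Tk h a))).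
  by apply: Tk_excess_mono_lip => //; exact: ltW.
have [iV hV'] := sint_igr (mf_aform A mu_ mV) (igr0 m2) pos (fun=> lexx 0) hV.
split => //; apply: le_trans hV' _.
apply: le_trans (hN N.+1 _); last by rewrite /= leqnSn.
have bT (t : R) x : `|Tk 1 (u x - t)| <= 1 by apply: Tk_norm.
apply: Rint_le.
- by apply: (igr_mulb hf mV (c := 1)) => x; exact: bT.
- by apply: (igr_mulb hf (c := 1)) => [|x]; [measf|exact: bT].
- move=> x; apply: ler_wpM2l => //; apply: Tk_le; rewrite lerD2l lerN2.
  have N0 : 0 <= N.+1%:R :> R by [].
  by have := u0 x; move: (u x) (N.+1%:R : R) Hh N0 => a b'; clear; mm; lra.
Qed.

End abstract_theorem.

(** * The iterated integral as a sigma-finite measure on tuples *)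

Section tuple_measure.
Context {R : realType}.

Section cons_measure.
Variables (n : nat) (m : {sigma_finite_measure set (n.-tuple R) -> \bar R}).

Local Notation X1 := (measurableTypeR R).

Definition consf (z : X1 * n.-tuple R) : n.+1.-tuple R := cons_tuple z.1 z.2.

Lemma measurable_consf : measurable_fun setT consf.
Proof.
have mid : measurable_fun setT (fun x : X1 => x : R) by move=> _ Y mY; rewrite setTI.
apply: (@measurable_cons _ _ _ _ (fun z : X1 * n.-tuple R => z.1 : R) n (fun z => z.2)).
  exact: (measurableT_comp mid measurable_fst).
exact: measurable_snd.
Qed.

Local Notation prodm := (@lebesgue_measure R \x m)%E.

(** Image of the product measure under consing, so that Tonelli's theorem reproduces the recursion
    of [iint]; sigma-finiteness has to be transported along for the next step of the induction. *)
Definition consm : set (n.+1.-tuple R) -> \bar R := pushforward prodm consf.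

Let consm0 : consm set0 = 0%E.
Proof. by rewrite /consm /pushforward preimage_set0 measure0. Qed.

Let consm_ge0 B : (0 <= consm B)%E.
Proof. by rewrite /consm /pushforward; apply: measure_ge0. Qed.

Let consm_sigma_additive : semi_sigma_additive consm.
Proof.
move=> F mF tF mUF; rewrite /consm /pushforward preimage_bigcup.
apply: measure_semi_sigma_additive.
- by move=> k; rewrite -[X in measurable X]setTI; exact: measurable_consf.
- apply/trivIsetP => /= i j _ _ ij; rewrite -preimage_setI.
  by move/trivIsetP : tF => /(_ _ _ _ _ ij) ->//; rewrite preimage_set0.
- by rewrite -preimage_bigcup -[X in measurable X]setTI; exact: measurable_consf.
Qed.

HB.instance Definition _ := isMeasure.Build _ _ _ consm consm0 consm_ge0 consm_sigma_additive.

Lemma consm_sigma_finite : sigma_finite setT consm.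
Proof.
have /sigma_finiteP[F1 [TF1 nd1 F1oo]] := sigma_finiteT (@lebesgue_measure R).
have /sigma_finiteP[F2 [TF2 nd2 F2oo]] := sigma_finiteT m.
pose F i := F1 i `*` F2 i.
have UF : setT = \bigcup_i F i.
  apply/seteqP; split => // -[x t] _.
  have : setT x by []; rewrite TF1 => -[i _ xi].
  have : setT t by []; rewrite TF2 => -[j _ tj].
  exists (maxn i j) => //; split => /=.
    by move: x xi; exact/subsetPset/nd1/leq_maxl.
  by move: t tj; exact/subsetPset/nd2/leq_maxr.
have mF i : measurable (F i) /\ (prodm (F i) < +oo)%E.
  have [? ?] := F1oo i; have [? ?] := F2oo i; split; first exact: measurableX.
  by rewrite product_measure1E // lte_mul_pinfty // ge0_fin_numE.
pose inv (t : n.+1.-tuple R) : X1 * n.-tuple R := (thead t, [tuple of behead t]).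
have minv : measurable_fun setT inv.
  apply/measurable_fun_pairP; split; last exact: measurable_behead.
  have mid : measurable_fun setT (fun x : R => x : X1) by move=> _ Y mY; rewrite setTI.
  exact: (measurableT_comp mid (measurable_tnth ord0)).
have consK : cancel consf inv.
  move=> [x t]; rewrite /inv /consf /=; congr pair.
  by apply: val_inj.
have invK t : consf (inv t) = t by rewrite [in RHS](tuple_eta t); apply: val_inj.
exists (fun i => inv @^-1` F i).
  by apply/seteqP; split => // t _; have : setT (inv t) by []; rewrite UF => -[i _ Fi]; exists i.
move=> i; have [m1 m2] := mF i; split.
  by rewrite -[X in measurable X]setTI; exact: minv.
rewrite /consm /pushforward (_ : consf @^-1` _ = F i) //.
by apply/seteqP; split => z; rewrite /preimage /= consK.
Qed.

HB.instance Definition _ := Measure_isSigmaFinite.Build _ _ _ consm consm_sigma_finite.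

Lemma consm_integral (F : n.+1.-tuple R -> \bar R) : measurable_fun setT F ->
  (forall x, 0 <= F x)%E ->
  (\int[consm]_x F x =
   \int[@lebesgue_measure R]_x \int[m]_t F (cons_tuple x t))%E.
Proof.
move=> mF F0.
have e := @ge0_integral_pushforward _ _ _ _ R _ measurable_consf prodm setT F measurableT mF
  (fun y _ => F0 y).
have mFc : measurable_fun setT (F \o consf).
  by apply: measurableT_comp => //; exact: measurable_consf.
transitivity (\int[prodm]_z (F \o consf) z)%E.
  rewrite preimage_setT in e; rewrite -e.
  by apply: eq_measure_integral => [|mc B mB _]; first exact: measurable_consf.
by apply: fubini_tonelli1 => // z; exact: F0.
Qed.

End cons_measure.

(** [iint] is a recursion on arbitrary functions. On nonnegative measurable ones it is integration
    against a measure, which opens the way to the convergence theorems; the empty tuple carries a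
    Dirac mass. *)
Lemma muN_ex n : exists m : {sigma_finite_measure set (n.-tuple R) -> \bar R},
  forall F : n.-tuple R -> \bar R, measurable_fun setT F -> (forall x, 0 <= F x)%E ->
  iint F = (\int[m]_x F x)%E.
Proof.
elim: n => [|n [m hm]].
  exists (@dirac _ _ [tuple] R) => F mF F0 /=.
  by rewrite integral_dirac // diracT mul1e.
exists (consm m) => F mF F0; rewrite consm_integral //=.
apply: eq_integral => x _; apply: hm => // .
apply: (measurableT_comp mF).
by apply: (@measurable_cons _ _ _ _ (fun t : n.-tuple R => x) n (fun t => t)).
Qed.

Definition muN n : {sigma_finite_measure set (n.-tuple R) -> \bar R} := projT1 (cid (muN_ex n)).

Lemma iintE n (F : n.-tuple R -> \bar R) : measurable_fun setT F ->
  (forall x, 0 <= F x)%E -> iint F = (\int[muN n]_x F x)%E.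
Proof. exact: (projT2 (cid (muN_ex n))). Qed.

End tuple_measure.

(** * Euclidean distance, cubes and measurability on tuples *)

Section euclidean_tuples.
Context {R : realType} {N : nat}.
Implicit Types (x y : N.-tuple R) (A B : set (N.-tuple R)) (r : R).
Local Notation mfun := (measurable_fun setT).

Lemma edist_ge0 x y : 0 <= edist x y.
Proof. exact: sqrtr_ge0. Qed.

Lemma enorm_ge0 x : 0 <= enorm x.
Proof. exact: sqrtr_ge0. Qed.

Definition zero_tuple : N.-tuple R := [tuple (0 : R) | i < N].

Lemma enormE x : enorm x = edist zero_tuple x.
Proof.
rewrite /enorm /edist; congr Num.sqrt; apply: eq_bigr => i _.
by rewrite tnth_mktuple sub0r sqrrN.
Qed.

Lemma edistC x y : edist x y = edist y x.
Proof.
by rewrite /edist; congr Num.sqrt; apply: eq_bigr => i _; rewrite -sqrrN opprB.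
Qed.

Lemma edist_coord x y i : `|tnth x i - tnth y i| <= edist x y.
Proof.
rewrite /edist -sqrtr_sqr; apply: ler_wsqrtr.
by rewrite (bigD1 i) //= lerDl; apply: sumr_ge0 => j _; exact: sqr_ge0.
Qed.

Lemma edist_xx x : edist x x = 0.
Proof.
by rewrite /edist big1 ?sqrtr0 // => i _; rewrite subrr expr0n.
Qed.

Lemma edist_eq0 x y : edist x y = 0 -> x = y.
Proof.
move=> h; apply: eq_from_tnth => i; have := edist_coord x y i.
by rewrite h normr_le0 subr_eq0 => /eqP.
Qed.

(** The factor N, instead of its square root, is crude but enters constants only. *)
Lemma edist_le x y r : 0 <= r -> (forall i, `|tnth x i - tnth y i| <= r) ->
  edist x y <= N%:R * r.
Proof.
move=> r0 h; rewrite -[leRHS]ger0_norm ?mulr_ge0 // -sqrtr_sqr /edist.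
apply: ler_wsqrtr; apply: (@le_trans _ _ (\sum_(i < N) r ^+ 2)).
  by apply: ler_sum => i _; rewrite -real_normK ?num_real // lerXn2r ?nnegrE.
rewrite sumr_const card_ord -(mulr_natl (r ^+ 2) N) exprMn; apply: ler_wpM2r; first exact: sqr_ge0.
by rewrite -natrX ler_nat; case: (N) => // n; rewrite -[X in (X <= _)%N]expn1 leq_pexp2l.
Qed.

Definition cube x r : set (N.-tuple R) := [set y | forall i, `|tnth x i - tnth y i| <= r].

Lemma mf_tnth i : mfun (fun x : N.-tuple R => tnth x i).
Proof. exact: measurable_tnth. Qed.

Lemma measurable_cube x r : measurable (cube x r).
Proof.
have -> : cube x r = \bigcap_(i in [set: 'I_N]) [set y | `|tnth x i - tnth y i| <= r].
  by apply/seteqP; split => y /= h i; [move=> _; exact: h|exact: h].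
apply: fin_bigcap_measurable => // i _.
have mf : mfun (fun y : N.-tuple R => `|tnth x i - tnth y i|).
  by have h := mf_tnth i; measf.
rewrite (_ : [set y | _] = setT `&` (fun y => `|tnth x i - tnth y i|) @^-1` `]-oo, r]).
  by apply: mf => //; exact: measurable_itv.
by apply/seteqP; split => y /=; rewrite in_itv /=; [split|case].
Qed.

(** Openness is expressed by [edist], the sigma-algebra is the product one. Cubes with rational
    centre and radius link them: an open set is the union of the countably many it contains. *)
Lemma eopen_measurable A : eopen A -> measurable A.
Proof.
move=> oA.
pose q (z : N.-tuple rat * rat) : set (N.-tuple R) :=
  cube [tuple ratr (tnth z.1 i) | i < N] (ratr z.2).
pose G := [set z | q z `<=` A].
have -> : A = \bigcup_(z in G) q z.
  apply/seteqP; split => x; last by move=> [z Gz qz]; exact: Gz.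
  move=> Ax; have [e e0 he] := oA x Ax.
  have N1 : 0 < N%:R + 1 :> R by rewrite ltr_wpDl.
  (* In a cube of radius below [s] containing x, all points are within 2 s of x in each coordinate,
     hence at distance at most 2 N s < e. *)
  pose s := e / (2 * (N%:R + 1)).
  have s0 : 0 < s by rewrite divr_gt0 // mulr_gt0.
  have [rr] := @rat_in_itvoo R 0 s s0; rewrite in_itv /= => /andP[rr0 rrs].
  have /choice[c hc] i : exists qi : rat, `|ratr qi - tnth x i| <= ratr rr.
    have lt : tnth x i - ratr rr < tnth x i + ratr rr by lra.
    have [qi] := rat_in_itvoo lt; rewrite in_itv /= => /andP[h1 h2].
    by exists qi; rewrite ler_norml; apply/andP; split; lra.
  exists ([tuple c i | i < N], rr); last by move=> i; rewrite tnth_mktuple /= tnth_mktuple.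
  move=> y qy; apply: he.
  apply: (@le_lt_trans _ _ (N%:R * (2 * ratr rr))).
    apply: edist_le; first by lra.
    move=> i; have := qy i; rewrite tnth_mktuple /= tnth_mktuple => h1.
    have := hc i; rewrite distrC => h2.
    have -> : tnth x i - tnth y i = (tnth x i - ratr (c i)) + (ratr (c i) - tnth y i) by ring.
    by apply: le_trans (ler_normD _ _) _; lra.
  have h : N%:R * (2 * ratr rr) <= N%:R * (2 * s).
    by apply: ler_wpM2l => //; lra.
  apply: le_lt_trans h _; rewrite /s.
  rewrite (_ : N%:R * _ = e * (N%:R / (N%:R + 1))); last by field; rewrite gt_eqF.
  by rewrite gtr_pMr // ltr_pdivrMr // mul1r ltrDl.
rewrite bigcup_mkcond; apply: countable_bigcupT_measurable => // z.
by case: ifP => _; [exact: measurable_cube|exact: measurable0].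
Qed.

Lemma econt_measurable (f : N.-tuple R -> R) : econt f -> mfun f.
Proof.
move=> cf; apply: (measurability _ (RGenOInfty.measurableE R)) => _ [_ [a ->] <-].
rewrite setTI; apply: eopen_measurable => x /=; rewrite in_itv /= andbT => ax.
have e0 : 0 < f x - a by lra.
have [dd d0 hd] := cf x _ e0; exists dd => // y /hd.
by rewrite ltr_norml => /andP[h1 h2]; rewrite /= in_itv /= andbT; lra.
Qed.

Lemma mf_sqrt {d : measure_display} {T : measurableType d} (f : T -> R) :
  mfun f -> (forall z, 0 <= f z) -> mfun (fun z => Num.sqrt (f z)).
Proof.
move=> mf f0; rewrite (_ : (fun z => _) = (fun z => f z `^ 2^-1)); first by measf.
by apply/funext => z; rewrite powR12_sqrt.
Qed.

Lemma mf_edist2 : mfun (fun z : N.-tuple R * N.-tuple R => edist z.1 z.2).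
Proof.
apply: mf_sqrt; last by move=> z; apply: sumr_ge0 => i _; exact: sqr_ge0.
apply: measurable_sum => i; apply: measurable_funX.
have h := mf_tnth i.
by apply: mf_D; [exact: (mf_fst h)|apply: mf_N; exact: (mf_snd h)].
Qed.

Lemma mf_edist x : mfun (fun y => edist x y).
Proof.
apply: mf_sqrt; last by move=> z; apply: sumr_ge0 => i _; exact: sqr_ge0.
by apply: measurable_sum => i; apply: measurable_funX; have h := mf_tnth i; measf.
Qed.

Lemma mf_enorm : mfun (@enorm R N).
Proof.
by rewrite (_ : @enorm R N = edist zero_tuple); [exact: mf_edist|apply/funext => x; exact: enormE].
Qed.

End euclidean_tuples.

(** * Volumes of cubes and integrals of powers of the distance *)

Section cube_volume.
Context {R : realType}.

Lemma iint_cube n (x : n.-tuple R) (r : R) : 0 <= r ->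
  iint (fun y => (\prod_(i < n) \1_[set t : R | `|tnth x i - t| <= r] (tnth y i))%:E)
  = ((2 * r) ^+ n)%:E.
Proof.
move=> r0; elim: n x => [|n ih] x /=; first by rewrite big_ord0 expr0.
pose x' : n.-tuple R := [tuple of behead x].
pose a (t : R) : R := \1_[set t : R | `|tnth x ord0 - t| <= r] t.
pose P (y : n.-tuple R) : R := \prod_(i < n) \1_[set t : R | `|tnth x' i - t| <= r] (tnth y i).
have mP : measurable_fun setT P.
  apply: measurable_prod => i _; apply: (measurableT_comp (measurable_indic _)); last first.
    exact: measurable_tnth.
  rewrite (_ : [set t | _] = [set` `[tnth x' i - r, tnth x' i + r]]).
    exact: measurable_itv.
  apply/seteqP; split => t /=; rewrite in_itv /= ler_distlC; move=> /andP[? ?];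
    by apply/andP; split; lra.
have P0 y : 0 <= P y by apply: prodr_ge0.
transitivity (\int[@lebesgue_measure R]_t ((a t)%:E * ((2 * r) ^+ n)%:E))%E.
  apply: eq_integral => t _; rewrite -(ih x').
  rewrite (iintE (proj2 (measurable_EFinP _ _) mP)) => [|y]; last by rewrite lee_fin.
  rewrite -ge0_integralZl_EFin //; last 2 first.
    by move=> y _; rewrite lee_fin.
    exact/measurable_EFinP.
  rewrite -iintE; last 2 first.
    by apply: emeasurable_funM => //; exact/measurable_EFinP.
    by move=> y; rewrite -EFinM lee_fin mulr_ge0.
  congr iint; apply/funext => y; rewrite big_ord_recl EFinM; congr (_ * _)%E.
  congr EFin; apply: eq_bigr => i _.
  by rewrite tnthS [in X in \1_X](tuple_eta x) tnthS.
have aE : a = \1_[set` `[tnth x ord0 - r, tnth x ord0 + r]].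
  congr indic; apply/seteqP; split => t /=; rewrite in_itv /= ler_distlC => /andP[? ?];
    by apply/andP; split; lra.
under eq_integral do rewrite muleC.
rewrite aE ge0_integralZl_EFin //; last 2 first.
- by apply/measurable_EFinP; apply: measurable_indic; exact: measurable_itv.
- by rewrite exprn_ge0 // mulr_ge0.
have v : @lebesgue_measure R [set` `[tnth x ord0 - r, tnth x ord0 + r]] = (2 * r)%:E.
  rewrite lebesgue_measure_itv /= lte_fin.
  have [h|h] := ltP (tnth x ord0 - r) (tnth x ord0 + r).
    by rewrite -EFinB; congr EFin; ring.
  by rewrite (_ : r = 0) ?mulr0 //; lra.
rewrite integral_indic // setIT exprSr EFinM; congr (_ * _)%E; exact: v.
Qed.

Lemma muN_cube n (x : n.-tuple R) (r : R) : 0 <= r ->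
  muN n (cube x r) = ((2 * r) ^+ n)%:E.
Proof.
move=> r0; rewrite -(iint_cube x r0).
have mc := measurable_cube x r.
have -> : muN n (cube x r) = (\int[muN n]_y (\1_(cube x r) y)%:E)%E.
  by rewrite integral_indic // setIT.
rewrite -iintE; last 2 first.
- by apply/measurable_EFinP; exact: measurable_indic.
- by move=> y; rewrite lee_fin.
congr iint; apply/funext => y; congr EFin.
have [h|h] := pselect (cube x r y).
  rewrite indicE mem_set // big1 // => i _.
  by rewrite indicE mem_set //=; exact: h.
rewrite indicE memNset //; move: h => /existsNP[i hi].
by rewrite (bigD1 i) //= indicE memNset // mul0r.
Qed.

Variable N : nat.
Implicit Types x y : N.-tuple R.

Lemma cube_edist x y r : edist x y <= r -> cube x r y.
Proof. by move=> h i; exact: le_trans (edist_coord x y i) h. Qed.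

(** A substitute for polar coordinates: F is dominated by the sum of the constants c_j on cubes of
    radius r_j, and the volumes (2 r_j)^N turn this into a geometric series of ratio [th]. *)
Lemma dyadic_bound x (F : N.-tuple R -> R) (c r : nat -> R) (B th : R) :
  measurable_fun setT F -> (forall y, 0 <= F y) -> (forall j, 0 <= c j) ->
  (forall j, 0 <= r j) -> 0 <= B -> 0 <= th < 1 ->
  (forall j, c j * (2 * r j) ^+ N <= B * th ^+ j) ->
  (forall y, F y = 0 \/ exists j, cube x (r j) y /\ F y <= c j) ->
  (\int[muN N]_y (F y)%:E <= (B / (1 - th))%:E)%E.
Proof.
move=> mF F0 c0 r0 B0 /andP[th0 th1] hB hF.
pose G j y := (c j * \1_(cube x (r j)) y)%:E.
have G0 j y : (0 <= G j y)%E by rewrite lee_fin mulr_ge0.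
have mG j : measurable_fun setT (G j).
  by apply/measurable_EFinP; apply: mf_M; [exact: mf_cst|apply: mf_indic; exact: measurable_cube].
apply: (@le_trans _ _ (\int[muN N]_y (\sum_(j <oo) G j y))%E).
  apply: ge0_le_integral; first by [].
  - by move=> y _; rewrite lee_fin.
  - exact/measurable_EFinP.
  - by apply: ge0_emeasurable_sum => [j y _ _|j _].
  - move=> y _; have [->|[j [cj hj]]] := hF y; first by apply: nneseries_ge0 => i _ _.
    apply: (@le_trans _ _ (\sum_(0 <= i < j.+1) G i y)%E); last first.
      by apply: nneseries_lim_ge => i _ _.
    rewrite big_nat_recr //=; apply: (@le_trans _ _ (G j y)); last first.
      by apply: leeDr; apply: sume_ge0 => i _.
    by rewrite lee_fin indicE mem_set // mulr1.
rewrite integral_nneseries //.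
apply: (@le_trans _ _ (\sum_(j <oo) (B * th ^+ j)%:E)%E).
  apply: lee_nneseries => j *; first exact: integral_ge0.
  rewrite /G; under eq_integral do rewrite EFinM.
  rewrite ge0_integralZl_EFin //; last first.
    by apply/measurable_EFinP; apply: measurable_indic; exact: measurable_cube.
  rewrite integral_indic //; last exact: measurable_cube.
  rewrite setIT; apply: (@le_trans _ _ ((c j)%:E * ((2 * r j) ^+ N)%:E)%E).
    by rewrite -(muN_cube x (r0 j)).
  by rewrite -EFinM lee_fin.
have hc := @cvg_geometric_series R B th.
rewrite ger0_norm // in hc; have {}hc := hc th1.
rewrite le_eqVlt; apply/orP; left; apply/eqP; apply/cvg_lim => //.
rewrite (_ : (fun n => _) = EFin \o (series (geometric B th))).
  by apply: cvg_EFin => //; exact: nearW.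
by apply/funext => n /=; rewrite sumEFin.
Qed.

Lemma dyadic_below (D rho : R) : 0 < D -> D <= rho ->
  exists j, rho / 2 ^+ j.+1 < D /\ D <= rho / 2 ^+ j.
Proof.
move=> D0 Dr; have ex : exists j, rho / 2 ^+ j.+1 < D.
  exists (Num.bound (rho / D)); rewrite ltr_pdivrMr ?exprn_gt0 // -ltr_pdivrMl // mulrC.
  have rD : 0 <= rho / D by rewrite divr_ge0 ?(ltW D0) // (le_trans (ltW D0)).
  apply: lt_trans (archi_boundP rD) _; rewrite -natrX ltr_nat.
  by apply: (leq_ltn_trans (leqnSn _)); exact: ltn_expl.
have [k kj kmin] := ex_minnP ex; exists k; split => //.
case: k kj kmin => [|k] kj kmin; first by rewrite expr0 divr1.
rewrite leNgt; apply/negP => /kmin; by rewrite ltnn.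
Qed.

Lemma dyadic_above (D del : R) : 0 < del -> del <= D ->
  exists j, del * 2 ^+ j <= D /\ D < del * 2 ^+ j.+1.
Proof.
move=> d0 dD; have ex : exists j, D < del * 2 ^+ j.+1.
  exists (Num.bound (D / del)); rewrite -ltr_pdivrMl // mulrC.
  have rD : 0 <= D / del by rewrite divr_ge0 ?(ltW d0) // (le_trans (ltW d0)).
  apply: lt_trans (archi_boundP rD) _; rewrite -natrX ltr_nat.
  by apply: (leq_ltn_trans (leqnSn _)); exact: ltn_expl.
have [k kj kmin] := ex_minnP ex; exists k; split => //.
case: k kj kmin => [|k] kj kmin; first by rewrite expr0 mulr1.
rewrite leNgt; apply/negP => /kmin; by rewrite ltnn.
Qed.

(** Dyadic shells shrinking from rho: the power gains 2^(a j) and the volume loses 2^(N j), whence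
    the ratio 2^(a - N) < 1. The constant does not depend on x. *)
Lemma near_kernel_bound (a rho : R) : 0 <= a -> a < N%:R -> 0 < rho ->
  exists2 C : R, 0 <= C & forall x,
  (\int[muN N]_y (\1_[set y | edist x y <= rho] y * edist x y `^ (- a))%:E <= C%:E)%E.
Proof.
move=> a0 aN rho0.
pose th : R := 2 `^ (a - N%:R).
have th01 : 0 <= th < 1.
  rewrite powR_ge0 /= -(powRr0 2); rewrite /th /powR !gt_eqF // ltr_expR.
  by rewrite ltr_pM2r ?subr_lt0 // ln_gt0 //; lra.
pose B : R := (rho / 2) `^ (- a) * (2 * rho) ^+ N.
have B0 : 0 <= B by rewrite mulr_ge0 ?powR_ge0 // exprn_ge0 // mulr_ge0 // ltW.
exists (B / (1 - th)); first by rewrite divr_ge0 // subr_ge0 ltW //; case/andP: th01.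
move=> x; apply: (@dyadic_bound x _ (fun j => (rho / 2 ^+ j.+1) `^ (- a))
  (fun j => rho / 2 ^+ j)) => //.
- apply: mf_M; last by apply: mf_pow; exact: mf_edist.
  by apply: mf_indic; apply: measurable_le; exact: mf_edist.
- by move=> y; rewrite mulr_ge0 ?powR_ge0.
- by move=> j; exact: powR_ge0.
- by move=> j; rewrite divr_ge0 ?ltW // exprn_ge0.
- move=> j; rewrite le_eqVlt; apply/orP; left; apply/eqP; rewrite /B.
  have e0 : 0 < 2 ^+ j :> R by rewrite exprn_gt0.
  have thj : th ^+ j = (2 ^+ j) `^ a / (2 ^+ j) ^+ N.
    rewrite -powR_mulrn ?powR_ge0 // /th -powRrM mulrC powRrM powR_mulrn //.
    by rewrite powRB ?powR_mulrn ?(ltW e0) // (gt_eqF e0) implybT.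
  have -> : rho / 2 ^+ j.+1 = (rho / 2) * (2 ^+ j)^-1.
    by rewrite exprS invfM mulrA.
  rewrite powRM ?divr_ge0 ?invr_ge0 ?(ltW rho0) ?(ltW e0) //.
  have -> : (2 ^+ j)^-1 `^ (- a) = (2 ^+ j) `^ a :> R.
    by rewrite -powR_inv1 ?(ltW e0) // -powRrM mulN1r opprK.
  by rewrite thj mulrA exprMn exprVn; ring.
- move=> y; have [h|h] := leP (edist x y) rho; last first.
    by left; rewrite indic_out ?mul0r //= ; apply/negP; rewrite -ltNge.
  rewrite indic_in // mul1r.
  (* On the diagonal the power is 0 by convention, except for a = 0, where it is 1 and the largest
     cube accounts for it. *)
  have [D0|D0] := eqVneq (edist x y) 0.
    have [->|az] := eqVneq a 0; last by left; rewrite D0 powR0 ?oppr_eq0.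
    right; exists 0%N; split; first by rewrite expr0 divr1; exact: cube_edist.
    by rewrite oppr0 !powRr0.
  have Dp : 0 < edist x y by rewrite lt_def D0 edist_ge0.
  have [j [j1 j2]] := dyadic_below Dp h; right; exists j; split; first exact: cube_edist.
  have jp : 0 < rho / 2 ^+ j.+1 by rewrite divr_gt0 // exprn_gt0.
  rewrite !powRN lef_pV2 ?posrE ?powR_gt0 //; apply: powR_le => //; exact: ltW.
Qed.

(** The same with shells growing from del: the exponent N + b beats the volume, and the ratio is
    2^(-b). *)
Lemma far_kernel_bound (b del : R) : 0 < b -> 0 < del ->
  exists2 C : R, 0 <= C & forall x,
  (\int[muN N]_y (\1_[set y | del <= edist x y] y * edist x y `^ (- (N%:R + b)))%:E <= C%:E)%E.
Proof.
move=> b0 del0.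
pose th : R := 2 `^ (- b).
have th01 : 0 <= th < 1.
  rewrite powR_ge0 /= /th powRN invf_lt1 ?powR_gt0 //.
  by have := @powR_lt R b 1 2 b0; rewrite powR1; apply; lra.
pose B : R := del `^ (- (N%:R + b)) * (4 * del) ^+ N.
have B0 : 0 <= B by rewrite mulr_ge0 ?powR_ge0 // exprn_ge0 // mulr_ge0 // ltW.
exists (B / (1 - th)); first by rewrite divr_ge0 // subr_ge0 ltW //; case/andP: th01.
move=> x; apply: (@dyadic_bound x _ (fun j => (del * 2 ^+ j) `^ (- (N%:R + b)))
  (fun j => del * 2 ^+ j.+1)) => //.
- apply: mf_M; last by apply: mf_pow; exact: mf_edist.
  by apply: mf_indic; apply: measurable_ge; exact: mf_edist.
- by move=> y; rewrite mulr_ge0 ?powR_ge0.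
- by move=> j; exact: powR_ge0.
- by move=> j; rewrite mulr_ge0 ?ltW // exprn_gt0.
- move=> j; rewrite le_eqVlt; apply/orP; left; apply/eqP; rewrite /B.
  have e0 : 0 < 2 ^+ j :> R by rewrite exprn_gt0.
  have thj : th ^+ j = (2 ^+ j) `^ (- (N%:R + b)) * (2 ^+ j) ^+ N.
    rewrite -powR_mulrn ?powR_ge0 // /th -powRrM mulrC powRrM powR_mulrn //.
    rewrite -[(_ ^+ N)]powR_mulrn ?(ltW e0) // -powRD ?(gt_eqF e0) ?implybT //.
    by congr (_ `^ _); ring.
  rewrite powRM ?(ltW del0) ?(ltW e0) // thj exprS.
  rewrite (_ : 2 * (del * (2 * 2 ^+ j)) = 4 * del * 2 ^+ j); last by ring.
  by rewrite exprMn; ring.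
- move=> y; have [h|h] := leP del (edist x y); last first.
    by left; rewrite indic_out ?mul0r //= ; apply/negP; rewrite -ltNge.
  rewrite indic_in // mul1r.
  have [j [j1 j2]] := dyadic_above del0 h; right; exists j.
  split; first by apply: cube_edist; exact: ltW.
  have jp : 0 < del * 2 ^+ j by rewrite mulr_gt0 // exprn_gt0.
  have Dp : 0 < edist x y by exact: lt_le_trans jp j1.
  rewrite !powRN lef_pV2 ?posrE ?powR_gt0 //; apply: powR_le => //; last exact: ltW.
  by rewrite addr_ge0 // ltW.
Qed.

End cube_volume.

(** * Calculus of smooth functions on tuples *)

Section smooth_calculus.
Context {R : realType} {N : nat}.
Implicit Types (f g : N.-tuple R -> R) (x y : N.-tuple R).

(** Neighbourhood filter of the Euclidean distance: [econt] becomes convergence along it, and the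
    limit rules for sums, products and compositions apply. *)
Definition enbhs x : set_system (N.-tuple R) :=
  filter_from [set r : R | 0 < r] (fun r => [set y | edist x y < r]).

Global Instance enbhs_filter x : Filter (enbhs x).
Proof.
apply: filter_from_filter; first by exists 1 => /=.
move=> r1 r2 /= r10 r20; exists (Num.min r1 r2) => /=; first by rewrite lt_min r10.
by move=> y /=; rewrite lt_min => /andP[].
Qed.

Lemma econtP f : econt f <-> forall x, f y @[y --> enbhs x] --> f x.
Proof.
split=> [cf x|cf x e e0].
  apply/cvgrPdist_lt => e e0; have [r r0 hr] := cf x _ e0.
  by exists r.
by have /cvgrPdist_lt/(_ _ e0)[r r0 hr] := cf x; exists r.
Qed.

Lemma econt_D f g : econt f -> econt g -> econt (fun x => f x + g x).
Proof.
by move=> /econtP cf /econtP cg; apply/econtP => x; apply: cvgD; [exact: cf|exact: cg].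
Qed.

Lemma econt_M f g : econt f -> econt g -> econt (fun x => f x * g x).
Proof.
by move=> /econtP cf /econtP cg; apply/econtP => x; apply: cvgM; [exact: cf|exact: cg].
Qed.

Lemma econt_comp (psi : R -> R) f : continuous psi -> econt f -> econt (psi \o f).
Proof.
move=> cpsi /econtP cf; apply/econtP => x.
by apply: (@continuous_cvg _ _ _ (enbhs x) _ f psi); [exact: cpsi|exact: cf].
Qed.

Lemma upd_id x i : upd x i (tnth x i) = x.
Proof. by apply: eq_from_tnth => j; rewrite tnth_mktuple; case: eqP => [->|]. Qed.

Lemma upd_upd x i t t' : upd (upd x i t) i t' = upd x i t'.
Proof. by apply: eq_from_tnth => j; rewrite !tnth_mktuple; case: eqP. Qed.

Lemma tnth_upd x i t : tnth (upd x i t) i = t.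
Proof. by rewrite tnth_mktuple eqxx. Qed.

Local Notation pdable i f :=
  (forall x, derivable (fun t : R => f (upd x i t)) (tnth x i) 1).

Lemma pderiv_is_derive i f x : pdable i f ->
  is_derive (tnth x i) 1 (fun t : R => f (upd x i t)) (pderiv i f x).
Proof. by move=> h; split; [exact: h|rewrite /pderiv derive1E]. Qed.

Lemma pderiv_val i f x (l : R) :
  is_derive (tnth x i) 1 (fun t : R => f (upd x i t)) l -> pderiv i f x = l.
Proof. by move=> h; rewrite /pderiv derive1E derive_val. Qed.

Lemma pderivD i f g : pdable i f -> pdable i g ->
  pdable i (fun x => f x + g x) /\
  pderiv i (fun x => f x + g x) = (fun x => pderiv i f x + pderiv i g x).
Proof.
move=> df dg; have h x := is_deriveD (pderiv_is_derive x df) (pderiv_is_derive x dg).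
by split=> [x|]; [have [] := h x|apply/funext => x; exact: pderiv_val].
Qed.

Lemma pderivM i f g : pdable i f -> pdable i g ->
  pdable i (fun x => f x * g x) /\
  pderiv i (fun x => f x * g x) = (fun x => f x * pderiv i g x + g x * pderiv i f x).
Proof.
move=> df dg; have h x := is_deriveM (pderiv_is_derive x df) (pderiv_is_derive x dg).
split=> [x|]; first by have [] := h x.
by apply/funext => x; have := @pderiv_val i (fun x => f x * g x) x _ (h x); rewrite upd_id.
Qed.

Lemma pderiv_comp i (psi dpsi : R -> R) f :
  (forall t : R, is_derive t 1 psi (dpsi t)) -> pdable i f ->
  pdable i (psi \o f) /\ pderiv i (psi \o f) = (fun x => dpsi (f x) * pderiv i f x).
Proof.
move=> dp df; have dp' t : derivable psi t 1 by have [] := dp t.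
split=> [x|].
  apply/derivable1_diffP; apply: (@differentiable_comp _ _ _ _ (fun t => f (upd x i t)) psi).
    by apply/derivable1_diffP; exact: df.
  by apply/derivable1_diffP.
apply/funext => x; rewrite {1}/pderiv.
have := @derive1_comp _ (fun t => f (upd x i t)) psi (tnth x i) (df x) (dp' _).
rewrite /comp => ->; rewrite upd_id; congr (_ * _).
by rewrite derive1E; have [_ ->] := dp (f x).
Qed.

Lemma CkW k f : Ck k.+1 f -> Ck k f.
Proof.
elim: k f => [|k ih] f [cf h] //; split => // i; have [h1 h2] := h i.
by split => //; exact: ih.
Qed.

Lemma Ck_D k f g : Ck k f -> Ck k g -> Ck k (fun x => f x + g x).
Proof.
elim: k f g => [|k ih] f g; first exact: econt_D.
move=> [cf hf] [cg hg]; split; first exact: econt_D.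
move=> i; have [df kf] := hf i; have [dg kg] := hg i.
by have [h ->] := pderivD df dg; split => //; exact: ih.
Qed.

Lemma Ck_M k f g : Ck k f -> Ck k g -> Ck k (fun x => f x * g x).
Proof.
elim: k f g => [|k ih] f g; first exact: econt_M.
move=> Cf Cg; have kf' := CkW Cf; have kg' := CkW Cg.
move: Cf Cg => [cf hf] [cg hg]; split; first exact: econt_M.
move=> i; have [df kf] := hf i; have [dg kg] := hg i.
by have [h ->] := pderivM df dg; split => //; apply: Ck_D; exact: ih.
Qed.

Lemma Ck_cst k (c : R) : Ck k (fun _ : N.-tuple R => c).
Proof.
have cc b : econt (fun _ : N.-tuple R => b : R).
  by move=> x e e0; exists 1 => // y _; rewrite subrr normr0.
elim: k c => [|k ih] c; first exact: cc.
split => // i.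
have h x : is_derive (tnth x i) 1 (fun _ : R => c) 0 by exact: is_derive_cst.
split=> [x|]; first by have [] := h x.
rewrite (_ : pderiv i _ = fun=> 0); first exact: ih.
by apply/funext => x; exact: pderiv_val (h x).
Qed.

(** The hypothesis on [dpsi] is required one order lower only, so it can be met by induction even
    when [dpsi] is expressed through [psi] itself, as for the sigmoid. *)
Lemma Ck_comp k (psi dpsi : R -> R) f : (forall t : R, is_derive t 1 psi (dpsi t)) ->
  (forall j, j.+1 = k -> Ck j f -> Ck j (dpsi \o f)) -> Ck k f -> Ck k (psi \o f).
Proof.
move=> dp hd.
have cpsi : continuous psi.
  move=> t; apply: differentiable_continuous; apply/derivable1_diffP.
  by have [] := dp t.
case: k hd => [|k] hd; first exact: econt_comp.
move=> Cf; have kf' := CkW Cf; move: Cf => [cf hf]; split; first exact: econt_comp.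
move=> i; have [df kf] := hf i; have [h ->] := pderiv_comp dp df.
by split => //; apply: Ck_M => //; exact: hd.
Qed.

End smooth_calculus.

(** * A smooth approximation of the cut *)

Section softplus.
Context {R : realType}.
Variables (m k : R).
Hypothesis m0 : 0 < m.

Definition sigmoid (t : R) : R := 1 - (1 + expR (m * (t - k)))^-1.
(** Smooth version of max(t - k, 0), sharper as m grows. The subtracted constant makes the value at
    0 vanish, so composition with it preserves compact supports. *)
Definition softplus (t : R) : R := ln (1 + expR (m * (t - k))) / m - ln (1 + expR (- (m * k))) / m.

Let ex0 t : 0 < 1 + expR (m * (t - k)).
Proof. by rewrite addr_gt0 // expR_gt0. Qed.

Let is_derive_ex (t : R) :
  is_derive t 1 (fun t : R => 1 + expR (m * (t - k))) (m * expR (m * (t - k))).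
Proof.
have h : is_derive t 1 (fun t : R => m * (t - k)) m.
  have -> : (fun t : R => m * (t - k)) = m *: (id - cst k) by [].
  by apply: is_derive_eq; rewrite subr0; exact: mulr1.
have e := @derive1_comp _ (fun t : R => m * (t - k)) expR t ltac:(by case: h) ltac:(exact: derivable_expR).
have d : derivable (expR \o (fun t : R => m * (t - k))) t 1.
  apply/derivable1_diffP; apply: differentiable_comp; apply/derivable1_diffP.
    by case: h.
  exact: derivable_expR.
have h2 : is_derive t 1 (expR \o (fun t : R => m * (t - k))) (m * expR (m * (t - k))).
  split => //; rewrite -derive1E e mulrC; congr (_ * _).
    by rewrite derive1E; case: h.
  by rewrite derive1E; have [_ ->] := is_derive_expR (m * (t - k)).
have := is_deriveD (is_derive_cst (1 : R) t 1) h2.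
by rewrite add0r.
Qed.

Lemma is_derive_softplus (t : R) : is_derive t 1 softplus (sigmoid t).
Proof.
have h := is_derive_ex t.
have hl := is_derive1_ln (ex0 t).
have d : derivable (@ln R \o (fun t : R => 1 + expR (m * (t - k)))) t 1.
  apply/derivable1_diffP; apply: differentiable_comp; apply/derivable1_diffP.
    by case: h.
  by case: hl.
have h2 : is_derive t 1 (@ln R \o (fun t : R => 1 + expR (m * (t - k))))
    ((1 + expR (m * (t - k)))^-1 * (m * expR (m * (t - k)))).
  split => //; rewrite -derive1E derive1_comp; [|by case: h|by case: hl].
  by rewrite !derive1E; case: h => _ ->; case: hl => _ ->.
have := is_deriveB (is_deriveZ m^-1 h2) (is_derive_cst (ln (1 + expR (- (m * k))) / m) t 1).
have -> : m^-1 *: (@ln R \o (fun t : R => 1 + expR (m * (t - k)))) - cst (ln (1 + expR (- (m * k))) / m) = softplus.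
  by apply/funext => u; rewrite /softplus [X in _ = X - _]mulrC.
rewrite (_ : _ - 0 = sigmoid t) //.
rewrite subr0 /sigmoid; have := ex0 t; move: (expR _) => a a0.
have a1 : 1 + a != 0 by rewrite gt_eqF.
have m1 : m != 0 by rewrite gt_eqF.
by rewrite /GRing.scale /=; field; rewrite m1 a1.
Qed.

(** The logistic equation: derivatives of every order are polynomials in the sigmoid, which gives
    smoothness by induction on the order. *)
Lemma is_derive_sigmoid (t : R) :
  is_derive t 1 sigmoid (m * (sigmoid t + -1 * (sigmoid t * sigmoid t))).
Proof.
have h := is_derive_ex t.
have a0 := ex0 t.
have a1 : 1 + expR (m * (t - k)) != 0 by rewrite gt_eqF.
have hv : is_derive t 1 (fun u : R => (1 + expR (m * (u - k)))^-1) (- (1 + expR (m * (t - k))) ^- 2 *: (m * expR (m * (t - k)))) by exact: is_deriveV.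
have := is_deriveB (is_derive_cst (1 : R) t 1) hv.
rewrite (_ : cst 1 - _ = sigmoid) //.
move=> h'; apply: is_derive_eq h' _.
rewrite /sigmoid; move: (expR _) a1 => a a1.
by rewrite /GRing.scale /=; field.
Qed.

Lemma softplus0 : softplus 0 = 0.
Proof. by rewrite /softplus sub0r mulrN subrr. Qed.

Lemma sigmoid_bound t : 0 <= sigmoid t <= 1.
Proof.
rewrite /sigmoid; have := ex0 t; have : 0 < expR (m * (t - k)) by exact: expR_gt0.
move: (expR _) => a a0 a1.
have : (1 + a)^-1 <= 1 by rewrite invf_le1 //; lra.
have : 0 <= (1 + a)^-1 by rewrite invr_ge0 ltW.
by move=> ? ?; apply/andP; split; lra.
Qed.

Lemma softplus_lip a b : `|softplus a - softplus b| <= `|a - b|.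
Proof.
wlog ab : a b / b <= a.
  move=> hw; have [ba|/ltW ab] := leP b a; first exact: hw.
  by rewrite distrC [leRHS]distrC; exact: hw.
have [|c _ ->] := @MVT_segment _ softplus sigmoid b a ab (fun t _ => is_derive_softplus t).
  by apply: derivable_within_continuous => t _; have [] := is_derive_softplus t.
have /andP[s0 s1] := sigmoid_bound c.
by rewrite normrM ler_piMl // ger0_norm.
Qed.

(** ln(1 + exp x) lies between max(x, 0) and max(x, 0) + ln 2. This is applied at m (t - k) and at
    -m k, where the positive part is 0 since k >= 0. *)
Lemma softplus_dist (t : R) : 0 <= k ->
  `|softplus t - Num.max (t - k) 0| <= 2 * ln 2 / m.
Proof.
move=> k0.
have l2 : 0 <= ln 2 :> R by rewrite ln_ge0 //; lra.
have key (x : R) : Num.max x 0 <= ln (1 + expR x) <= Num.max x 0 + ln 2.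
  have e0 := expR_gt0 x; apply/andP; split.
    have [x0|x0] := leP x 0; first by rewrite ln_ge0 //; lra.
    by rewrite -{1}[x]expRK ler_ln ?posrE //; lra.
  have [x0|x0] := leP x 0.
    have e1 : expR x <= 1 by rewrite -expR0 ler_expR.
    by rewrite add0r ler_ln ?posrE; lra.
  have e1 : 1 <= expR x by rewrite -expR0 ler_expR ltW.
  by rewrite -{2}[x]expRK -lnM ?posrE // ?ler_ln ?posrE; lra.
have /andP[a1 a2] := key (m * (t - k)).
have /andP[b1 b2] := key (- (m * k)).
have mx : Num.max (m * (t - k)) 0 = m * Num.max (t - k) 0.
  by rewrite maxr_pMr ?mulr0 // ltW.
have mk0 : Num.max (- (m * k)) 0 = 0 :> R by apply: max_r; rewrite oppr_le0 mulr_ge0 // ltW.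
rewrite mx in a1 a2; rewrite mk0 in b1 b2.
rewrite /softplus -mulrBl ler_norml.
have -> : (ln (1 + expR (m * (t - k))) - ln (1 + expR (- (m * k)))) / m - Num.max (t - k) 0
  = (ln (1 + expR (m * (t - k))) - ln (1 + expR (- (m * k))) - m * Num.max (t - k) 0) / m.
  by field; rewrite gt_eqF.
rewrite -mulNr ler_pM2r ?invr_gt0 // ler_pM2r ?invr_gt0 //.
move: a1 a2 b1 b2 l2; move: (ln _) (ln _) (ln _) (m * _) => a b c e *.
by apply/andP; split; lra.
Qed.

Lemma Ck_softplus {N : nat} j (f : N.-tuple R -> R) : Ck j f -> Ck j (softplus \o f).
Proof.
have hs i : forall f : N.-tuple R -> R, Ck i f -> Ck i (sigmoid \o f).
  elim: i => [|i ih] h; apply: (Ck_comp is_derive_sigmoid) => // i' [->] Ch.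
  have Cs := ih _ Ch.
  apply: (@Ck_M _ _ i (fun _ => m)); first exact: Ck_cst.
  apply: (Ck_D Cs); apply: (@Ck_M _ _ i (fun _ => -1)); first exact: Ck_cst.
  exact: (Ck_M Cs Cs).
by apply: (Ck_comp is_derive_softplus) => i _ /hs.
Qed.

End softplus.

(** * Test functions with compact support in O *)

Section compactly_supported.
Context {R : realType} {N : nat}.
Variable O : set (N.-tuple R).
Implicit Types (f g phi : N.-tuple R -> R) (x y : N.-tuple R).

(** Tuples are read as row vectors, where a box containing O is compact and the extreme value
    theorem applies. *)
Lemma econt_bounded f : ebounded O -> (forall x, ~ O x -> f x = 0) -> econt f ->
  exists2 B : R, 0 <= B & forall x, `|f x| <= B.
Proof.
move=> [M hM] fO cf.
pose tup (v : 'rV[R]_N) : N.-tuple R := [tuple v ord0 i | i < N].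
pose A : set 'rV[R]_N := [set v | forall i, `[- `|M|, `|M|]%classic (v ord0 i)].
have cA : compact A.
  exact: (@rV_compact R N (fun=> `[- `|M|, `|M|]%classic) (fun=> @segment_compact _ _ _)).
have cF : continuous (fun v => `|f (tup v)|).
  move=> v; have ct : tup w @[w --> v] `=>` enbhs (tup v).
    move=> P [r /= r0 hr]; apply/nbhs_ballP; exists (r / (N%:R + 1)) => /=.
      by rewrite divr_gt0 // ltr_pwDr.
    move=> w [_ hw]; apply: hr => /=.
    apply: (@le_lt_trans _ _ (N%:R * (r / (N%:R + 1)))).
      apply: edist_le; first by rewrite divr_ge0 ?ltW // ltr_pwDr.
      by move=> i; rewrite !tnth_mktuple; apply: ltW; have := hw ord0 i.
    by rewrite mulrCA gtr_pMr // ltr_pdivrMr ?mul1r ?ltrDl // ltr_pwDr.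
  have c : f (tup w) @[w --> v] --> f (tup v) by exact: (cvg_comp _ _ ct (proj1 (econtP f) cf (tup v))).
  exact: (cvg_norm c).
have A0 : A !=set0.
  by exists 0 => i /=; rewrite mxE in_itv /= oppr_le0 normr_ge0.
have [c _ hc] := EVT_max_rV A0 cA (continuous_subspaceT cF).
exists `|f (tup c)| => // x.
have [Ox|nOx] := pselect (O x); last by rewrite fO // normr0.
have -> : x = tup (\row_i tnth x i) by apply: eq_from_tnth => i; rewrite tnth_mktuple mxE.
apply: hc; rewrite inE => i /=; rewrite mxE in_itv /= -ler_norml.
apply: le_trans (le_trans (hM _ Ox) (ler_norm M)).
by have := edist_coord (zero_tuple (R := R)) x i; rewrite -enormE tnth_mktuple sub0r normrN.
Qed.

(** Coordinates of x are exchanged for those of y one at a time, so the one-variable mean value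
    theorem applies N times. *)
Lemma pderiv_lipschitz f (B : R) : 0 <= B ->
  (forall i x, derivable (fun t => f (upd x i t)) (tnth x i) 1) ->
  (forall i x, `|pderiv i f x| <= B) ->
  forall x y, `|f x - f y| <= N%:R * B * edist x y.
Proof.
move=> B0 df hB x y.
pose z k : N.-tuple R := [tuple if (j < k)%N then tnth y j else tnth x j | j < N].
have z0 : z 0%N = x by apply: eq_from_tnth => j; rewrite tnth_mktuple.
have zN : z N = y by apply: eq_from_tnth => j; rewrite tnth_mktuple ltn_ord.
have step (k : 'I_N) : `|f (z k.+1) - f (z k)| <= B * edist x y.
  pose h (t : R) := f (upd (z k) k t).
  have zk : z k = upd (z k) k (tnth x k).
    apply: eq_from_tnth => j; rewrite !tnth_mktuple.
    by case: eqP => [->|//]; rewrite ltnn.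
  have zk1 : z k.+1 = upd (z k) k (tnth y k).
    apply: eq_from_tnth => j; rewrite !tnth_mktuple ltnS leq_eqVlt.
    by rewrite (inj_eq val_inj); case: eqP => [->|//].
  have dh (t : R) : is_derive t 1 h (pderiv k f (upd (z k) k t)).
    have := pderiv_is_derive (upd (z k) k t) (df k); rewrite tnth_upd.
    by rewrite (_ : (fun t' : R => f (upd (upd (z k) k t) k t')) = h) //;
       apply/funext => t'; rewrite upd_upd.
  have lip (a b : R) : `|h a - h b| <= B * `|a - b|.
    wlog ab : a b / b <= a.
      move=> hw; have [ba|/ltW ab] := leP b a; first exact: hw.
      by rewrite distrC [`|a - b|]distrC; exact: hw.
    have [|c _ ->] := @MVT_segment _ h _ b a ab (fun t _ => dh t).
      by apply: derivable_within_continuous => t _; have [] := dh t.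
    by rewrite normrM ler_wpM2r.
  rewrite zk1 zk -[upd (upd _ _ _) _ _]/(upd _ _ _) upd_upd.
  apply: le_trans (lip _ _) _; rewrite ler_wpM2l // distrC; exact: edist_coord.
have -> : `|f x - f y| = `|\sum_(0 <= k < N) (f (z k.+1) - f (z k))|.
  by rewrite (telescope_sumr (fun k => f (z k))) // z0 zN distrC.
rewrite big_mkord.
apply: le_trans (ler_norm_sum _ _ _) _.
apply: (@le_trans _ _ (\sum_(k < N) B * edist x y)); first by apply: ler_sum => k _; exact: step.
by rewrite sumr_const card_ord -[leLHS]mulr_natl mulrA.
Qed.

Lemma Ccinf_off phi x : Ccinf O phi -> ~ O x -> phi x = 0.
Proof.
move=> [_ [dd d0 hd]] nOx; apply/eqP; apply: contra_notT nOx => h.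
by apply: hd h _ _; rewrite edist_xx.
Qed.

Lemma Ccinf_meas phi : Ccinf O phi -> meas phi.
Proof. by move=> [/(_ 0%N)/= h _]; exact: econt_measurable. Qed.

Lemma Ccinf_lipschitz phi : ebounded O -> Ccinf O phi ->
  exists2 L : R, 0 <= L &
    (forall x, `|phi x| <= L) /\ forall x y, `|phi x - phi y| <= L * edist x y.
Proof.
move=> bO Cphi; have phi0 x := @Ccinf_off phi x Cphi.
have [sphi [dd d0 hd]] := Cphi.
have [B B0 hB] := econt_bounded bO phi0 (sphi 0%N).
have [_ h1] := sphi 1%N.
(* A nonzero value of phi within distance [dd] of a point would put that point in O, so phi vanishes
   near every point outside O. The partial derivatives vanish there too, and the boundedness lemma
   applies to them. *)
have dz i x : ~ O x -> pderiv i phi x = 0.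
  move=> nOx; apply: pderiv_val.
  have e : {near tnth x i, (cst 0 : R -> R) =1 (fun t : R => phi (upd x i t))}.
    near=> t => /=; apply/esym/eqP; apply: contra_notT nOx => /hd; apply.
    apply: (@le_lt_trans _ _ (N%:R * `|t - tnth x i|)).
      apply: edist_le => // j; rewrite !tnth_mktuple.
      by case: eqP => [->//|_]; rewrite subrr normr0.
    rewrite mulrC; near: t.
    have c : (fun t : R => `|t - tnth x i| * N%:R) t @[t --> tnth x i] --> (0 : R).
      rewrite [X in _ --> X](_ : 0 = `|tnth x i - tnth x i| * N%:R); last by rewrite subrr normr0 mul0r.
      apply: cvgM; last exact: cvg_cst.
      by apply: cvg_norm; apply: cvgB; [exact: cvg_id|exact: cvg_cst].
    exact: (cvgr_lt _ c).
  by have := is_derive_cst (0 : R) (tnth x i) 1; apply: near_eq_is_derive => //; rewrite oner_eq0.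
have hb i : exists2 Bi : R, 0 <= Bi & forall x, `|pderiv i phi x| <= Bi.
  by apply: (econt_bounded bO (dz i)); have [] := h1 i.
have [Bs hBs] : exists Bs : R, 0 <= Bs /\ forall i x, `|pderiv i phi x| <= Bs.
  have /choice[b hb'] : forall i, exists Bi : R, 0 <= Bi /\ forall x, `|pderiv i phi x| <= Bi.
    by move=> i; have [b ? ?] := hb i; exists b.
  exists (\sum_i b i); split; first by apply: sumr_ge0 => i _; have [] := hb' i.
  move=> i x; have [_ h] := hb' i; apply: le_trans (h x) _.
  by rewrite (bigD1 i) //= lerDl; apply: sumr_ge0 => j _; have [] := hb' j.
have [Bs0 hBs'] := hBs.
have hl := @pderiv_lipschitz phi Bs Bs0 (fun i => (h1 i).1) hBs'.
exists (B + N%:R * Bs); first by rewrite addr_ge0 // mulr_ge0.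
have NB : 0 <= N%:R * Bs by rewrite mulr_ge0.
split=> [x|x y]; first by apply: le_trans (hB x) _; rewrite lerDl.
by apply: le_trans (hl x y) _; rewrite ler_wpM2r ?edist_ge0 // lerDr.
Unshelve. all: by end_near. Qed.

Lemma Ccinf0 : Ccinf O (fun=> 0).
Proof. by split=> [k|]; [exact: Ck_cst|exists 1 => // x; rewrite eqxx]. Qed.

Lemma CcinfD f g : Ccinf O f -> Ccinf O g -> Ccinf O (fun x => f x + g x).
Proof.
move=> [sf [r r0 hf]] [sg [r' r'0 hg]]; split=> [k|]; first exact: Ck_D.
exists (Num.min r r'); first by rewrite lt_min r0.
move=> x fg y; rewrite lt_min => /andP[h1 h2].
have [f0|f0] := eqVneq (f x) 0; last exact: hf h1.
by apply: hg h2; rewrite f0 add0r in fg.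
Qed.

Lemma CcinfZ (c : R) f : Ccinf O f -> Ccinf O (fun x => c * f x).
Proof.
move=> [sf [r r0 hf]]; split=> [k|]; first by apply: Ck_M => //; exact: Ck_cst.
exists r => // x h; apply: hf; apply: contra_neq h => ->; exact: mulr0.
Qed.

Lemma Ccinf_softplus (m k : R) f : 0 < m -> Ccinf O f -> Ccinf O (softplus m k \o f).
Proof.
move=> m0 [sf [r r0 hf]]; split=> [j|]; first exact: Ck_softplus.
by exists r => // x h; apply: hf; apply: contra_neq h => /= ->; exact: softplus0.
Qed.

End compactly_supported.

(** * Integrable weights against kernels with bounded marginals *)

Section schur_test.
Context {d : measure_display} {T : measurableType d} {R : realType}.
Variable mu : {sigma_finite_measure set T -> \bar R}.
Local Notation m2 := (mu \x mu)%E.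

Lemma schur_fst (a : T -> R) (k : T * T -> R) (C : R) : igr mu a -> (forall x, 0 <= a x) ->
  measurable_fun setT k -> (forall z, 0 <= k z) -> 0 <= C ->
  (forall x, \int[mu]_y (k (x, y))%:E <= C%:E)%E -> igr m2 (fun z => a z.1 * k z).
Proof.
move=> ia a0 mk k0 C0 hC; have ma := igr_meas ia.
apply/igr_ge0P; [by measf|by move=> z; rewrite mulr_ge0|].
rewrite fubini_tonelli1; last 2 first.
- by apply/measurable_EFinP; measf.
- by move=> z; rewrite lee_fin mulr_ge0.
have iC : igr mu (fun x => C * a x) by exact: igrZ.
apply: (@le_lt_trans _ _ (\int[mu]_x (C * a x)%:E)%E); last first.
  by rewrite EFin_Rintegral // ltry.
apply: ge0_le_integral => //.
- by move=> x _; apply: integral_ge0 => y _; rewrite lee_fin mulr_ge0.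
- apply: (@measurable_fun_fubini_tonelli_F _ _ _ _ _ mu (fun z => (a z.1 * k z)%:E)).
    by apply/measurable_EFinP; measf.
  by move=> z; rewrite lee_fin mulr_ge0.
- by apply/measurable_EFinP; measf.
move=> x _; rewrite /fubini_F /=; under eq_integral do rewrite EFinM.
have mkx : measurable_fun setT (fun y => k (x, y)).
  by apply: (measurableT_comp mk); exact: measurable_pair1.
rewrite ge0_integralZl_EFin //; [|by move=> y _; rewrite lee_fin|exact/measurable_EFinP].
by rewrite mulrC EFinM; apply: lee_wpmul2l; rewrite ?lee_fin.
Qed.

Lemma schur_snd (a : T -> R) (k : T * T -> R) (C : R) : igr mu a -> (forall x, 0 <= a x) ->
  measurable_fun setT k -> (forall z, 0 <= k z) -> 0 <= C ->
  (forall y, \int[mu]_x (k (x, y))%:E <= C%:E)%E -> igr m2 (fun z => a z.2 * k z).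
Proof.
move=> ia a0 mk k0 C0 hC; have ma := igr_meas ia.
have msw : measurable_fun setT (fun z : T * T => (z.2, z.1)).
  exact: (measurable_fun_pair measurable_snd measurable_fst).
have mks : measurable_fun setT (fun z : T * T => k (z.2, z.1)) by exact: measurableT_comp mk msw.
have h : igr m2 (fun z => a z.1 * k (z.2, z.1)).
  apply: (schur_fst (k := fun z => k (z.2, z.1)) ia a0 _ _ C0 hC) => //.
move/igr_ge0P: h => h.
apply/igr_ge0P; [by measf|by move=> z; rewrite mulr_ge0|].
have mm2 : measurable_fun setT (fun z : T * T => a z.1 * k (z.2, z.1)).
  by measf.
have {}h := h mm2 (fun z => mulr_ge0 (a0 _) (k0 _)).
rewrite fubini_tonelli2; last 2 first.
- by apply/measurable_EFinP; measf.
- by move=> z; rewrite lee_fin mulr_ge0.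
by rewrite fubini_tonelli1 in h; [|exact/measurable_EFinP|move=> z; rewrite lee_fin mulr_ge0].
Qed.

End schur_test.

(** * Integrals and null sets of the statement in terms of [muN] *)

Section integral_translation.
Context {R : realType} {N : nat}.
Local Notation mu := (@muN R N).
Local Notation m2 := (mu \x mu)%E.

Lemma aeNE (P : N.-tuple R -> Prop) : aeN P <-> {ae mu, forall x, P x}.
Proof.
have e (A : set (N.-tuple R)) : measurable A -> iint (fun x => (\1_A x : R)%:E) = mu A.
  move=> mA; rewrite iintE; first by rewrite integral_indic // setIT.
    by apply/measurable_EFinP; exact: measurable_indic.
  by move=> x; rewrite lee_fin.
split=> [[A [mA [A0 h]]]|[A [mA A0 h]]]; exists A; split => //.
  by rewrite -e.
by split => //; rewrite e.
Qed.

Lemma intNE (f : N.-tuple R -> R) : measurable_fun setT f -> intN f = sint mu f.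
Proof.
move=> mf; rewrite /intN /sint !iintE //.
- by apply/measurable_EFinP; measf.
- by move=> x; rewrite lee_fin le_max lexx orbT.
- by apply/measurable_EFinP; measf.
- by move=> x; rewrite lee_fin le_max lexx orbT.
Qed.

Lemma iint2E (F : N.-tuple R * N.-tuple R -> R) : measurable_fun setT F ->
  (forall z, 0 <= F z) ->
  iint (fun x => iint (fun y => (F (x, y))%:E)) = (\int[m2]_z (F z)%:E)%E.
Proof.
move=> mF F0.
have mE : measurable_fun setT (fun z => (F z)%:E) by exact/measurable_EFinP.
have E0 z : (0 <= (F z)%:E)%E by rewrite lee_fin.
have -> : (fun x => iint (fun y => (F (x, y))%:E)) = (fun x => \int[mu]_y (F (x, y))%:E)%E.
  apply/funext => x; rewrite iintE //.
  by apply: (measurableT_comp mE); exact: measurable_pair1.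
rewrite iintE.
- by rewrite fubini_tonelli1.
- exact: (@measurable_fun_fubini_tonelli_F _ _ _ _ _ mu (fun z => (F z)%:E)).
- by move=> x; apply: integral_ge0 => y _; exact: E0.
Qed.

Lemma int2NE (F : N.-tuple R -> N.-tuple R -> R) :
  measurable_fun setT (fun z : N.-tuple R * N.-tuple R => F z.1 z.2) ->
  int2N F = sint m2 (fun z => F z.1 z.2).
Proof.
move=> mF; rewrite /int2N /sint -!(iint2E (F := fun z => Num.max _ _)) //.
- by measf.
- by move=> x; rewrite le_max lexx orbT.
- by measf.
- by move=> x; rewrite le_max lexx orbT.
Qed.

Lemma sint_ge0 {d : measure_display} {T : measurableType d} (m : {measure set T -> \bar R})
  (F : T -> R) : (forall z, 0 <= F z) -> sint m F = (\int[m]_z (F z)%:E)%E.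
Proof.
move=> F0; rewrite /sint (_ : (\int[m]_z (Num.max (- F z) 0)%:E)%E = 0%E).
  by rewrite sube0; apply: eq_integral => z _; rewrite max_l.
by apply: integral0_eq => z _; rewrite max_r // oppr_le0.
Qed.

End integral_translation.

(** * The weighted kernel *)

Section kernel.
Context {R : realType} {N : nat}.
Variables (p s beta : R) (O : set (N.-tuple R)).
Hypotheses (s01 : 0 < s < 1) (p1 : 1 < p) (pN : p < N%:R).
Hypotheses (b0 : 0 <= beta) (bN : beta < (N%:R - p * s) / 2).
Hypotheses (oO : eopen O) (bO : ebounded O) (O0 : O (zero_tuple (R := R))).

Local Notation T := (N.-tuple R).
Local Notation mu := (@muN R N).
Implicit Types (x y : T) (phi : T -> R) (z : T * T).

(** The factor 1/2 and the indicator of D are part of the kernel, so that [GagD] is exactly its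
    energy. *)
Definition nuK z : R := 2^-1 * indD O z.1 z.2 * knu p s beta z.1 z.2.

Let p0 : 0 < p. Proof. by have := p1; lra. Qed.
Let ps0 : 0 < p * s. Proof. by case/andP: s01 => s0 _; rewrite mulr_gt0. Qed.
Let b2N : 2 * beta < N%:R.
Proof. by have := ps0; have := bN; move: (p * s) (N%:R : R) => a b; lra. Qed.

Lemma knuE x y : knu p s beta x y =
  edist x y `^ (- (N%:R + p * s)) * (enorm x `^ (- beta) * enorm y `^ (- beta)).
Proof. by rewrite /knu !invfM !powRN mulrA. Qed.

Lemma knu_ge0 x y : 0 <= knu p s beta x y.
Proof. by rewrite knuE !mulr_ge0 ?powR_ge0. Qed.

Lemma knuC x y : knu p s beta x y = knu p s beta y x.
Proof. by rewrite /knu (edistC y x); congr (_^-1); exact: mulrAC. Qed.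

Lemma indDC x y : indD O x y = indD O y x.
Proof. by rewrite /indD; congr (if _ then _ else _); apply: asbool_equiv_eq; tauto. Qed.

Lemma nuKC x y : nuK (x, y) = nuK (y, x).
Proof. by rewrite /nuK knuC indDC. Qed.

Lemma nuK_ge0 z : 0 <= nuK z.
Proof. by rewrite /nuK !mulr_ge0 ?knu_ge0 // /indD; case: ifP. Qed.

Lemma measurable_dom : measurable O. Proof. exact: eopen_measurable. Qed.

Lemma indDE x y : indD O x y = \1_O x + \1_O y - \1_O x * \1_O y.
Proof.
rewrite /indD; case: ifP => /asboolP h.
  have [Ox|nx] := pselect (O x); have [Oy|ny] := pselect (O y).
  - by rewrite !indic_in //; lra.
  - by rewrite indic_in // indic_out //; lra.
  - by rewrite indic_out // indic_in //; lra.
  - by case: h.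
have [nx ny] : ~ O x /\ ~ O y by tauto.
by rewrite !indic_out //; lra.
Qed.

Lemma mf_knu : measurable_fun setT (fun z : T * T => knu p s beta z.1 z.2).
Proof.
under eq_fun do rewrite knuE.
by have h1 := @mf_edist2 R N; have h2 := @mf_enorm R N; measf.
Qed.

Lemma mf_indD : measurable_fun setT (fun z : T * T => indD O z.1 z.2).
Proof.
under eq_fun do rewrite indDE.
have h : measurable_fun setT (\1_O : T -> R) by exact: mf_indic measurable_dom.
have h1 : measurable_fun setT (fun z : T * T => \1_O z.1 : R) by exact: (mf_fst h).
have h2 : measurable_fun setT (fun z : T * T => \1_O z.2 : R) by exact: (mf_snd h).
by measf.
Qed.

Lemma mf_nuK : measurable_fun setT nuK.
Proof. by have h1 := mf_knu; have h2 := mf_indD; rewrite /nuK; measf. Qed.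

Lemma mf_wmu : measurable_fun setT (wmu (N := N) beta).
Proof. by have h2 := @mf_enorm R N; rewrite /wmu; measf. Qed.

Lemma wmu_ge0 x : 0 <= wmu beta x. Proof. exact: powR_ge0. Qed.

Lemma dom_norm_bound : exists2 M : R, 0 < M & forall x, O x -> enorm x <= M.
Proof.
have [M hM] := bO; exists (`|M| + 1); first by rewrite ltr_wpDl.
by move=> x /hM h; apply: le_trans h (le_trans (ler_norm M) _); rewrite lerDl.
Qed.

Lemma igr_dom : igr mu (\1_O : T -> R).
Proof.
have [M M0 hM] := dom_norm_bound.
have fc : (mu (cube (zero_tuple (R := R) (N := N)) M) < +oo)%E by rewrite muN_cube ?ltry // ltW.
have [h _] := igr_indic (measurable_cube _ _) fc.
apply: (igr_le _ _ h); first exact: mf_indic measurable_dom.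
move=> x; rewrite ger0_norm //; have [Ox|nx] := pselect (O x); last by rewrite indic_out.
by rewrite !indic_in //; apply: cube_edist; rewrite -enormE; exact: hM.
Qed.

Lemma igr_wmu : igr mu (fun x => \1_O x * wmu beta x).
Proof.
have [M M0 hM] := dom_norm_bound.
have [C C0 hC] := near_kernel_bound (N := N) (a := 2 * beta) (rho := M) (mulr_ge0 (ler0n _ _) b0) b2N M0.
have mw := mf_wmu; have mO := measurable_dom.
apply/igr_ge0P; [by measf|by move=> x; rewrite mulr_ge0 ?wmu_ge0|].
apply: le_lt_trans (ltry C); apply: le_trans (hC (zero_tuple (R := R))).
have md := mf_edist (zero_tuple (R := R) (N := N)).
have mS : measurable_fun setT (fun y : T => \1_[set y | edist (zero_tuple (R := R)) y <= M] y *
    edist (zero_tuple (R := R)) y `^ (- (2 * beta))).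
  exact: mf_M (mf_indic (measurable_le M md)) (mf_pow _ md).
apply: ge0_le_integral.
- exact: measurableT.
- by move=> x _; rewrite lee_fin mulr_ge0 ?wmu_ge0.
- by apply/measurable_EFinP; exact: mf_M (mf_indic mO) mw.
- exact/measurable_EFinP.
- move=> x _; rewrite lee_fin /wmu enormE ler_wpM2r ?powR_ge0 //.
  have [Ox|nx] := pselect (O x); last by rewrite indic_out.
  by rewrite !indic_in //= -enormE; exact: hM.
Qed.

End kernel.

(** * Test functions have finite energy over all of D *)

Section finite_energy.
Context {R : realType} {N : nat}.
Variables (p s beta : R) (O : set (N.-tuple R)).
Hypotheses (s01 : 0 < s < 1) (p1 : 1 < p) (pN : p < N%:R).
Hypotheses (b0 : 0 <= beta) (bN : beta < (N%:R - p * s) / 2).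
Hypotheses (oO : eopen O) (bO : ebounded O) (O0 : O (zero_tuple (R := R))).

Local Notation T := (N.-tuple R).
Local Notation mu := (@muN R N).
Local Notation mfun := (measurable_fun setT).
Local Notation K := (nuK p s beta O).
Implicit Types (x y : T) (phi u v w : T -> R) (z : T * T).

Let p0 : 0 < p. Proof. by have := p1; lra. Qed.
Let ps0 : 0 < p * s. Proof. by case/andP: s01 => s0 _; rewrite mulr_gt0. Qed.
Let mO : measurable O := measurable_dom oO.
Let mK : mfun K := @mf_nuK R N p s beta O oO.
Let K0 z : 0 <= K z := @nuK_ge0 R N p s beta O z.

(** Integrable weight dominating |x|^(-beta) |y|^(-beta) once the variables are separated; the
    summand 1 serves for a single factor |x|^(-beta). *)
Let wt x : R := \1_O x * (1 + wmu beta x).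

Let wt0 x : 0 <= wt x. Proof. by rewrite mulr_ge0 // addr_ge0 // wmu_ge0. Qed.

Let igr_wt : igr mu wt.
Proof.
rewrite (_ : wt = fun x => \1_O x + \1_O x * wmu beta x); last first.
  by apply/funext => x; rewrite /wt mulrDr mulr1.
by apply: igrD; [exact: igr_dom|exact: (@igr_wmu R N p s)].
Qed.

Let wmu_sqr x : wmu beta x = enorm x `^ (- beta) ^+ 2.
Proof.
by rewrite /wmu -powR_mulrn ?powR_ge0 // -powRrM; congr (_ `^ _); ring.
Qed.

(** Pairs inside O: the Lipschitz bound lowers the singular exponent N + ps by p, below N because s
    < 1, and ab <= a^2 + b^2 separates the weights. *)
Let knu_near (L rho : R) phi x y : 0 <= L -> 0 < rho ->
  `|phi x - phi y| <= L * edist x y -> edist x y <= rho -> O x -> O y ->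
  `|phi x - phi y| `^ p * knu p s beta x y <=
  L `^ p * (1 + rho `^ (p - N%:R - p * s)) * (wt x + wt y) *
  edist x y `^ (- Num.max (N%:R + p * s - p) 0).
Proof.
move=> L0 rho0 hL Dr Ox Oy; set D := edist x y.
have D0 : 0 <= D by exact: edist_ge0.
have h1 : `|phi x - phi y| `^ p <= L `^ p * D `^ p.
  by rewrite -powRM //; apply: powR_le => //; exact: ltW.
have h2 : D `^ p * D `^ (- (N%:R + p * s)) <=
    (1 + rho `^ (p - N%:R - p * s)) * D `^ (- Num.max (N%:R + p * s - p) 0).
  have r0 : 0 <= rho `^ (p - N%:R - p * s) by exact: powR_ge0.
  have [->|Dn0] := eqVneq D 0.
    by rewrite powR0 ?mul0r ?mulr_ge0 ?powR_ge0 ?addr_ge0 // gt_eqF.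
  rewrite -powRD; last by rewrite Dn0 implybT.
  have [a0|a0] := leP (N%:R + p * s - p) 0.
    rewrite oppr0 powRr0 mulr1; apply: le_trans (ler_wpDl _ (lexx _)) => //.
    rewrite (_ : p + - (N%:R + p * s) = p - N%:R - p * s); last by ring.
    by apply: powR_le => //; lra.
  rewrite (_ : p + - (N%:R + p * s) = - (N%:R + p * s - p)); last by ring.
  by rewrite ler_peMl ?powR_ge0 // lerDl.
have h3 : enorm x `^ (- beta) * enorm y `^ (- beta) <= wt x + wt y.
  rewrite /wt !indic_in // !mul1r !wmu_sqr.
  move: (enorm x `^ _) (enorm y `^ _) => a b; have := sqr_ge0 (a - b).
  by have := sqr_ge0 (a + b); nra.
rewrite knuE -/D mulrA.
apply: (@le_trans _ _ (L `^ p * D `^ p * D `^ (- (N%:R + p * s)) *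
    (enorm x `^ (- beta) * enorm y `^ (- beta)))).
  by rewrite ler_wpM2r ?mulr_ge0 ?powR_ge0 // ler_wpM2r ?powR_ge0.
rewrite -[L `^ p * D `^ p * _]mulrA.
apply: (@le_trans _ _ (L `^ p * ((1 + rho `^ (p - N%:R - p * s)) *
    D `^ (- Num.max (N%:R + p * s - p) 0)) * (wt x + wt y))).
  have Lp := powR_ge0 L p.
  exact: (ler_pM (mulr_ge0 Lp (mulr_ge0 (powR_ge0 _ _) (powR_ge0 _ _)))
    (mulr_ge0 (powR_ge0 _ _) (powR_ge0 _ _)) (ler_wpM2l Lp h2) h3).
move: (L `^ p) (rho `^ _) (D `^ _) (wt x) (wt y) => a b c e f.
by rewrite le_eqVlt; apply/orP; left; apply/eqP; ring.
Qed.

(** Pairs with y outside O: where phi x is nonzero, x is at distance at least [dd] from y, and a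
    ball about the origin inside O keeps |y|^(-beta) bounded. *)
Let knu_far (L r0 dd : R) phi x y : 0 <= L -> 0 < r0 -> `|phi x| <= L ->
  (forall y, enorm y < r0 -> O y) -> (forall x, phi x != 0 -> forall y, edist x y < dd -> O y) ->
  (forall x, ~ O x -> phi x = 0) -> O x -> ~ O y ->
  `|phi x - phi y| `^ p * knu p s beta x y <=
  L `^ p * r0 `^ (- beta) * wt x *
  (\1_[set y | dd <= edist x y] y * edist x y `^ (- (N%:R + p * s))).
Proof.
move=> L0 r00 hL hr hd h0 Ox nOy; rewrite (h0 _ nOy) subr0.
have [->|nx] := eqVneq (phi x) 0.
  rewrite normr0 powR0 ?gt_eqF // mul0r; apply: mulr_ge0; last by rewrite mulr_ge0 // powR_ge0.
  by apply: mulr_ge0 (wt0 x); rewrite mulr_ge0 ?powR_ge0.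
have Dd : dd <= edist x y by rewrite leNgt; apply/negP => /(hd _ nx).
rewrite [\1_[set y | _] y]indic_in // mul1r knuE.
have h1 : `|phi x| `^ p <= L `^ p by apply: powR_le => //; exact: ltW.
have h2 : enorm y `^ (- beta) <= r0 `^ (- beta).
  have yr : r0 <= enorm y by rewrite leNgt; apply/negP => /hr.
  rewrite !powRN lef_pV2 ?posrE ?powR_gt0 //; first by apply: powR_le => //; exact: ltW.
  exact: lt_le_trans yr.
have h3 : enorm x `^ (- beta) <= wt x.
  rewrite /wt indic_in // mul1r wmu_sqr; move: (enorm x `^ _) => a.
  by have := sqr_ge0 (a - 1); have := sqr_ge0 a; nra.
have e0 := powR_ge0 (edist x y) (- (N%:R + p * s)).
apply: (@le_trans _ _ (L `^ p * (edist x y `^ (- (N%:R + p * s)) * (wt x * r0 `^ (- beta))))).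
  exact: (ler_pM (powR_ge0 _ _) (mulr_ge0 e0 (mulr_ge0 (powR_ge0 _ _) (powR_ge0 _ _))) h1
    (ler_wpM2l e0 (ler_pM (powR_ge0 _ _) (powR_ge0 _ _) h3 h2))).
move: (L `^ p) (r0 `^ _) (edist x y `^ _) (wt x) => a b c e.
by rewrite le_eqVlt; apply/orP; left; apply/eqP; ring.
Qed.

Lemma Ccinf_fin_energy phi : Ccinf O phi -> fin_energy mu p K phi.
Proof.
move=> Cphi; have mphi : mfun phi := Ccinf_meas Cphi.
have [L L0 [hL1 hL2]] := Ccinf_lipschitz bO Cphi.
have [_ [dd dd0 hd]] := Cphi.
have phi0 x := @Ccinf_off _ _ O phi x Cphi.
have [r0 r00 hr0] := oO O0.
have hr y : enorm y < r0 -> O y by rewrite enormE; exact: hr0.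
have [M M0 hM] := dom_norm_bound bO.
have N0 : 0 < N%:R :> R by apply: lt_trans pN.
pose rho := N%:R * (2 * M).
have rho0 : 0 < rho by rewrite /rho !mulr_gt0.
have hrho x y : O x -> O y -> edist x y <= rho.
  move=> Ox Oy; apply: edist_le; first by rewrite mulr_ge0 // ltW.
  move=> i; have c (w : T) : O w -> `|tnth w i| <= M.
    move=> Ow; apply: le_trans (hM _ Ow).
    by have := edist_coord (zero_tuple (R := R)) w i; rewrite -enormE tnth_mktuple sub0r normrN.
  apply: le_trans (ler_normB _ _) _; have := c _ Ox; have := c _ Oy.
  by move: (`|_|) (`|_|) => a b; lra.
pose a' := Num.max (N%:R + p * s - p) 0.
have a'0 : 0 <= a' by rewrite le_max lexx orbT.
have a'N : a' < N%:R.
  rewrite gt_max N0 andbT; case/andP: s01 => s0 s1.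
  have : p * s < p * 1 by rewrite ltr_pM2l.
  by rewrite mulr1; move: (p * s) (N%:R : R) => b c; lra.
have [C1 C10 hC1] := near_kernel_bound (N := N) a'0 a'N rho0.
have [C2 C20 hC2] := far_kernel_bound N ps0 dd0.
pose k1 z : R := \1_[set z : T * T | edist z.1 z.2 <= rho] z * edist z.1 z.2 `^ (- a').
pose k2 z : R := \1_[set z : T * T | dd <= edist z.1 z.2] z * edist z.1 z.2 `^ (- (N%:R + p * s)).
have md := @mf_edist2 R N.
have mk1 : mfun k1 by have h := measurable_le rho md; rewrite /k1; measf.
have mk2 : mfun k2 by have h := measurable_ge dd md; rewrite /k2; measf.
have k10 z : 0 <= k1 z by rewrite mulr_ge0 ?powR_ge0.
have k20 z : 0 <= k2 z by rewrite mulr_ge0 ?powR_ge0.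
have e1 x y : (k1 (x, y))%:E = (\1_[set y | edist x y <= rho] y * edist x y `^ (- a'))%:E by [].
have e2 x y : (k2 (x, y))%:E = (\1_[set y | dd <= edist x y] y * edist x y `^ (- (N%:R + p * s)))%:E by [].
have k1C x y : k1 (x, y) = k1 (y, x).
  rewrite /k1 /= (edistC y x) !indicE; congr ((nat_of_bool _)%:R * _).
  by apply/idP/idP; rewrite !inE /= edistC.
have k2C x y : k2 (x, y) = k2 (y, x).
  rewrite /k2 /= (edistC y x) !indicE; congr ((nat_of_bool _)%:R * _).
  by apply/idP/idP; rewrite !inE /= edistC.
have b1 x : (\int[mu]_y (k1 (x, y))%:E <= C1%:E)%E by exact: hC1.
have b2 x : (\int[mu]_y (k2 (x, y))%:E <= C2%:E)%E by exact: hC2.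
have b1' y : (\int[mu]_x (k1 (x, y))%:E <= C1%:E)%E.
  by under eq_integral do rewrite k1C; exact: b1.
have b2' y : (\int[mu]_x (k2 (x, y))%:E <= C2%:E)%E.
  by under eq_integral do rewrite k2C; exact: b2.
have i11 := schur_fst igr_wt wt0 mk1 k10 C10 b1.
have i12 := schur_snd igr_wt wt0 mk1 k10 C10 b1'.
have i21 := schur_fst igr_wt wt0 mk2 k20 C20 b2.
have i22 := schur_snd igr_wt wt0 mk2 k20 C20 b2'.
pose B1 := L `^ p * (1 + rho `^ (p - N%:R - p * s)).
pose B2 := L `^ p * r0 `^ (- beta).
have B10 : 0 <= B1 by rewrite mulr_ge0 ?addr_ge0 ?powR_ge0.
have B20 : 0 <= B2 by rewrite mulr_ge0 ?powR_ge0.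
apply: (igr_le _ _ (igrD (igrZ B1 (igrD i11 i12)) (igrZ B2 (igrD i21 i22)))).
  by rewrite /edens; measf.
move=> [x y] /=; rewrite ger0_norm; last exact: mulr_ge0 (K0 _) (powR_ge0 _ _).
have A1 : 0 <= B1 * (wt x * k1 (x, y) + wt y * k1 (x, y)) by rewrite mulr_ge0 // addr_ge0 // mulr_ge0.
have A2 : 0 <= B2 * (wt x * k2 (x, y) + wt y * k2 (x, y)) by rewrite mulr_ge0 // addr_ge0 // mulr_ge0.
have half (X : R) : 0 <= X -> 2^-1 * X <= X by move=> X0; rewrite ler_piMl // invf_le1 ?ler1n.
rewrite /edens /= /nuK /=.
have [Ox|nx] := pselect (O x); have [Oy|ny] := pselect (O y).
- rewrite indDE !indic_in // (_ : 1 + 1 - 1 * 1 = 1); last by ring.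
  rewrite mulr1 -mulrA [knu _ _ _ _ _ * _]mulrC.
  apply: le_trans (half _ _) _; first by rewrite mulr_ge0 ?powR_ge0 ?knu_ge0.
  apply: le_trans (knu_near L0 rho0 (hL2 x y) (hrho _ _ Ox Oy) Ox Oy) _.
  apply: (@le_trans _ _ (B1 * (wt x * k1 (x, y) + wt y * k1 (x, y)))); last by rewrite lerDl.
  have -> : k1 (x, y) = edist x y `^ (- a').
    by rewrite /k1 (@indic_in _ _ [set z : T * T | edist z.1 z.2 <= rho] (x, y) (hrho _ _ Ox Oy)) mul1r.
  rewrite -/a' -/B1; move: (edist x y `^ _) (wt x) (wt y) => a b c.
  by rewrite -mulrDl mulrA.
- rewrite indDE indic_in // indic_out // (_ : 1 + 0 - 1 * 0 = 1); last by ring.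
  rewrite mulr1 -mulrA [knu _ _ _ _ _ * _]mulrC.
  apply: le_trans (half _ _) _; first by rewrite mulr_ge0 ?powR_ge0 ?knu_ge0.
  apply: le_trans (knu_far L0 r00 (hL1 x) hr hd phi0 Ox ny) _.
  apply: (@le_trans _ _ (B2 * (wt x * k2 (x, y) + wt y * k2 (x, y)))); last by rewrite lerDr.
  by rewrite mulrDr -mulrA lerDl mulr_ge0 // mulr_ge0.
- rewrite indDE indic_out // indic_in // (_ : 0 + 1 - 0 * 1 = 1); last by ring.
  rewrite mulr1 -mulrA [knu _ _ _ _ _ * _]mulrC.
  apply: le_trans (half _ _) _; first by rewrite mulr_ge0 ?powR_ge0 ?knu_ge0.
  rewrite distrC knuC.
  apply: le_trans (knu_far L0 r00 (hL1 y) hr hd phi0 Oy nx) _.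
  apply: (@le_trans _ _ (B2 * (wt x * k2 (x, y) + wt y * k2 (x, y)))); last by rewrite lerDr.
  by rewrite k2C mulrDr -[leLHS]mulrA lerDr mulr_ge0 // mulr_ge0.
- by rewrite indDE !indic_out // mul0r subr0 addr0 mulr0 !mul0r addr_ge0.
Qed.

End finite_energy.

(** * [W0] as a linear space *)

Section sobolev_space.
Context {R : realType} {N : nat}.
Variables (p s beta : R) (O : set (N.-tuple R)).
Hypotheses (s01 : 0 < s < 1) (p1 : 1 < p) (pN : p < N%:R).
Hypotheses (b0 : 0 <= beta) (bN : beta < (N%:R - p * s) / 2).
Hypotheses (oO : eopen O) (bO : ebounded O) (O0 : O (zero_tuple (R := R))).

Local Notation T := (N.-tuple R).
Local Notation mu := (@muN R N).
Local Notation m2 := (mu \x mu)%E.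
Local Notation mfun := (measurable_fun setT).
Local Notation K := (nuK p s beta O).
Implicit Types (x y : T) (phi u v w : T -> R) (z : T * T).

Let p0 : 0 < p. Proof. by have := p1; lra. Qed.
Let mO : measurable O := measurable_dom oO.
Let mK : mfun K := @mf_nuK R N p s beta O oO.
Let K0 z : 0 <= K z := @nuK_ge0 R N p s beta O z.
Let m1O : mfun (\1_O : T -> R) := mf_indic mO.
Let mO1 : mfun (fun z : T * T => \1_O z.1 : R) := mf_fst m1O.
Let mO2 : mfun (fun z : T * T => \1_O z.2 : R) := mf_snd m1O.

Local Notation W := (W0 p s beta O).

Let mw : mfun (wmu (N := N) beta) := @mf_wmu R N beta.
Let w0 x : 0 <= wmu beta x := @wmu_ge0 R N beta x.

Definition ipd w x : R := \1_O x * `|w x| `^ p * wmu beta x.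
Definition gad w z : R := \1_O z.1 * \1_O z.2 * edens p K w z.
Definition wclose (e : R) w := [/\ igr mu (ipd w), Rintegral mu setT (ipd w) <= e,
  igr m2 (gad w) & Rintegral m2 setT (gad w) <= e].

Lemma mf_ipd w : mfun w -> mfun (ipd w).
Proof. by move=> h; rewrite /ipd; measf. Qed.

Lemma mf_gad w : mfun w -> mfun (gad w).
Proof. by move=> h; rewrite /gad /edens; measf. Qed.

Lemma ipd_ge0 w x : 0 <= ipd w x.
Proof. by rewrite !mulr_ge0 ?powR_ge0. Qed.

Lemma gad_ge0 w z : 0 <= gad w z.
Proof. by apply: mulr_ge0; [rewrite mulr_ge0|exact: mulr_ge0 (K0 z) (powR_ge0 _ _)]. Qed.

Lemma gadE w z : 2 * gad w z =
  \1_O z.1 * \1_O z.2 * `|w z.1 - w z.2| `^ p * knu p s beta z.1 z.2.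
Proof.
rewrite /gad /edens /nuK indDE.
have [Ox|nx] := pselect (O z.1); last by rewrite (indic_out nx) !mul0r mulr0.
have [Oy|ny] := pselect (O z.2); last by rewrite (indic_out ny) !(mulr0, mul0r).
by rewrite !indic_in //; field.
Qed.

Lemma IpmuE w : mfun w -> Ipmu p beta O w = (\int[mu]_x (ipd w x)%:E)%E.
Proof.
by move=> h; rewrite /Ipmu intNE ?sint_ge0 //; [exact: ipd_ge0|exact: mf_ipd].
Qed.

Lemma GagE w : mfun w -> Gag p s beta O w = (\int[m2]_z (2 * gad w z)%:E)%E.
Proof.
move=> h; have mg := mf_gad h.
have e : (fun z : T * T => \1_O z.1 * \1_O z.2 * `|w z.1 - w z.2| `^ p * knu p s beta z.1 z.2)
  = (fun z => 2 * gad w z) by apply/funext => z; rewrite gadE.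
rewrite /Gag int2NE e; last by measf.
by rewrite sint_ge0 // => z; rewrite mulr_ge0 // gad_ge0.
Qed.

Lemma wcloseP (e : R) w : mfun w -> 0 < e -> (Ipmu p beta O w < e%:E)%E ->
  (Gag p s beta O w < e%:E)%E -> wclose e w.
Proof.
move=> h e0; rewrite IpmuE // GagE // => h1 h2.
have i1 : igr mu (ipd w).
  apply/igr_ge0P; [exact: mf_ipd|exact: ipd_ge0|exact: lt_trans h1 (ltry _)].
have mg := mf_gad h.
have i2 : igr m2 (fun z => 2 * gad w z).
  apply/igr_ge0P; [by measf| |exact: lt_trans h2 (ltry _)].
  by move=> z; rewrite mulr_ge0 // gad_ge0.
have i3 : igr m2 (gad w).
  apply: (igr_le mg _ i2) => z; have := gad_ge0 w z => g0.
  by rewrite ger0_norm // ler_peMl // ler1n.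
rewrite EFin_Rintegral // lte_fin in h1; rewrite EFin_Rintegral // lte_fin Rint_Z // in h2.
split; [exact: i1|exact: ltW|exact: i3|].
have := Rint_ge0 m2 (gad_ge0 w); move: (Rintegral _ _ _) h2 => a; lra.
Qed.

(** The third absorbs the factor 2 between [Gag] and [gad], whose kernel contains 1/2, and leaves
    room for strictness. *)
Lemma wclose_lt (e : R) w : mfun w -> 0 < e -> wclose (e / 3) w ->
  (Ipmu p beta O w < e%:E)%E /\ (Gag p s beta O w < e%:E)%E.
Proof.
move=> h e0 [i1 h1 i2 h2]; rewrite IpmuE // GagE // !EFin_Rintegral //; last exact: igrZ.
rewrite !lte_fin Rint_Z //.
by move: (Rintegral _ _ _) (Rintegral _ _ _) h1 h2 => a b; split; lra.
Qed.

(** Trades the approximating sequence for one approximant per tolerance, and extended real integrals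
    for integrable densities. *)
Lemma W0P u : W u <-> [/\ mfun u, (forall x, ~ O x -> u x = 0) &
  forall e : R, 0 < e -> exists2 phi, Ccinf O phi & wclose e (fun x => phi x - u x)].
Proof.
split=> [[mu_ [ou [ph [Cph h]]]]|[mu_ ou h]].
  split => // e e0; have [n0 hn] := h _ e0; exists (ph n0) => //.
  have [h1 h2] := hn n0 (leqnn _); apply: wcloseP => //.
  by have h' := Ccinf_meas (Cph n0); measf.
split => //; split => //.
have /choice[ph hph] : forall n, exists phi, Ccinf O phi /\
    wclose (n.+1%:R^-1 / 3) (fun x => phi x - u x).
  by move=> n; have [|phi C1 C2] := h (n.+1%:R^-1 / 3); [rewrite divr_gt0|exists phi].
exists ph; split=> [n|e e0]; first by have [] := hph n.
exists (Num.bound e^-1) => n hn.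
have [Cn cn] := hph n; have mn : mfun (fun x => ph n x - u x).
  by have h' := Ccinf_meas Cn; measf.
have [|h1 h2] := wclose_lt mn _ cn; first by rewrite invr_gt0.
have le : n.+1%:R^-1 <= e.
  rewrite -[e]invrK lef_pV2 ?posrE ?invr_gt0 //.
  apply: ltW; apply: lt_le_trans (archi_boundP _) _; first by rewrite invr_ge0 ltW.
  by rewrite ler_nat; apply: leqW.
by split; [apply: lt_le_trans h1 _|apply: lt_le_trans h2 _]; rewrite lee_fin.
Qed.

Lemma ipd_D v w x : ipd (fun x => v x + w x) x <= 2 `^ p * (ipd v x + ipd w x).
Proof.
have -> : 2 `^ p * (ipd v x + ipd w x) =
  \1_O x * (2 `^ p * (`|v x| `^ p + `|w x| `^ p)) * wmu beta x by rewrite /ipd; ring.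
by rewrite ler_wpM2r // ler_wpM2l // powR_normD.
Qed.

Lemma gad_D v w z : gad (fun x => v x + w x) z <= 2 `^ p * (gad v z + gad w z).
Proof.
have -> : 2 `^ p * (gad v z + gad w z) =
  \1_O z.1 * \1_O z.2 * (2 `^ p * (edens p K v z + edens p K w z)) by rewrite /gad; ring.
rewrite ler_wpM2l ?mulr_ge0 // /edens -mulrDr mulrCA ler_wpM2l //.
have -> : v z.1 + w z.1 - (v z.2 + w z.2) = (v z.1 - v z.2) + (w z.1 - w z.2) by ring.
exact: powR_normD.
Qed.

Lemma wclose_D (e e' : R) v w : mfun v -> mfun w -> wclose e v -> wclose e' w ->
  wclose (2 `^ p * (e + e')) (fun x => v x + w x).
Proof.
move=> mv mw' [i1 l1 i2 l2] [j1 k1 j2 k2].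
have m : mfun (fun x => v x + w x) by measf.
have a1 := igrZ (2 `^ p) (igrD i1 j1); have a2 := igrZ (2 `^ p) (igrD i2 j2).
have c1 : igr mu (ipd (fun x => v x + w x)).
  by apply: (igr_le (mf_ipd m) _ a1) => x; rewrite ger0_norm ?ipd_ge0 // ipd_D.
have c2 : igr m2 (gad (fun x => v x + w x)).
  by apply: (igr_le (mf_gad m) _ a2) => x; rewrite ger0_norm ?gad_ge0 // gad_D.
split; [exact: c1| |exact: c2|].
  apply: le_trans (Rint_le c1 a1 (ipd_D v w)) _.
  by rewrite Rint_Z ?Rint_D //; [rewrite ler_wpM2l ?powR_ge0 // lerD|exact: igrD].
apply: le_trans (Rint_le c2 a2 (gad_D v w)) _.
by rewrite Rint_Z ?Rint_D //; [rewrite ler_wpM2l ?powR_ge0 // lerD|exact: igrD].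
Qed.

Lemma wclose_Z (c e : R) v : wclose e v -> wclose (`|c| `^ p * e) (fun x => c * v x).
Proof.
move=> [i1 l1 i2 l2].
have e1 : ipd (fun x => c * v x) = fun x => `|c| `^ p * ipd v x.
  by apply/funext => x; rewrite /ipd normrM powRM //; ring.
have e2 : gad (fun x => c * v x) = fun z => `|c| `^ p * gad v z.
  by apply/funext => z; rewrite /gad edens_Z; ring.
split; rewrite ?e1 ?e2; [exact: igrZ| |exact: igrZ|].
  by rewrite Rint_Z // ler_wpM2l ?powR_ge0.
by rewrite Rint_Z // ler_wpM2l ?powR_ge0.
Qed.

Lemma W0_0 : W (fun=> 0).
Proof.
apply/W0P; split; [exact: mf_cst|by []|].
move=> e e0; exists (fun=> 0); first exact: Ccinf0.
have z1 : ipd (fun x : T => 0 - 0) = fun=> 0.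
  by apply/funext => x; rewrite /ipd subrr normr0 powR0 ?gt_eqF // mulr0 mul0r.
have z2 : gad (fun x : T => 0 - 0) = fun=> 0.
  by apply/funext => x; rewrite /gad /edens subrr normr0 powR0 ?gt_eqF // !mulr0.
have r1 : Rintegral mu setT (fun=> 0 : R) = 0 by rewrite /Rintegral integral0.
have r2 : Rintegral m2 setT (fun=> 0 : R) = 0 by rewrite /Rintegral integral0.
by split; rewrite ?z1 ?z2 ?r1 ?r2 ?(ltW e0) //; exact: igr0.
Qed.

Lemma W0_D u v : W u -> W v -> W (fun x => u x + v x).
Proof.
move=> /W0P[mu_ ou hu] /W0P[mv ov hv]; apply/W0P; split; first by measf.
  by move=> x nx; rewrite ou // ov // addr0.
move=> e e0; pose e' := e / (2 `^ p * 2).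
have P0 : 0 < 2 `^ p :> R by rewrite powR_gt0.
have e'0 : 0 < e' by rewrite divr_gt0 // mulr_gt0.
have [f Cf cf] := hu _ e'0; have [g Cg cg] := hv _ e'0.
have mf := Ccinf_meas Cf; have mg := Ccinf_meas Cg.
exists (fun x => f x + g x); first exact: CcinfD.
have := wclose_D _ _ cf cg; rewrite (_ : 2 `^ p * (e' + e') = e); last first.
  by rewrite /e'; field; rewrite gt_eqF.
rewrite (_ : (fun x => f x - u x + (g x - v x)) = (fun x => f x + g x - (u x + v x))).
  by apply; rewrite /meas in mf mg; measf.
by apply/funext => x; ring.
Qed.

Lemma W0_Z (c : R) u : W u -> W (fun x => c * u x).
Proof.
move=> /W0P[mu_ ou hu]; apply/W0P; split; first by measf.
  by move=> x nx; rewrite ou // mulr0.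
move=> e e0; pose b := `|c| `^ p + 1.
have b_gt0 : 0 < b by rewrite ltr_wpDl // powR_ge0.
have [f Cf cf] := hu _ (divr_gt0 e0 b_gt0).
exists (fun x => c * f x); first exact: CcinfZ.
have [i1 l1 i2 l2] := wclose_Z c cf.
have le : `|c| `^ p * (e / b) <= e.
  by rewrite mulrCA ler_piMr ?(ltW e0) // ler_pdivrMr // mul1r lerDl.
rewrite (_ : (fun x => c * f x - c * u x) = (fun x => c * (f x - u x))).
  by split; [exact: i1|exact: le_trans l1 le|exact: i2|exact: le_trans l2 le].
by apply/funext => x; ring.
Qed.

End sobolev_space.

(** * Stability of [W0] under cuts *)

Section sobolev_lattice.
Context {R : realType} {N : nat}.
Variables (p s beta : R) (O : set (N.-tuple R)).
Hypotheses (s01 : 0 < s < 1) (p1 : 1 < p) (pN : p < N%:R).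
Hypotheses (b0 : 0 <= beta) (bN : beta < (N%:R - p * s) / 2).
Hypotheses (oO : eopen O) (bO : ebounded O) (O0 : O (zero_tuple (R := R))).

Local Notation T := (N.-tuple R).
Local Notation mu := (@muN R N).
Local Notation m2 := (mu \x mu)%E.
Local Notation mfun := (measurable_fun setT).
Local Notation K := (nuK p s beta O).
Implicit Types (x y : T) (phi u v w : T -> R) (z : T * T).

Let p0 : 0 < p. Proof. by have := p1; lra. Qed.
Let mO : measurable O := measurable_dom oO.
Let mK : mfun K := @mf_nuK R N p s beta O oO.
Let K0 z : 0 <= K z := @nuK_ge0 R N p s beta O z.
Let m1O : mfun (\1_O : T -> R) := mf_indic mO.
Let mO1 : mfun (fun z : T * T => \1_O z.1 : R) := mf_fst m1O.
Let mO2 : mfun (fun z : T * T => \1_O z.2 : R) := mf_snd m1O.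

Local Notation W := (W0 p s beta O).
Local Notation wcl := (wclose p s beta O).
Local Notation ip := (ipd p beta O).
Local Notation ga := (gad p s beta O).

Let N0 : 0 < N%:R :> R. Proof. by have := p0; move/lt_trans; apply. Qed.
Let w0 x : 0 <= wmu beta x := @wmu_ge0 R N beta x.
Let iw : igr mu (fun x => \1_O x * wmu beta x) := igr_wmu s01 p1 b0 bN oO bO.
Let feC := Ccinf_fin_energy s01 p1 pN b0 bN oO bO O0.
Let WP := W0P p s beta oO.

(** A point is a cube of radius 0, and N > 0. This disposes of the diagonal and of the origin, where
    |x|^(-2 beta) has the conventional value 0 if beta > 0. *)
Lemma ae_neq (x0 : T) : {ae mu, forall x, x <> x0}.
Proof.
exists (cube x0 0); split; first exact: measurable_cube.
  rewrite muN_cube // mulr0 expr0n; case: eqP => // e0.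
  by move: N0; rewrite e0 ltxx.
by move=> x /= /contrapT -> i; rewrite subrr normr0.
Qed.

Lemma wmu_gt0 x : x <> zero_tuple (R := R) -> 0 < wmu beta x.
Proof.
move=> nx; rewrite powR_gt0 // lt_neqAle enorm_ge0 andbT eq_sym.
by apply/eqP; rewrite enormE => /edist_eq0 /esym.
Qed.

Lemma gad_le_edens w z : ga w z <= edens p K w z.
Proof.
apply: ler_piMl; first exact: mulr_ge0 (K0 z) (powR_ge0 _ _).
by apply: mulr_ile1; rewrite // indicE; case: (_ \in _).
Qed.

(** One approximant within tolerance 1 suffices: it has finite energy, and the norm controls the
    difference. *)
Lemma igr_gad u : W u -> igr m2 (ga u).
Proof.
move=> /WP[mu_ ou hu]; have [phi Cp [_ _ h _]] := hu 1 ltr01.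
have mp : mfun phi := Ccinf_meas Cp.
have ip_ : igr m2 (ga phi).
  apply: (igr_le (mf_gad p s beta oO mp) _ (feC Cp)) => z.
  by rewrite ger0_norm ?gad_ge0 // gad_le_edens.
have h' : igr m2 (ga (fun x => -1 * (phi x - u x))).
  rewrite (_ : ga _ = fun z => `|-1| `^ p * ga (fun x => phi x - u x) z); first exact: igrZ.
  by apply/funext => z; rewrite /gad edens_Z; ring.
apply: (igr_le (mf_gad p s beta oO mu_) _ (igrZ (2 `^ p) (igrD ip_ h'))) => z.
rewrite ger0_norm ?gad_ge0 //; apply: le_trans (gad_D s beta O p1 _ _ _).
rewrite (_ : (fun x => phi x + _) = u) //.
by apply/funext => x; ring.
Qed.

Lemma powR_cvg0 (a : nat -> R) : (forall n, 0 <= a n) ->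
  a n `^ p @[n --> \oo] --> 0 -> a n @[n --> \oo] --> 0.
Proof.
move=> a0 c; have pi : 0 < p^-1 by rewrite invr_gt0.
have := cvgn_comp (normr_powR_continuous pi) c.
rewrite normr0 powR0 ?gt_eqF //.
rewrite (_ : (fun n => _) = a) //; apply/funext => n.
by rewrite ger0_norm ?powR_ge0 // -powRrM mulfV ?gt_eqF // powRr1.
Qed.

(** Errors of 2^-n are summable, so the weighted p-th powers tend to 0 almost everywhere, and the
    weight is positive off the origin. *)
Lemma W0_seq u : W u -> exists ph : nat -> T -> R,
  [/\ forall n, Ccinf O (ph n), forall n, wcl (2^-1 ^+ n) (fun x => ph n x - u x) &
      {ae mu, forall x, ph n x @[n --> \oo] --> u x}].
Proof.
move=> /WP[mu_ ou hu].
have /choice[ph hph] : forall n, exists phi, Ccinf O phi /\ wcl (2^-1 ^+ n) (fun x => phi x - u x).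
  move=> n; have [|phi C1 C2] := hu (2^-1 ^+ n); first by rewrite exprn_gt0 // invr_gt0.
  by exists phi.
exists ph; split=> [n|n|]; [by have [] := hph n|by have [] := hph n|].
have h := @summable_ae_cvg0 _ _ _ mu (fun n => ip (fun x => ph n x - u x))
  (fun n => let: conj _ (And4 i1 _ _ _) := hph n in i1) (fun n x => ipd_ge0 _ _ _ _ _)
  (fun n => let: conj _ (And4 _ l1 _ _) := hph n in l1).
move: (ae_neq (zero_tuple (R := R))) h; apply: filterS2 => x nx c.
have [Ox|nOx] := pselect (O x); last first.
  rewrite ou // (_ : (fun n => ph n x) = fun=> 0); first exact: cvg_cst.
  by apply/funext => n; have [Cn _] := hph n; rewrite (Ccinf_off Cn nOx).
have wx := wmu_gt0 nx.
have c1 : `|ph n x - u x| `^ p @[n --> \oo] --> 0.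
  rewrite (_ : (fun n => _) = fun n => ip (fun x => ph n x - u x) x * (wmu beta x)^-1); last first.
    by apply/funext => n; rewrite /ipd /= indic_in // mul1r mulfK // gt_eqF.
  by rewrite -[X in _ --> X](mul0r (wmu beta x)^-1); apply: cvgM; [exact: c|exact: cvg_cst].
have c2 : `|ph n x - u x| @[n --> \oo] --> 0 by apply: (powR_cvg0 _ c1).
apply/cvgrPdist_lt => e e0; move/cvgr0Pnorm_lt: c2 => /(_ _ e0).
by apply: filterS => n; rewrite normr_id distrC.
Qed.

(** Contraction alone does not make the composed approximants converge in the seminorm, since it
    bounds increments without making their difference small. Almost everywhere convergence has to
    help: the increment of the error is at most 2 |u(x) - u(y)| plus the increment of the error of
    the original approximants. *)
Lemma W0_cut (k : R) u : 0 <= k -> W u -> W (fun x => Num.max (u x - k) 0).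
Proof.
move=> k0 Wu; have igu := igr_gad Wu; have [ph [Cph cph aeph]] := W0_seq Wu.
move/WP: Wu => [mu_ ou _].
pose cut (t : R) := Num.max (t - k) 0.
have mcut : mfun (fun x => cut (u x)) by rewrite /cut; measf.
apply/WP; split; [exact: mcut| |].
  by move=> x nx; rewrite ou // sub0r max_r // oppr_le0.
have m0 n : 0 < n.+1%:R :> R by [].
pose q n := softplus n.+1%:R k \o ph n.
have Cq n : Ccinf O (q n) by exact: Ccinf_softplus.
have mq n : mfun (q n) := Ccinf_meas (Cq n).
have mph n : mfun (ph n) := Ccinf_meas (Cph n).
pose w n x := q n x - cut (u x).
have mw_ n : mfun (w n) by have h := mq n; rewrite /w; measf.
pose c n : R := 2 * ln 2 / n.+1%:R.
have c_ge0 n : 0 <= c n by rewrite divr_ge0 // mulr_ge0 // ln_ge0 // ler1n.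
have c0 : c n @[n --> \oo] --> 0.
  rewrite -[X in _ --> X](mulr0 (2 * ln 2)); apply: cvgM; first exact: cvg_cst.
  exact: cvg_harmonic.
have cutlip a b : `|cut a - cut b| <= `|a - b|.
  apply: le_trans (pos_part_lip _ _) _.
  by rewrite (_ : a - k - (b - k) = a - b) //; ring.
have wb n x : `|w n x| <= `|ph n x - u x| + c n.
  rewrite (_ : w n x = (q n x - softplus n.+1%:R k (u x)) + (softplus n.+1%:R k (u x) - cut (u x))).
    by apply: le_trans (ler_normD _ _) (lerD (softplus_lip k (m0 n) _ _) (softplus_dist (m0 n) _ k0)).
  by rewrite /w; ring.
have Dwb n x y : `|w n x - w n y| <=
    2 * `|u x - u y| + `|ph n x - u x - (ph n y - u y)|.
  have h1 : `|q n x - q n y| <= `|ph n x - ph n y| := softplus_lip k (m0 n) _ _.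
  have h2 := cutlip (u x) (u y).
  have h3 : `|ph n x - ph n y| <= `|u x - u y| + `|ph n x - u x - (ph n y - u y)|.
    rewrite (_ : ph n x - ph n y = (u x - u y) + (ph n x - u x - (ph n y - u y))).
      exact: ler_normD.
    by ring.
  have h4 : `|w n x - w n y| <= `|q n x - q n y| + `|cut (u x) - cut (u y)|.
    rewrite (_ : w n x - w n y = (q n x - q n y) - (cut (u x) - cut (u y))).
      exact: ler_normB.
    by rewrite /w; ring.
  move: h1 h2 h3 h4; move: (`|_|) (`|_|) (`|_|) (`|_|) (`|_|) (`|_|) => a1 a2 a3 a4 a5 a6; lra.
pose A := Rintegral mu setT (fun x => \1_O x * wmu beta x).
have P0 : 0 <= 2 `^ p :> R by exact: powR_ge0.
have hI n : igr mu (ip (w n)) /\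
    Rintegral mu setT (ip (w n)) <= 2 `^ p * (2^-1 ^+ n + c n `^ p * A).
  have [i1 l1 _ _] := cph n.
  have i2 := igrZ (2 `^ p) (igrD i1 (igrZ (c n `^ p) iw)).
  have le x : ip (w n) x <= 2 `^ p * (ip (fun x => ph n x - u x) x + c n `^ p * (\1_O x * wmu beta x)).
    have -> : 2 `^ p * (ip (fun x => ph n x - u x) x + c n `^ p * (\1_O x * wmu beta x)) =
      \1_O x * (2 `^ p * (`|ph n x - u x| `^ p + c n `^ p)) * wmu beta x by rewrite /ipd; ring.
    rewrite ler_wpM2r // ler_wpM2l //.
    have := powR_normD `|ph n x - u x| (c n) p0; rewrite normr_id (ger0_norm (c_ge0 n)).
    apply: le_trans; apply: powR_le => //; first exact: ltW.
    by apply: le_trans (wb n x) _; exact: ler_norm.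
  have i3 : igr mu (ip (w n)).
    by apply: (igr_le (mf_ipd p beta oO (mw_ n)) _ i2) => x; rewrite ger0_norm ?ipd_ge0.
  split; first exact: i3.
  apply: le_trans (Rint_le i3 i2 le) _.
  rewrite Rint_Z ?Rint_D ?Rint_Z //; [|exact: igrZ|by apply: igrD => //; exact: igrZ].
  by rewrite ler_wpM2l // lerD2r.
(* The increment of the error, capped at 2 |u(x) - u(y)|, is dominated by an integrable density and
   tends to 0. What exceeds the cap is at most the increment of [ph n - u], whose contribution is at
   most 2^-n. *)
pose mn n z : R := \1_O z.1 * \1_O z.2 *
  (K z * Num.min `|w n z.1 - w n z.2| (2 * `|u z.1 - u z.2|) `^ p).
have mmn n : mfun (mn n).
  by rewrite /mn; move: (w n) (mw_ n) => v mv; measf.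
have mn0 n z : 0 <= mn n z.
  by apply: mulr_ge0; [rewrite mulr_ge0|exact: mulr_ge0 (K0 z) (powR_ge0 _ _)].
have [|||||_ cm] := @dominated_real _ _ _ m2 mn (fun=> 0) (fun z => 2 `^ p * ga u z).
- exact: mmn.
- exact: mf_cst.
- move: (ae_pair aeph); apply: filterS => -[x y] /= [cx cy].
  have wc x' : ph n x' @[n --> \oo] --> u x' -> w n x' @[n --> \oo] --> 0.
    move=> cv; apply/cvgr0Pnorm_le => e e0.
    have e20 : 0 < e / 2 by rewrite divr_gt0.
    move/cvgrPdist_le: cv => /(_ _ e20); move/cvgr0Pnorm_le: c0 => /(_ _ e20).
    apply: filterS2 => n; rewrite (ger0_norm (c_ge0 n)) distrC => h1 h2.
    by apply: le_trans (wb n x') _; move: (`|_|) h2 (c n) h1 => a h2 b h1; lra.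
  rewrite (_ : 0 = \1_O x * \1_O y * (K (x, y) * 0)); last by rewrite !mulr0.
  apply: cvgM; first exact: cvg_cst.
  apply: cvgM; first exact: cvg_cst.
  have cD : w n x - w n y @[n --> \oo] --> 0.
    by rewrite -[X in _ --> X](subr0 0); apply: cvgB; exact: wc.
  have c1 : `|w n x - w n y| `^ p @[n --> \oo] --> 0.
    by have := cvgn_comp (normr_powR_continuous p0) cD; rewrite normr0 powR0 // gt_eqF.
  apply: (squeeze_cvgr _ (cvg_cst 0) c1); apply: nearW => n; rewrite powR_ge0 /=.
  by apply: powR_le; rewrite ?(ltW p0) ?le_min ?normr_ge0 ?mulr_ge0 // ge_min lexx.
- exact: igrZ.
- move=> n; apply: nearW => z; rewrite ger0_norm // /mn /gad /edens.
  rewrite [leRHS]mulrCA ler_wpM2l ?mulr_ge0 // [leRHS]mulrCA ler_wpM2l //.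
  rewrite -powRM //; apply: powR_le; rewrite ?(ltW p0) ?le_min ?normr_ge0 ?mulr_ge0 //.
  by rewrite ge_min lexx orbT.
have z0 : Rintegral m2 setT (fun=> 0 : R) = 0 by rewrite /Rintegral integral0.
rewrite z0 in cm.
have imn n : igr m2 (mn n).
  apply: (igr_le (mmn n) _ (igrZ (2 `^ p) igu)) => z; rewrite ger0_norm // /mn /gad /edens.
  rewrite [leRHS]mulrCA ler_wpM2l ?mulr_ge0 // [leRHS]mulrCA ler_wpM2l //.
  rewrite -powRM //; apply: powR_le; rewrite ?(ltW p0) ?le_min ?normr_ge0 ?mulr_ge0 //.
  by rewrite ge_min lexx orbT.
have hG n : igr m2 (ga (w n)) /\
    Rintegral m2 setT (ga (w n)) <= 2 `^ p * (Rintegral m2 setT (mn n) + 2^-1 ^+ n).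
  have [_ _ i1 l1] := cph n.
  have i2 := igrZ (2 `^ p) (igrD (imn n) i1).
  have le z : ga (w n) z <= 2 `^ p * (mn n z + ga (fun x => ph n x - u x) z).
    have -> : 2 `^ p * (mn n z + ga (fun x => ph n x - u x) z) = \1_O z.1 * \1_O z.2 * (K z *
     (2 `^ p * (Num.min `|w n z.1 - w n z.2| (2 * `|u z.1 - u z.2|) `^ p +
       `|ph n z.1 - u z.1 - (ph n z.2 - u z.2)| `^ p))) by rewrite /mn /gad /edens; ring.
    rewrite ler_wpM2l ?mulr_ge0 // ler_wpM2l //.
    have M0 : 0 <= Num.min `|w n z.1 - w n z.2| (2 * `|u z.1 - u z.2|).
      by rewrite le_min normr_ge0 mulr_ge0.
    have := powR_normD (Num.min `|w n z.1 - w n z.2| (2 * `|u z.1 - u z.2|))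
      `|ph n z.1 - u z.1 - (ph n z.2 - u z.2)| p0.
    rewrite normr_id (ger0_norm M0); apply: le_trans; apply: powR_le => //; first exact: ltW.
    have h := Dwb n z.1 z.2; apply: le_trans (ler_norm _).
    case: (leP `|w n z.1 - w n z.2| (2 * `|u z.1 - u z.2|)) => _; first by rewrite lerDl.
    exact: h.
  have i3 : igr m2 (ga (w n)).
    by apply: (igr_le (mf_gad p s beta oO (mw_ n)) _ i2) => z; rewrite ger0_norm ?gad_ge0.
  split; first exact: i3.
  apply: le_trans (Rint_le i3 i2 le) _.
  rewrite Rint_Z ?Rint_D //; last exact: igrD.
  by rewrite ler_wpM2l // lerD2l.
have g0 : (2^-1 ^+ n : R) @[n --> \oo] --> 0.
  by apply: cvg_expr; rewrite ger0_norm ?invr_ge0 // invf_lt1 // ltr1n.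
have L1 : 2 `^ p * (2^-1 ^+ n + c n `^ p * A) @[n --> \oo] --> 0.
  rewrite (_ : 0 = 2 `^ p * (0 + 0 * A)); last by rewrite mul0r addr0 mulr0.
  apply: cvgM; first exact: cvg_cst.
  apply: cvgD; first exact: g0.
  apply: cvgM; last exact: cvg_cst.
  have := cvgn_comp (normr_powR_continuous p0) c0; rewrite normr0 powR0 ?gt_eqF //.
  by under eq_fun do rewrite (ger0_norm (c_ge0 _)).
have L2 : 2 `^ p * (Rintegral m2 setT (mn n) + 2^-1 ^+ n) @[n --> \oo] --> 0.
  rewrite (_ : 0 = 2 `^ p * (0 + 0)); last by rewrite addr0 mulr0.
  apply: cvgM; first exact: cvg_cst.
  by apply: cvgD; [exact: cm|exact: g0].
move=> e e0.
have h1 : \forall n \near \oo, 2 `^ p * (2^-1 ^+ n + c n `^ p * A) <= e.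
  exact: (@cvgr_le _ _ _ _ _ _ L1 _ e0).
have h2 : \forall n \near \oo, 2 `^ p * (Rintegral m2 setT (mn n) + 2^-1 ^+ n) <= e.
  exact: (@cvgr_le _ _ _ _ _ _ L2 _ e0).
have [n [H1 H2]] : exists n, 2 `^ p * (2^-1 ^+ n + c n `^ p * A) <= e /\
    2 `^ p * (Rintegral m2 setT (mn n) + 2^-1 ^+ n) <= e.
  by have [n0 _ h] := filterI h1 h2; exists n0; exact: (h n0 (leqnn _)).
exists (q n); first exact: Cq.
have [a1 a2] := hI n; have [a3 a4] := hG n.
by split; [exact: a1|exact: le_trans a2 H1|exact: a3|exact: le_trans a4 H2].
Qed.

End sobolev_lattice.

(** * Closedness, approximation and the Poincare inequality *)

Section sobolev_closure.
Context {R : realType} {N : nat}.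
Variables (p s beta : R) (O : set (N.-tuple R)).
Hypotheses (s01 : 0 < s < 1) (p1 : 1 < p) (pN : p < N%:R).
Hypotheses (b0 : 0 <= beta) (bN : beta < (N%:R - p * s) / 2).
Hypotheses (oO : eopen O) (bO : ebounded O) (O0 : O (zero_tuple (R := R))).

Local Notation T := (N.-tuple R).
Local Notation mu := (@muN R N).
Local Notation m2 := (mu \x mu)%E.
Local Notation mfun := (measurable_fun setT).
Local Notation K := (nuK p s beta O).
Implicit Types (x y : T) (phi u v w : T -> R) (z : T * T).

Let p0 : 0 < p. Proof. by have := p1; lra. Qed.
Let mO : measurable O := measurable_dom oO.
Let mK : mfun K := @mf_nuK R N p s beta O oO.
Let K0 z : 0 <= K z := @nuK_ge0 R N p s beta O z.

Local Notation W := (W0 p s beta O).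
Local Notation fe := (fin_energy mu p K).
Local Notation wcl := (wclose p s beta O).
Local Notation ip := (ipd p beta O).
Local Notation ga := (gad p s beta O).

Let w0 x : 0 <= wmu beta x := @wmu_ge0 R N beta x.
Let iw : igr mu (fun x => \1_O x * wmu beta x) := igr_wmu s01 p1 b0 bN oO bO.
Let feC := Ccinf_fin_energy s01 p1 pN b0 bN oO bO O0.
Let WP := W0P p s beta oO.
Let Wcut := W0_cut s01 p1 pN b0 bN oO bO O0.
Let WD := @W0_D R N p s beta O p1 oO.
Let WZ := @W0_Z R N p s beta O oO.

(** The energy controls the seminorm only. The weighted L^p part converges by domination, through
    the uniform bound k and the integrability of |x|^(-2 beta) over O. *)
Lemma W0_closed (v_ : nat -> T -> R) v (k : R) : (forall n, W (v_ n)) ->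
  (forall n x, `|v_ n x| <= k) -> mfun v -> (forall x, ~ O x -> v x = 0) ->
  {ae mu, forall x, v_ n x @[n --> \oo] --> v x} ->
  (forall e, 0 < e -> \forall n \near \oo, fe (fun x => v_ n x - v x) /\
     energy mu p K (fun x => v_ n x - v x) <= e) -> W v.
Proof.
move=> Wv vk mv ov cv hE; apply/WP; split; [exact: mv|exact: ov|] => e e0.
have k0 : 0 <= k by apply: le_trans (vk 0%N (zero_tuple (R := R))).
have mv_ n : mfun (v_ n) by have /WP[] := Wv n.
have P0 : 0 < 2 `^ p :> R by rewrite powR_gt0.
pose e' := e / (2 `^ p * 2).
have e'0 : 0 < e' by rewrite divr_gt0 // mulr_gt0.
have vb : {ae mu, forall x, `|v x| <= k}.
  apply: filterS cv => x cx.
  have c : `|v_ n x| @[n --> \oo] --> `|v x| by exact: cvg_norm.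
  rewrite leNgt; apply/negP => kv.
  have [n0 _ h] : \forall n \near \oo, k < `|v_ n x| by exact: (cvgr_gt _ c).
  by have := h n0 (leqnn _); rewrite ltNge vk.
pose f n := ip (fun x => v_ n x - v x).
have md n : mfun (fun x => v_ n x - v x) by have h := mv_ n; measf.
have dom n : {ae mu, forall x, `|f n x| <= (2 * k) `^ p * (\1_O x * wmu beta x)}.
  apply: filterS vb => x hx; rewrite ger0_norm ?ipd_ge0 // /f /ipd -mulrA mulrCA.
  rewrite ler_wpM2r ?mulr_ge0 //; apply: powR_le; [exact: ltW|by []|].
  by apply: le_trans (ler_normB _ _) _; rewrite mulr2n mulrDl mul1r lerD.
have [|||||_ cf] := @dominated_real _ _ _ mu f (fun=> 0)
  (fun x => (2 * k) `^ p * (\1_O x * wmu beta x)).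
- by move=> n; apply: mf_ipd => //; exact: md.
- exact: mf_cst.
- apply: filterS cv => x cx.
  rewrite (_ : 0 = \1_O x * 0 * wmu beta x); last by rewrite mulr0 mul0r.
  apply: cvgM; last exact: cvg_cst.
  apply: cvgM; first exact: cvg_cst.
  have cD : v_ n x - v x @[n --> \oo] --> 0.
    by rewrite -[X in _ --> X](subrr (v x)); apply: cvgB => //; exact: cvg_cst.
  by have := cvgn_comp (normr_powR_continuous p0) cD; rewrite normr0 powR0 // gt_eqF.
- exact: igrZ.
- exact: dom.
have z0 : Rintegral mu setT (fun=> 0 : R) = 0 by rewrite /Rintegral integral0.
rewrite z0 in cf.
have h1 : \forall n \near \oo, Rintegral mu setT (f n) <= e' by exact: (@cvgr_le _ _ _ _ _ _ cf _ e'0).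
have [n0 _ h] := filterI h1 (hE _ e'0).
have [l1 [i2 l2]] := h n0 (leqnn _).
have cn : wcl e' (fun x => v_ n0 x - v x).
  have igx : igr mu (f n0).
    apply: (igr_le_ae _ (dom n0)) => //; last exact: igrZ.
    by apply: mf_ipd => //; exact: md.
  have mg := mf_gad p s beta oO (md n0).
  have igg : igr m2 (ga (fun x => v_ n0 x - v x)).
    by apply: (igr_le mg _ i2) => z; rewrite ger0_norm ?gad_ge0 // gad_le_edens.
  split; [exact: igx|exact: l1|exact: igg|].
  by apply: le_trans l2; apply: (Rint_le igg i2) => z; exact: gad_le_edens.
have /WP[_ _ hv] := Wv n0; have [phi Cp cp] := hv _ e'0.
exists phi => //; have mp : mfun phi := Ccinf_meas Cp.
have m1 : mfun (fun x => phi x - v_ n0 x) by have h' := mv_ n0; measf.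
have := wclose_D p1 oO m1 (md n0) cp cn.
rewrite (_ : 2 `^ p * (e' + e') = e); last by rewrite /e'; field; rewrite gt_eqF.
by rewrite (_ : (fun x => phi x - v_ n0 x + _) = (fun x => phi x - v x)) //; apply/funext => x; ring.
Qed.

Lemma W0_Tk (k : R) u : 0 <= k -> W u -> W (fun x => Tk k (u x)).
Proof.
move=> k0 Wu; have Wn := WZ (-1) Wu.
have pos w : W w -> W (fun x => Num.max (w x) 0).
  move=> Ww; have := Wcut (lexx 0) Ww.
  by congr W0; apply/funext => x; rewrite subr0.
have h1 := WD (pos _ Wu) (WZ (-1) (Wcut k0 Wu)).
have h2 := WD (pos _ Wn) (WZ (-1) (Wcut k0 Wn)).
rewrite (_ : (fun x => _) = (fun x => Num.max (u x) 0 + -1 * Num.max (u x - k) 0 +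
     -1 * (Num.max (-1 * u x) 0 + -1 * Num.max (-1 * u x - k) 0))).
  exact: (WD h1 (WZ (-1) h2)).
by apply/funext => x; exact: TkE.
Qed.

Lemma Ccinf_W0 phi : Ccinf O phi -> W phi.
Proof.
move=> Cp; apply/WP; split; [exact: Ccinf_meas Cp|by move=> x; exact: Ccinf_off|] => e e0.
exists phi => //.
have z1 : ip (fun x => phi x - phi x) = fun=> 0.
  by apply/funext => x; rewrite /ipd subrr normr0 powR0 ?gt_eqF // mulr0 mul0r.
have z2 : ga (fun x => phi x - phi x) = fun=> 0.
  by apply/funext => x; rewrite /gad /edens !subrr normr0 powR0 ?gt_eqF // !mulr0.
have r1 : Rintegral mu setT (fun=> 0 : R) = 0 by rewrite /Rintegral integral0.
have r2 : Rintegral m2 setT (fun=> 0 : R) = 0 by rewrite /Rintegral integral0.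
by split; rewrite ?z1 ?z2 ?r1 ?r2 ?(ltW e0) //; exact: igr0.
Qed.

(** Truncating at M preserves the bound, and truncation contracts increments, so those of T_M (ph n)
    exceed those of phi by at most those of ph n - phi. This one-sided comparison stands in for
    convergence of the truncated functions in the seminorm. *)
Lemma W0_approx phi (M : R) : W phi -> (forall x, `|phi x| <= M) ->
  igr m2 (fun z => \1_O z.1 * \1_O z.2 * edens p K phi z) /\
  exists (phi_ : nat -> T -> R) (dd : nat -> T * T -> R),
  [/\ (forall n, W (phi_ n) /\ fe (phi_ n)), (forall n x, `|phi_ n x| <= M),
      {ae mu, forall x, phi_ n x @[n --> \oo] --> phi x},
      (forall n z, 0 <= dd n z) /\ (forall n z, O z.1 -> O z.2 ->
        `|phi_ n z.1 - phi_ n z.2| <= `|phi z.1 - phi z.2| + dd n z) &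
      (forall n, mfun (dd n)) /\ (forall e, 0 < e -> \forall n \near \oo,
        igr m2 (fun z => \1_O z.1 * \1_O z.2 * (K z * dd n z `^ p)) /\
        Rintegral m2 setT (fun z => \1_O z.1 * \1_O z.2 * (K z * dd n z `^ p)) <= e)].
Proof.
move=> Wp pM; split; first exact: (igr_gad s01 p1 pN b0 bN oO bO O0 Wp).
have M0 : 0 <= M by apply: le_trans (pM (zero_tuple (R := R))).
have mp : mfun phi by have /WP[] := Wp.
have [ph [Cph cph aeph]] := W0_seq p1 pN oO Wp.
have mph n : mfun (ph n) := Ccinf_meas (Cph n).
exists (fun n x => Tk M (ph n x)).
exists (fun n z => `|ph n z.1 - phi z.1 - (ph n z.2 - phi z.2)|).
split.
- move=> n; split; first by apply: W0_Tk => //; exact: Ccinf_W0.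
  apply: (igr_le _ _ (feC (Cph n))); first by have h := mph n; rewrite /edens; measf.
  move=> z; rewrite ger0_norm; last exact: mulr_ge0 (K0 z) (powR_ge0 _ _).
  apply: (ler_wpM2l (K0 z)); apply: powR_le; [exact: ltW|by []|exact: Tk_lip].
- by move=> n x; exact: Tk_norm.
- apply: filterS aeph => x cx; rewrite -(@Tk_id _ M (phi x)) //.
  exact: (cvgn_comp (Tk_continuous M0) cx).
- split=> [n z //|n z _ _]; apply: le_trans (Tk_lip _ _ M0) _.
  rewrite (_ : ph n z.1 - ph n z.2 = (phi z.1 - phi z.2) + (ph n z.1 - phi z.1 - (ph n z.2 - phi z.2))).
    exact: ler_normD.
  by ring.
split=> [n|e e0]; first by have h := mph n; measf.
have g0 : (2^-1 ^+ n : R) @[n --> \oo] --> 0.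
  by apply: cvg_expr; rewrite ger0_norm ?invr_ge0 // invf_lt1 // ltr1n.
have h : \forall n \near \oo, (2^-1 ^+ n : R) <= e by exact: (@cvgr_le _ _ _ _ _ _ g0 _ e0).
apply: filterS h => n hn; have [_ _ i l] := cph n.
by split; [exact: i|exact: le_trans l hn].
Qed.

Lemma GagDE v : mfun v -> GagD p s beta O v = (\int[m2]_z (edens p K v z)%:E)%E.
Proof.
move=> mv; have me : mfun (edens p K v) by rewrite /edens; measf.
have e z : indD O z.1 z.2 * `|v z.1 - v z.2| `^ p * knu p s beta z.1 z.2 = 2 * edens p K v z.
  by rewrite /edens /nuK; move: (indD _ _ _) (knu _ _ _ _ _) (_ `^ _) => a b c; field.
have en0 z : 0 <= edens p K v z by exact: mulr_ge0 (K0 z) (powR_ge0 _ _).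
rewrite /GagD int2NE; under eq_fun do rewrite e; last by measf.
rewrite sint_ge0; last by move=> z; rewrite mulr_ge0.
under eq_integral do rewrite EFinM.
rewrite ge0_integralZl_EFin //; [|by move=> z _; rewrite lee_fin|exact/measurable_EFinP].
by rewrite muleA -EFinM mulVf // mul1e.
Qed.

Lemma W0_poincare (lam' : R) v : 0 < lam' -> (lam'%:E <= lambda1 p s beta O)%E -> W v -> fe v ->
  igr mu (fun x => \1_O x * `|v x| `^ p) /\
  lam' * Rintegral mu setT (fun x => \1_O x * `|v x| `^ p) <= energy mu p K v.
Proof.
move=> l0 hl Wv fv; have /WP[mv ov _] := Wv.
have mI : mfun (fun x => \1_O x * `|v x| `^ p) by measf.
have I0 x : 0 <= \1_O x * `|v x| `^ p by rewrite mulr_ge0 ?powR_ge0.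
have E0 : 0 <= energy mu p K v.
  by apply: Rint_ge0 => z; exact: mulr_ge0 (K0 z) (powR_ge0 _ _).
have [v0|v0] := pselect (aeN (fun x => v x = 0)).
  have [] := @igr_ae _ _ _ mu (fun=> 0) (fun x => \1_O x * `|v x| `^ p) _ mI (igr0 mu).
    move/aeNE: v0; apply: filterS => x ->.
    by rewrite normr0 powR0 ?gt_eqF // mulr0.
  by move=> i1 <-; split => //; rewrite /Rintegral integral0 mulr0.
have : (lam'%:E <= (energy mu p K v)%:E *
    ((fine (intN (fun x => (\1_O x * `|v x| `^ p)%R)))^-1)%:E)%E.
  apply: le_trans hl _; apply: ereal_inf_lbound; exists v; split => //; split => //.
  by rewrite GagDE // EFin_Rintegral.
rewrite intNE // sint_ge0 // -EFinM lee_fin => h.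
have J0 : (0 <= \int[mu]_x (\1_O x * `|v x| `^ p)%:E)%E.
  by apply: integral_ge0 => x _; rewrite lee_fin.
(* An infinite denominator would be read as 0 by [fine] and its inverse as 0, so the quotient would
   be 0, against lam' > 0. *)
have iI : igr mu (fun x => \1_O x * `|v x| `^ p).
  apply/igr_ge0P => //; rewrite ltey; apply/eqP => e.
  by move: h; rewrite e /= invr0 mulr0 leNgt l0.
split => //; rewrite -/(Rintegral mu setT (fun x => \1_O x * `|v x| `^ p)) in h.
have R0 := Rint_ge0 mu I0.
have [e|ne] := eqVneq (Rintegral mu setT (fun x => \1_O x * `|v x| `^ p)) 0.
  by rewrite e mulr0.
by rewrite -ler_pdivlMr // lt_neqAle eq_sym ne.
Qed.

End sobolev_closure.

(** * The gain of measure and admissibility of [W0] *)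

Section concrete_admissible.
Context {R : realType} {N : nat}.
Variables (p s beta : R) (O : set (N.-tuple R)).
Hypotheses (s01 : 0 < s < 1) (p1 : 1 < p) (pN : p < N%:R).
Hypotheses (b0 : 0 <= beta) (bN : beta < (N%:R - p * s) / 2).
Hypotheses (oO : eopen O) (bO : ebounded O) (O0 : O (zero_tuple (R := R))).

Local Notation T := (N.-tuple R).
Local Notation mu := (@muN R N).
Local Notation m2 := (mu \x mu)%E.
Local Notation mfun := (measurable_fun setT).
Local Notation K := (nuK p s beta O).
Implicit Types (x y : T) (phi u v w : T -> R) (z : T * T).

Let p0 : 0 < p. Proof. by have := p1; lra. Qed.
Let ps0 : 0 < p * s. Proof. by case/andP: s01 => s0 _; rewrite mulr_gt0. Qed.
Let mO : measurable O := measurable_dom oO.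
Let mK : mfun K := @mf_nuK R N p s beta O oO.
Let K0 z : 0 <= K z := @nuK_ge0 R N p s beta O z.
Let m1O : mfun (\1_O : T -> R) := mf_indic mO.

Local Notation W := (W0 p s beta O).

Let N0 : 0 < N%:R :> R. Proof. by have := p0; move/lt_trans; apply. Qed.
Let sg : R := p * s / N%:R.
Let sg0 : 0 < sg. Proof. by rewrite divr_gt0. Qed.

(* The cube of measure [2 |E|] around a point of [E'] leaves [E] on a set of measure
   at least [|E|], on which the kernel is at least of order [|E|^-(1 + sg)]. *)
Lemma kernel_cube_bound : exists2 Q : R, 0 < Q & forall (a : R) x, 0 < a -> a <= fine (mu O) ->
  O x -> x <> zero_tuple (R := R) -> exists2 r : R, 0 <= r & (2 * r) ^+ N = 2 * a /\
  forall y, cube x r y -> y <> x -> y <> zero_tuple (R := R) ->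
    (a * (a `^ sg * Q))^-1 <= K (x, y).
Proof.
have [M M0 hM] := dom_norm_bound bO.
pose V := fine (mu O); pose r1 := (2 * V) `^ N%:R^-1 / 2.
have V0 : 0 <= V by rewrite fine_ge0.
have r10 : 0 <= r1 by rewrite divr_ge0 ?powR_ge0.
pose M1 := N%:R * (M + r1).
have M10 : 0 < M1 by rewrite mulr_gt0 // ltr_wpDr.
(* The first 2 undoes the 1/2 in the kernel. The next two factors come from |x - y| <= N t / 2 with
   t = (2a)^(1/N), as t^(N+ps) = (2a)^(1+sg). [M] and [M1] bound |x| and |y|. *)
pose Q := 2 * (N%:R / 2) `^ (N%:R + p * s) * 2 `^ (1 + sg) * (M `^ beta * M1 `^ beta).
have Q0 : 0 < Q by rewrite /Q !mulr_gt0 ?powR_gt0 // divr_gt0.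
exists Q => // a x a0 aV Ox nx.
pose t := (2 * a) `^ N%:R^-1.
have a20 : 0 < 2 * a by rewrite mulr_gt0.
have t0 : 0 < t by rewrite powR_gt0.
have tN : t ^+ N = 2 * a.
  by rewrite -powR_mulrn ?powR_ge0 // -powRrM mulVf ?gt_eqF // powRr1 // ltW.
exists (t / 2); first by rewrite divr_ge0 // ltW.
have e2 : 2 * (t / 2) = t by field.
split; first by rewrite e2.
move=> y hy nyx ny0.
have r_le : t / 2 <= r1.
  rewrite ler_pM2r ?invr_gt0 //; apply: powR_le; [by rewrite invr_ge0|exact: ltW|].
  by rewrite ler_pM2l.
have pos (w : T) : w <> zero_tuple (R := R) -> 0 < enorm w.
  move=> nw; rewrite lt_neqAle enorm_ge0 andbT eq_sym.
  by apply/eqP; rewrite enormE => /edist_eq0 /esym.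
have D0 : 0 < edist x y.
  rewrite lt_neqAle edist_ge0 andbT eq_sym; apply/eqP => /edist_eq0 e.
  by apply: nyx; rewrite e.
have DN : edist x y <= N%:R * (t / 2).
  by apply: edist_le => //; rewrite divr_ge0 // ltW.
have yM : enorm y <= M1.
  rewrite enormE; apply: edist_le; first by rewrite addr_ge0 // ltW.
  move=> i; rewrite tnth_mktuple sub0r normrN.
  have h1 : `|tnth x i| <= M.
    apply: le_trans (hM _ Ox); rewrite enormE.
    by have := edist_coord (zero_tuple (R := R)) x i; rewrite tnth_mktuple sub0r normrN.
  have h2 := hy i.
  rewrite (_ : tnth y i = tnth x i - (tnth x i - tnth y i)); last by ring.
  apply: le_trans (ler_normB _ _) _; apply: lerD => //; exact: le_trans h2 r_le.
have hD : edist x y `^ (N%:R + p * s) <= (N%:R / 2) `^ (N%:R + p * s) * (2 * a) `^ (1 + sg).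
  have -> : (2 * a) `^ (1 + sg) = t `^ (N%:R + p * s).
    rewrite /t -powRrM; congr (_ `^ _); rewrite /sg; field.
    by rewrite gt_eqF.
  rewrite -powRM ?divr_ge0 ?(ltW t0) //; apply: powR_le.
  - by rewrite addr_ge0 // ltW.
  - exact: edist_ge0.
  - by apply: le_trans DN _; rewrite mulrCA mulrC.
rewrite /nuK /= indDE (indic_in Ox) mul1r addrK mulr1 /knu -invfM.
rewrite lef_pV2 ?posrE; last 2 first.
- by rewrite mulr_gt0 // mulr_gt0 // powR_gt0.
- by rewrite !mulr_gt0 ?powR_gt0 ?pos.
have -> : a * (a `^ sg * Q) = 2 * ((N%:R / 2) `^ (N%:R + p * s) * (2 * a) `^ (1 + sg) *
    M `^ beta * M1 `^ beta).
  rewrite [(2 * a) `^ _]powRM //; last exact: ltW.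
  rewrite [a `^ (1 + sg)]powRD; last by rewrite (gt_eqF a0) implybT.
  rewrite powRr1 ?(ltW a0) // /Q; move: (a `^ sg) (2 `^ _) ((N%:R / 2) `^ _) (M `^ _) (M1 `^ _) => b1 b2 b3 b4 b5.
  by ring.
rewrite ler_pM2l //; apply: ler_pM; rewrite ?mulr_ge0 ?powR_ge0 //; last first.
  by apply: powR_le => //; exact: enorm_ge0.
apply: ler_pM; rewrite ?mulr_ge0 ?powR_ge0 //.
by apply: powR_le => //; [exact: enorm_ge0|exact: hM].
Qed.

(** With a = |E|, the part of the cube outside E has measure at least 2a - a, so each x in E' other
    than the origin contributes at least 1 / (a^sg Q); integration over E' concludes. If |E| = 0
    then |E'| = 0 as well. *)
Lemma W0_gain : exists2 C : R, 0 < C & forall E' E : set T, measurable E' -> measurable E ->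
  E' `<=` E -> E `<=` O -> igr m2 (fun z => \1_E' z.1 * \1_(~` E) z.2 * K z) ->
  fine (mu E') <= C * fine (mu E) `^ sg *
    Rintegral m2 setT (fun z => \1_E' z.1 * \1_(~` E) z.2 * K z).
Proof.
have [Q Q0 hQ] := kernel_cube_bound; exists Q => // E' E mE' mE E'E EO iF.
have [iO fO] : igr mu (\1_O : T -> R) /\ (mu O < +oo)%E.
  have i := @igr_dom R N O oO bO; split => //.
  move/(igr_ge0P mu m1O (fun x => ler0n _ _)): i.
  by rewrite integral_indic // setIT.
have fE : (mu E < +oo)%E by apply: le_lt_trans (le_measure _ _ _ EO) fO; rewrite inE.
have fE' : (mu E' < +oo)%E by apply: le_lt_trans (le_measure _ _ _ E'E) fE; rewrite inE.
have ffin (B : set T) : (mu B < +oo)%E -> mu B \is a fin_num.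
  by move=> h; rewrite ge0_fin_numE.
set F := fun z : T * T => \1_E' z.1 * \1_(~` E) z.2 * K z.
have F0 z : 0 <= F z by exact: mulr_ge0 (mulr_ge0 (ler0n _ _) (ler0n _ _)) (K0 z).
have RF0 : 0 <= Rintegral m2 setT F by exact: Rint_ge0.
pose a := fine (mu E).
have a_ge0 : 0 <= a by rewrite fine_ge0.
have le' : fine (mu E') <= a.
  by rewrite fine_le ?ffin // le_measure ?inE.
have [a0|an0] := eqVneq a 0.
  apply: le_trans le' _; rewrite a0 mulr_ge0 // mulr_ge0 ?powR_ge0 //; exact: ltW.
have a_gt0 : 0 < a by rewrite lt_neqAle eq_sym an0.
have aV : a <= fine (mu O) by rewrite fine_le ?ffin // le_measure ?inE.
pose c := (a `^ sg * Q)^-1.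
have c_gt0 : 0 < c by rewrite invr_gt0 mulr_gt0 // powR_gt0.
have inner x : E' x -> x <> zero_tuple (R := R) -> (c%:E <= \int[mu]_y (F (x, y))%:E)%E.
  move=> E'x nx; have [r r0 [rN hr]] := hQ _ x a_gt0 aV (EO _ (E'E _ E'x)) nx.
  pose S := cube x r `\` E.
  have mc := measurable_cube x r.
  have mS : measurable S by exact: measurableD.
  have aS : (a%:E <= mu S)%E.
    have h : (mu (cube x r) <= mu S + mu E)%E.
      apply: le_trans (measureU2 _ mS mE); apply: le_measure; rewrite ?inE //.
        exact: measurableU.
      by move=> y cy; have [Ey|nEy] := pselect (E y); [right|left].
    move: h; rewrite muN_cube // rN -(fineK (ffin _ fE)) -/a.
    by rewrite -leeBlDr // -EFinB (_ : 2 * a - a = a) //; ring.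
  pose k := (a * (a `^ sg * Q))^-1.
  have k0 : 0 < k by rewrite invr_gt0 mulr_gt0 // mulr_gt0 // powR_gt0.
  apply: (@le_trans _ _ (\int[mu]_y (k * \1_S y)%:E)%E).
    under eq_integral do rewrite EFinM.
    rewrite ge0_integralZl_EFin; [|by []|by move=> y _; rewrite lee_fin| |exact: ltW]; last first.
      by apply/measurable_EFinP; exact: measurable_indic.
    rewrite integral_indic // setIT (_ : c = k * a).
      by rewrite EFinM; apply: lee_wpmul2l => //; rewrite lee_fin ltW.
    by rewrite /c /k [in RHS]invfM mulrAC mulVf ?gt_eqF // mul1r.
  have mFx : mfun (fun y => F (x, y)).
    rewrite /F /=; apply: mf_M; first by apply: mf_M; [exact: mf_cst|apply: mf_indic; exact: measurableC].
    by apply: (measurableT_comp mK); exact: measurable_pair1.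
  apply: ae_ge0_le_integral => //.
  - by move=> y _; rewrite lee_fin mulr_ge0 // ltW.
  - by apply/measurable_EFinP; apply: mf_M; [exact: mf_cst|exact: mf_indic].
  - by move=> y _; rewrite lee_fin.
  - exact/measurable_EFinP.
  have := ae_neq p1 pN x; have := ae_neq p1 pN (zero_tuple (R := R)).
  apply: filterS2 => y ny0 nyx _; rewrite lee_fin.
  have [Sy|nSy] := pselect (S y); last by rewrite (indic_out nSy) mulr0.
  have [cy nEy] := Sy; rewrite (indic_in Sy) mulr1 /F /= (indic_in E'x) indic_Cin // !mul1r.
  exact: hr.
have key : ((c * fine (mu E'))%:E <= (Rintegral m2 setT F)%:E)%E.
  have mF : mfun F := igr_meas iF.
  have mFE : measurable_fun setT (fun z => (F z)%:E) by exact/measurable_EFinP.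
  have [i1 e1] := igr_indic mE' fE'.
  rewrite -EFin_Rintegral // fubini_tonelli1 //.
  rewrite -e1 -Rint_Z // -EFin_Rintegral; last exact: igrZ.
  apply: ae_ge0_le_integral => //.
  - by move=> x _; rewrite lee_fin mulr_ge0 // ltW.
  - by apply/measurable_EFinP; apply: mf_M; [exact: mf_cst|exact: mf_indic].
  - by move=> x _; apply: integral_ge0 => y _; rewrite lee_fin.
  - by apply: measurable_fun_fubini_tonelli_F => // z; rewrite lee_fin.
  have := ae_neq p1 pN (zero_tuple (R := R)).
  apply: filterS => x nx _; have [E'x|nE'x] := pselect (E' x).
    by rewrite (indic_in E'x) mulr1; exact: inner.
  rewrite (indic_out nE'x) mulr0.
  by apply: integral_ge0 => y _; rewrite lee_fin.
move: key; rewrite lee_fin /c mulrC ler_pdivrMr ?mulr_gt0 ?powR_gt0 // -/a.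
by rewrite mulrC (mulrC Q).
Qed.

Lemma W0_admissible (lam' : R) : 0 < lam' -> (lam'%:E <= lambda1 p s beta O)%E ->
  admissible mu p K O W lam' sg.
Proof.
move=> l0 hl; split.
- exact: p1.
- exact: mO.
- have i := @igr_dom R N O oO bO.
  move/(igr_ge0P mu m1O (fun x => ler0n _ _)): i.
  by rewrite integral_indic // setIT.
- exact: mK.
- exact: K0.
- exact: W0_0.
- by move=> u [].
- by move=> u [_ []].
- by move=> u v; exact: W0_D.
- by move=> c u; exact: W0_Z.
- by move=> k u; exact: W0_cut.
- by move=> v_ v k; exact: W0_closed.
- exact: l0.
- by move=> v; exact: W0_poincare.
- exact: sg0.
- exact: W0_gain.
- by move=> phi M; exact: W0_approx.
Qed.

End concrete_admissible.

(** * Back to the integrals of the statement *)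

Section signed_integral_more.
Context {d : measure_display} {T : measurableType d} {R : realType}.
Variable m : {measure set T -> \bar R}.
Implicit Types F G : T -> R.

Lemma sint_ae F G : measurable_fun setT F -> measurable_fun setT G ->
  {ae m, forall z, F z = G z} -> sint m F = sint m G.
Proof.
move=> mF mG h; rewrite /sint; congr (_ - _)%E; apply: ae_eq_integral => //.
- by apply/measurable_EFinP; measf.
- by apply/measurable_EFinP; measf.
- by apply: filterS h => z ->.
- by apply/measurable_EFinP; measf.
- by apply/measurable_EFinP; measf.
- by apply: filterS h => z ->.
Qed.

(** Brings the factor 1/2, which the statement keeps outside the integral, into the kernel; infinite
    parts have to be followed through the subtraction. *)
Lemma sintZ (c : R) F : 0 < c -> measurable_fun setT F ->
  (c%:E * sint m F)%E = sint m (fun z => c * F z).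
Proof.
move=> c0 mF; rewrite /sint.
have e (G : T -> R) : measurable_fun setT G ->
    (\int[m]_z (Num.max (c * G z) 0)%:E = c%:E * \int[m]_z (Num.max (G z) 0)%:E)%E.
  move=> mG; rewrite -ge0_integralZl_EFin; [|by []|by move=> z _; rewrite lee_fin le_max lexx orbT| |exact: ltW].
    apply: eq_integral => z _; rewrite -EFinM; congr EFin.
    by rewrite [in RHS]maxr_pMr ?mulr0 // ltW.
  by apply/measurable_EFinP; measf.
have e' : (\int[m]_z (Num.max (- (c * F z)) 0)%:E = c%:E * \int[m]_z (Num.max (- F z) 0)%:E)%E.
  rewrite -(e (fun z => - F z)); last by measf.
  by apply: eq_integral => z _; rewrite mulrN.
rewrite (e _ mF) e'.
have : (0 <= \int[m]_z (Num.max (F z) 0)%:E)%E.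
  by apply: integral_ge0 => z _; rewrite lee_fin le_max lexx orbT.
have : (0 <= \int[m]_z (Num.max (- F z) 0)%:E)%E.
  by apply: integral_ge0 => z _; rewrite lee_fin le_max lexx orbT.
case: (\int[m]_z _)%E => [a||] //; case: (\int[m]_z _)%E => [b||] // _ _.
- by rewrite -EFinB -!EFinM -EFinB mulrBr.
- by rewrite /= gt0_muley ?lte_fin //.
- by rewrite /= gt0_muleNy ?gt0_muley ?lte_fin //.
- by rewrite /= gt0_muleNy ?gt0_muley ?lte_fin //.
Qed.

End signed_integral_more.

Section concrete_translation.
Context {R : realType} {N : nat}.
Variables (p s beta : R) (O : set (N.-tuple R)).
Hypotheses (s01 : 0 < s < 1) (p1 : 1 < p) (pN : p < N%:R).
Hypotheses (b0 : 0 <= beta) (bN : beta < (N%:R - p * s) / 2).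
Hypotheses (oO : eopen O) (bO : ebounded O) (O0 : O (zero_tuple (R := R))).

Local Notation T := (N.-tuple R).
Local Notation mu := (@muN R N).
Local Notation m2 := (mu \x mu)%E.
Local Notation mfun := (measurable_fun setT).
Local Notation K := (nuK p s beta O).
Implicit Types (x y : T) (phi u v w : T -> R) (z : T * T).

Let mO : measurable O := measurable_dom oO.
Let K0 z : 0 <= K z := @nuK_ge0 R N p s beta O z.

Variables (lam : R) (g g' : T -> R).
Hypotheses (mg : mfun g) (ig' : igr mu g') (gg' : {ae mu, forall x, \1_O x * g x = g' x}).

Lemma entropy_form_translation u phi phi' (k : R) : mfun u -> mfun phi -> mfun phi' ->
  {ae mu, forall x, phi x = phi' x} ->
  ((2^-1)%:E * int2N (fun x y => (indD O x y *
        (`|u x - u y| `^ (p - 2) * (u x - u y)) *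
        (Tk k (u x - phi x) - Tk k (u y - phi y)) * knu p s beta x y)%R))%E =
  sint m2 (aform p K u (fun x => Tk k (u x - phi' x))).
Proof.
move=> mu_ mp mp' pp'; have mk := @mf_knu R N p s beta; have mi := @mf_indD R N O oO.
have mD (f : T -> R) : mfun f -> mfun (fun z : T * T => f z.1 - f z.2).
  by move=> mf; exact: mf_D (mf_fst mf) (mf_N (mf_snd mf)).
have mT (f : T -> R) : mfun f -> mfun (fun x => Tk k (u x - f x)).
  by move=> mf; exact: mf_Tk (mf_D mu_ (mf_N mf)).
have mF : mfun (fun z : T * T => indD O z.1 z.2 *
    (`|u z.1 - u z.2| `^ (p - 2) * (u z.1 - u z.2)) *
    (Tk k (u z.1 - phi z.1) - Tk k (u z.2 - phi z.2)) * knu p s beta z.1 z.2).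
  exact: mf_M (mf_M (mf_M mi (mf_M (mf_pow _ (mf_norm (mD _ mu_))) (mD _ mu_))) (mD _ (mT _ mp))) mk.
rewrite int2NE; last exact: mF.
rewrite sintZ; [|by rewrite invr_gt0|exact: mF].
apply: sint_ae; [exact: mf_M (mf_cst _) mF|
  exact: mf_M (@mf_nuK R N p s beta O oO) (mf_M (mf_Phi p (mD _ mu_)) (mD _ (mT _ mp')))|].
move: (ae_pair pp'); apply: filterS => z [-> ->]; rewrite /aform /nuK /Phi.
by move: (indD _ _ _) (knu _ _ _ _ _) (_ `^ _) (Tk _ _) (Tk _ _) => a b c e f; ring.
Qed.

(** The abstract theorem wants a datum on the whole space, while the statement looks at g on O only.
    As u vanishes off O, so does u^(p-1), and the two data agree after restriction to O. *)
Lemma datum_ae u : (forall x, ~ O x -> u x = 0) ->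
  {ae mu, forall x, \1_O x * (lam * u x `^ (p - 1) + g x) = datum p lam g' u x}.
Proof.
move=> ou; apply: filterS gg' => x; rewrite /datum => <-; rewrite mulrDr; congr (_ + _).
have [Ox|nx] := pselect (O x); first by rewrite indic_in // mul1r.
by rewrite ou // powR0 ?mulr0 // gt_eqF // subr_gt0.
Qed.

Lemma datum_integral_translation u phi phi' (k : R) : 0 < k -> mfun u ->
  (forall x, ~ O x -> u x = 0) -> igr mu (fun x => u x `^ (p - 1)) -> mfun phi -> mfun phi' ->
  {ae mu, forall x, phi x = phi' x} ->
  intN (fun x => (\1_O x * (lam * u x `^ (p - 1) + g x) * Tk k (u x - phi x))%R) =
  (Rintegral mu setT (fun x => datum p lam g' u x * Tk k (u x - phi' x)))%:E.
Proof.
move=> k0 mu_ ou iu mp mp' pp'.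
have id_ := igr_datum lam ig' iu; have md := igr_meas id_.
have mdT : mfun (fun x => datum p lam g' u x * Tk k (u x - phi' x)) by measf.
have mT : mfun (fun x => \1_O x * (lam * u x `^ (p - 1) + g x) * Tk k (u x - phi x)) by measf.
rewrite intNE // -sintE; last first.
  apply: (igr_le mdT _ (igrZ k (integrable_norm id_))) => x /=.
  by rewrite normrM mulrC ler_wpM2r // Tk_norm // ltW.
apply: sint_ae => //; move: (datum_ae ou) pp'.
by apply: filterS2 => x -> ->.
Qed.

Lemma measurable_Rh u (h : R) : mfun u -> mfun (fun z : T * T => if `[< Rh u h z.1 z.2 >] then 1 else 0 : R).
Proof.
move=> mu_.
pose S := [set z : T * T | h + 1 <= Num.max `|u z.1| `|u z.2|] `&`
  ([set z | Num.min `|u z.1| `|u z.2| <= h] `|` [set z | 0 < - (u z.1 * u z.2)]).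
have mS : measurable S.
  apply: measurableI; first by apply: measurable_ge; measf.
  by apply: measurableU; [apply: measurable_le|apply: measurable_gt]; measf.
rewrite (_ : (fun z => _) = (\1_S : T * T -> R)); first exact: mf_indic.
apply/funext => z; have e : Rh u h z.1 z.2 <-> S z by rewrite /Rh /S /= oppr_gt0.
case: ifP => /asboolP hz; first by rewrite indic_in //; exact/e.
by rewrite indic_out // => /e.
Qed.

(** For u >= 0 the sign alternative in [Rh] cannot occur. Otherwise T_1 (u - T_h u) is 1 at the
    larger value and 0 at the smaller one, so the tested form reproduces |u(x) - u(y)|^(p-1) against
    the kernel; the factor 2 undoes the 1/2. *)
Lemma tail_translation (lam' : R) u (h : R) : 0 < lam' -> (lam'%:E <= lambda1 p s beta O)%E ->
  mfun u -> (forall x, 0 <= u x) -> (forall x, ~ O x -> u x = 0) -> 0 < h ->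
  igr m2 (aform p K u (fun x => Tk 1 (u x - Tk h (u x)))) ->
  (int2N (fun x y => ((if `[< Rh u h x y >] then 1 else 0) *
        `|u x - u y| `^ (p - 1) * knu p s beta x y)%R) <=
   (2 * Rintegral m2 setT (aform p K u (fun x => Tk 1 (u x - Tk h (u x)))))%:E)%E.
Proof.
move=> l0 hl mu_ u0 ou h0 ia.
have A := W0_admissible s01 p1 pN b0 bN oO bO O0 l0 hl.
have mk := @mf_knu R N p s beta; have mr := measurable_Rh h mu_.
have a0 z : 0 <= aform p K u (fun x => Tk 1 (u x - Tk h (u x))) z.
  apply: le_trans (aform_lip_mono A u z (Tk_excess_mono_lip ler01 (ltW h0))).
  exact: mulr_ge0 (K0 z) (powR_ge0 _ _).
rewrite int2NE; last by measf.
rewrite sint_ge0; last first.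
  by move=> z; rewrite mulr_ge0 ?knu_ge0 // mulr_ge0 ?powR_ge0 //; case: ifP.
have i2 := igrZ 2 ia; rewrite -Rint_Z // -EFin_Rintegral //.
apply: ge0_le_integral => //.
- by move=> z _; rewrite lee_fin mulr_ge0 ?knu_ge0 // mulr_ge0 ?powR_ge0 //; case: ifP.
- by apply/measurable_EFinP; measf.
- by apply/measurable_EFinP; exact: (igr_meas i2).
move=> z _; rewrite lee_fin; case: ifP => /asboolP hR; last first.
  by rewrite !mul0r mulr_ge0.
have key x y : h + 1 <= u x -> u y <= h ->
    1 * `|u x - u y| `^ (p - 1) * knu p s beta x y <=
    2 * aform p K u (fun x => Tk 1 (u x - Tk h (u x))) (x, y).
  move=> hx hy; have Ox : O x.
    by apply: contrapT => /ou e; move: hx h0; rewrite e; lra.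
  have T1 : Tk 1 (u x - Tk h (u x)) = 1.
    by rewrite (@Tk_geE _ h) ?Tk_geE //; lra.
  have T2 : Tk 1 (u y - Tk h (u y)) = 0.
    by rewrite (@Tk_id _ h) ?subrr ?Tk0 // ger0_norm.
  have D0 : 0 <= u x - u y by lra.
  rewrite /aform /= T1 T2 subr0 mulr1 Phi_ge0E // (ger0_norm D0) /nuK /= indDE (indic_in Ox).
  rewrite mul1r [1 * _]mul1r addrK mulr1.
  move: (knu _ _ _ _ _) (_ `^ _) => a b.
  by rewrite le_eqVlt; apply/orP; left; apply/eqP; field.
case: hR; rewrite (ger0_norm (u0 z.1)) (ger0_norm (u0 z.2)).
have [yx|xy] := leP (u z.1) (u z.2).
  move=> h1 [h2|]; last by rewrite ltNge mulr_ge0.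
  rewrite distrC knuC; apply: le_trans (key _ _ h1 h2) _.
  rewrite /aform nuKC -surjective_pairing /=.
  rewrite (_ : Phi p (u z.2 - u z.1) = - Phi p (u z.1 - u z.2)); last by rewrite -PhiN opprB.
  move: (K z) (Phi _ _) (Tk _ _) (Tk _ _) => a b c e.
  by rewrite le_eqVlt; apply/orP; left; apply/eqP; ring.
move=> h1 [h2|]; last by rewrite ltNge mulr_ge0.
by have := key _ _ h1 h2; rewrite -surjective_pairing.
Qed.

End concrete_translation.

Theorem theorem4p2 (R : realType) (N : nat) (s p beta : R)
  (O : set (N.-tuple R)) (lam : R) (g : N.-tuple R -> R) :
  0 < s < 1 -> 1 < p -> p < N%:R -> p * s < N%:R ->
  0 <= beta -> beta < (N%:R - p * s) / 2 ->
  smooth_bounded_domain O -> O [tuple (0 : R) | i < N] ->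
  0 < lam -> (lam%:E < lambda1 p s beta O)%E ->
  L1on O g -> aeN (fun x => O x -> 0 <= g x) ->
  ~ aeN (fun x => O x -> g x = 0) ->
  exists u : N.-tuple R -> R,
    nonneg_entropy_sol p s beta O lam g u /\
    forall ubar : N.-tuple R -> R, nonneg_entropy_sol p s beta O lam g ubar ->
      aeN (fun x => u x <= ubar x).
Proof.
move=> s01 p1 pN _ b0 bN [oO [_ [bO _]]] O0 lam0 hlam [mg hg] g0 _.
(* [lambda1] may be infinite, while the abstract theorem takes a real Poincare constant, so a real
   lam' above lam is fixed. *)
have [lam' [ll' hl']] : exists lam' : R, lam < lam' /\ (lam'%:E <= lambda1 p s beta O)%E.
  case: (lambda1 p s beta O) hlam => [r| |] //= h.
    by exists r; rewrite lte_fin in h; split.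
  by exists (lam + 1); rewrite ltrDl leey.
have l'0 : 0 < lam' by exact: lt_trans ll'.
have lamP : 0 < lam < lam' by rewrite lam0.
have A := W0_admissible s01 p1 pN b0 bN oO bO O0 l'0 hl'.
have mO := adm_mO A.
have m1O : measurable_fun setT (\1_O : N.-tuple R -> R) by exact: mf_indic.
have iL1 (f : N.-tuple R -> R) : meas f ->
    (intN (fun x => (\1_O x * `|f x|)%R) < +oo)%E <-> igr (muN N) (fun x => \1_O x * `|f x|).
  rewrite /meas => mf; have m : measurable_fun setT (fun x => \1_O x * `|f x|) by measf.
  rewrite intNE // sint_ge0; last by move=> x; rewrite mulr_ge0.
  by split=> h; [apply/igr_ge0P => // x; rewrite mulr_ge0|move/igr_ge0P: h; apply => // x; rewrite mulr_ge0].
(* g is nonnegative almost everywhere on O only; this modification is nonnegative at every point and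
   agrees with g on O up to a null set. *)
pose g' x := \1_O x * Num.max (g x) 0.
have g'0 x : 0 <= g' x by rewrite mulr_ge0 // le_max lexx orbT.
have mg' : measurable_fun setT g' by rewrite /meas in mg; rewrite /g'; measf.
have ig' : igr (muN N) g'.
  apply: (igr_le mg' _ (proj1 (iL1 _ mg) hg)) => x.
  by rewrite ger0_norm // ler_wpM2l // ge_max ler_norm normr_ge0.
have gg' : {ae muN N, forall x, \1_O x * g x = g' x}.
  move/aeNE: g0; apply: filterS => x hx; rewrite /g'.
  have [Ox|nx] := pselect (O x); last by rewrite indic_out // !mul0r.
  by rewrite max_l //; exact: hx.
have [u [[mu_ u0 ou] iu WT hu umin]] := minimal_entropy_solution A lamP ig' g'0.
exists u; split; last first.
  move=> v [mv [v0 [[mvp iv] [_ [ov [WTv [_ hv]]]]]]]; apply/aeNE; apply: umin => //.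
    move/iL1 : iv => /(_ mvp); apply: igr_le => // x.
    have [Ox|nx] := pselect (O x); first by rewrite indic_in // mul1r.
    by rewrite ov // powR0 ?normr0 ?mulr0 // gt_eqF // subr_gt0.
  move=> k M phi k0 Wphi hM.
  have iv' : igr (muN N) (fun x => v x `^ (p - 1)).
    move/iL1 : iv => /(_ mvp); apply: igr_le => // x.
    have [Ox|nx] := pselect (O x); first by rewrite indic_in // mul1r.
    by rewrite ov // powR0 ?normr0 ?mulr0 // gt_eqF // subr_gt0.
  have mphi := adm_meas A Wphi.
  have same : {ae muN N, forall x, phi x = phi x} by exact: nearW.
  have Li : Linf O phi by exists M; apply/aeNE; apply: nearW => x _; exact: hM.
  have := hv k phi k0 Wphi Li.
  rewrite (@entropy_form_translation R N p s beta O oO v phi phi k) //.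
  by rewrite (@datum_integral_translation R N p O p1 oO lam g g' mg ig' gg' v phi phi k).
have md := igr_datum lam ig' iu.
have d0 x : 0 <= datum p lam g' u x.
  by rewrite addr_ge0 // mulr_ge0 ?powR_ge0 // ltW.
split; [exact: mu_|split; [exact: u0|split]].
  have mup : meas (fun x => u x `^ (p - 1)) by rewrite /meas; measf.
  split; first exact: mup.
  apply/(iL1 _ mup); apply: (igr_le _ _ iu); first by rewrite /meas in mup; measf.
  move=> x; rewrite ger0_norm ?mulr_ge0 // ger0_norm ?powR_ge0 //.
  by rewrite ler_piMl ?powR_ge0 // indicE; case: (_ \in _).
split; [exact: mu_|split; [exact: ou|split; [exact: WT|split]]].
  (* A quarter, because the translation of the tail costs a factor 2 and the inequality to reach is
     strict. *)
  move=> e e0; have e40 : 0 < e / 4 by rewrite divr_gt0.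
  have [H H0 hH] := entropy_tail A mu_ u0 md d0 WT hu e40.
  exists H => h Hh; have [i1 l1] := hH h Hh.
  have h0 : 0 < h by exact: lt_le_trans Hh.
  apply: le_lt_trans (@tail_translation R N p s beta O s01 p1 pN b0 bN oO bO O0 lam' u h
    l'0 hl' mu_ u0 ou h0 i1) _.
  by rewrite lte_fin; move: (Rintegral _ _ _) l1 => a l1; lra.
move=> k phi k0 Wphi [M hM].
have mphi := adm_meas A Wphi.
(* phi is bounded almost everywhere on O only; truncation at |M| changes it on a null set and makes
   the bound hold everywhere. *)
pose phi' x := Tk `|M| (phi x).
have Wphi' : W0 p s beta O phi' := W0_Tk s01 p1 pN b0 bN oO bO O0 (normr_ge0 M) Wphi.
have mphi' := adm_meas A Wphi'.
have pp' : {ae muN N, forall x, phi x = phi' x}.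
  move/aeNE: hM; apply: filterS => x hx; rewrite /phi' Tk_id //.
  have [Ox|nx] := pselect (O x); first exact: le_trans (hx Ox) (ler_norm M).
  by rewrite (adm_out A Wphi nx) normr0.
rewrite (@entropy_form_translation R N p s beta O oO u phi phi' k) //.
rewrite (@datum_integral_translation R N p O p1 oO lam g g' mg ig' gg' u phi phi' k) //.
by apply: (hu k `|M| phi') => // x; exact: Tk_norm.
Qed.
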